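(* Let $T_0$ be a tiling of $\mathbb{R}^n$ which is strongly aperiodic, repetitive, and has finite local complexity, and let $\mathcal{S}$ be its associated inverse semigroup. Then the groupoid $\mathcal{R}_{punc}$ (translational equivalence on the punctured hull $\Omega_{punc}$ of $T_0$) and the tight groupoid $\mathcal{G}_{\mathrm{tight}}$ associated with $\mathcal{S}$ are isomorphic as topological groupoids. In particular, the tight C*-algebra $C^*(\mathcal{G}_{\mathrm{tight}})$ associated with $\mathcal{S}$ is isomorphic to the usual C*-algebra $C^*(\mathcal{R}_{punc})$ associated to the tiling.
   Context: **Tilings.** A tile is a subset of $\mathbb{R}^n$ homeomorphic to the closed unit ball (possibly carrying a label). A partial tiling is a collection of tiles whose interiors are pairwise disjoint; its support is the union of its tiles; a patch is a finite partial tiling; a tiling is a partial tiling with support $\mathbb{R}^n$. For a partial tiling $T$ and $U\subset\mathbb{R}^n$, $T(U)=\{t\in T: t\cap U\ne\emptyset\}$ and $T(x)=T(\{x\})$; $T+x=\{t+x: t\in T\}$ (labels are preserved by translation). $B(x,r)=B_r(x)$ is the ball of radius $r$ about $x$. It is assumed that $T_0$ has a finite set of prototiles $\mathcal{P}=\{p_1,\dots,p_N\}$: every tile of $T_0$ is $p_i+x$ for some $p_i\in\mathcal{P}$, $x\in\mathbb{R}^n$. Distinct prototiles are not translates of each other as labelled tiles, and each $p_i$ has the origin in its interior. If $t=p+x(t)$ with $p\in\mathcal{P}$, then $x(t)$ is called the puncture of $t$. **Hull.** The tiling metric is $d(T,T')=\inf\{1,\epsilon : \exists\, x,x'\in\mathbb{R}^n,\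 |x|,|x'|<\epsilon,\ (T-x)(B(0,1/\epsilon))=(T'-x')(B(0,1/\epsilon))\}$. The continuous hull $\Omega_{T_0}$ is the completion of $T_0+\mathbb{R}^n=\{T_0+x:x\in\mathbb{R}^n\}$ in this metric; it is identified with the set of all tilings $T'$ such that every patch in $T'$ is a translate of a patch in $T_0$, with the metric $d$. A tiling $T$ is periodic if $T+x=T$ for some $x\neq0$. **Assumptions.** $T_0$ has finite local complexity if for every $r>0$ the set $\{T_0(B(x,r)): x\in\mathbb{R}^n\}$ contains only finitely many patches modulo translation. $T_0$ is repetitive if for every patch $P\subset T_0$ there is $R>0$ such that for every $x\in\mathbb{R}^n$ there is $y\in\mathbb{R}^n$ with $P+y\subset T_0(B_R(x))$. $T_0$ is strongly aperiodic if $\Omega_{T_0}$ contains no periodic tilings. **Punctured hull and $\mathcal{R}_{punc}$.** $\Omega_{punc}\subset\Omega_{T_0}$ is the subspace of tilings in $\Omega_{T_0}$ that have a tile with puncture at the origin. $\mathcal{R}_{punc}=\{(T,T+x): T,\,T+x\in\Omega_{punc}\}$ is an equivalence relation, viewed as a groupoid with $(T,T')(T',T'')=(T,T'')$ and $(T,T')^{-1}=(T',T)$, and with the topology from $\Omega_{punc}\times\mathbb{R}^n$ obtained by identifying $(T,T+x)$ with $(T,x)$. **Inverse semigroup $\mathcal{S}$.** Let $\mathcal{M}$ be the set of patches $P$ that appear (up to translation) in $T_0$ and whose support has connected interior. For $P,Q\in\mathcal{M}$, $t_1,t_2\in P$, $s_1,s_2\in Q$, put $(t_1,P,t_2)\sim(s_1,Q,s_2)$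 if there is $x\in\mathbb{R}^n$ with $t_1+x=s_1$, $t_2+x=s_2$, $P+x=Q$; the class is $[t_1,P,t_2]$. Then $\mathcal{S}=\{[t_1,P,t_2]: P\in\mathcal{M},\ t_1,t_2\in P\}\cup\{0\}$. If there are $x,x'\in\mathbb{R}^n$ such that $P+x$ and $P'+x'$ are patches in $T_0$ and $t_2+x=t_1'+x'$, then $[t_1,P,t_2][t_1',P',t_2']=[t_1+x,(P+x)\cup(P'+x'),t_2'+x']$; otherwise the product is $0$; all products with $0$ are $0$. Also $[t_1,P,t_2]^*=[t_2,P,t_1]$, $0^*=0$. This is an inverse semigroup with zero. **Groupoid of germs.** An action of an inverse semigroup $\mathcal{S}$ on a locally compact Hausdorff space $X$ is a semigroup homomorphism $\theta$ from $\mathcal{S}$ to the inverse semigroup of bijections between subsets of $X$ such that each $\theta_s$ is continuous with open domain and the domains cover $X$. For an idempotent $e$ let $D_e$ be the domain of $\theta_e$. On $Y=\{(s,x)\in\mathcal{S}\times X: x\in D_{s^*s}\}$ put $(s,x)\sim(t,y)$ if $x=y$ and there is an idempotent $e$ with $x\in D_e$ and $se=te$; the class is $[s,x]$. The groupoid of germs is $\mathcal{G}=Y/\!\sim$ with composable pairs $([s,x],[t,y])$ with $x=\theta_t(y)$, product $[s,x][t,y]=[st,y]$, inverse $[s,x]^{-1}=[s^*,\theta_s(x)]$, and topology with basis the sets $\Theta(s,U)=\{[s,x]: x\in U\}$, $s\in\mathcal{S}$, $U\subseteq D_{s^*s}$ open. **Tight groupoid and tight C*-algebra.** Let $E$ be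 the set of idempotents of $\mathcal{S}$, ordered by $e\le f\iff e=ef$. A filter in $E$ is a non-empty $\xi\subset E$ with $0\notin\xi$, upward closed, and such that any $x,y\in\xi$ have a common lower bound in $\xi$; an ultra-filter is a filter not properly contained in another filter. A character is a non-zero map $\phi:E\to\{0,1\}$ with $\phi(ef)=\phi(e)\phi(f)$ and $\phi(0)=0$; $\hat E_0$ is the set of characters with the topology of pointwise convergence. Characters correspond bijectively to filters via $\phi\mapsto\{e:\phi(e)=1\}$. $\hat E_\infty$ is the set of characters corresponding to ultra-filters, and $\hat E_{tight}$ is its closure in $\hat E_0$. $\mathcal{S}$ acts on $\hat E_{tight}$ by $\theta_s:D_{s^*s}\to D_{ss^*}$, $\theta_s(\phi)(e)=\phi(s^*es)$, where $D_e=\{\phi\in\hat E_{tight}:\phi(e)=1\}$. The tight groupoid $\mathcal{G}_{\mathrm{tight}}$ is the groupoid of germs of this action. $C^*(\cdot)$ denotes the groupoid C*-algebra; $C^*(\mathcal{G}_{\mathrm{tight}})$ is the tight C*-algebra of $\mathcal{S}$. *)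

(* Defs.v *)
(* MathComp-Analysis; the reals are an arbitrary [R : realType]. *)
From HB Require Import structures.
From mathcomp Require Import all_boot all_order all_algebra.
From mathcomp Require Import complex.
From mathcomp Require Import all_classical all_reals all_analysis.

Set Implicit Arguments.
Unset Strict Implicit.
Unset Printing Implicit Defensive.
Import Order.TTheory GRing.Theory Num.Theory.
Import numFieldNormedType.Exports.
Local Open Scope classical_set_scope.
Local Open Scope ring_scope.
Local Open Scope complex_scope.

(* A groupoid is given by the graph of its partial product, [gmul a b c]
   meaning that (a, b) is composable with product c, and by its inverse map.
   Only the data are recorded: isomorphisms do not involve the axioms. *)
Record topgroupoid := TopGroupoid {
  gpd_sort :> topologicalType ;
  gmul : gpd_sort -> gpd_sort -> gpd_sort -> Prop ;
  ginv : gpd_sort -> gpd_sort }.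

Definition topgroupoid_iso (G H : topgroupoid) : Prop :=
  exists (phi : G -> H) (psi : H -> G),
    [/\ cancel phi psi /\ cancel psi phi,
        continuous phi /\ continuous psi,
        (forall a b c, gmul a b c <-> gmul (phi a) (phi b) (phi c)) &
        (forall a, phi (ginv a) = ginv (phi a))].

Section GroupoidAlgebra.
Context {R : realType} {G : topgroupoid}.
Implicit Types f g : G -> R[i].

Definition hausdorff_set (U : set G) : Prop :=
  forall x y, U x -> U y -> x <> y ->
    exists V W, [/\ open V, open W, V x, W y & U `&` V `&` W = set0].

(* Continuous functions with compact support on U, extended by zero. *)
Definition Cc_on (U : set G) : set (G -> R[i]) :=
  [set f | (exists K, [/\ compact K, K `<=` U &
                          forall x, ~ K x -> f x = 0]) /\
           (forall x, U x -> {for x, continuous (f : G -> (R[i])^o)})].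

(* Linear span of the Cc_on U, for U open and Hausdorff: the usual function
   algebra of an etale groupoid, which is not assumed to be Hausdorff; when G
   is Hausdorff this is just C_c(G). *)
Definition Cc : set (G -> R[i]) :=
  [set f | exists (m : nat) (h : 'I_m -> G -> R[i]),
     (forall i, exists U, [/\ open U, hausdorff_set U & Cc_on U (h i)]) /\
     f = (fun x => \sum_(i < m) h i x)].

Definition convolution f g : G -> R[i] := fun c =>
  \sum_(p \in [set p : G * G | gmul p.1 p.2 c]) f p.1 * g p.2.

Definition invol f : G -> R[i] := fun c => (f (ginv c))^*.

End GroupoidAlgebra.

Record hilbert (R : realType) := Hilbert {
  hil_sort :> lmodType R[i] ;
  ip : hil_sort -> hil_sort -> R[i] ;
  ip_linear : forall a x y z, ip (a *: x + y) z = a * ip x z + ip y z ;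
  ip_conj : forall x y, ip x y = (ip y x)^* ;
  ip_ge0 : forall x, 0 <= ip x x ;
  ip_eq0 : forall x, ip x x = 0 -> x = 0 ;
  hil_complete : forall u : nat -> hil_sort,
    (forall e : R, 0 < e -> exists N, forall m k, (N <= m)%N -> (N <= k)%N ->
       Num.sqrt (complex.Re (ip (u m - u k) (u m - u k))) < e) ->
    exists l, forall e : R, 0 < e -> exists N, forall m, (N <= m)%N ->
       Num.sqrt (complex.Re (ip (u m - l) (u m - l))) < e }.

Definition hnorm {R : realType} {H : hilbert R} (v : H) : R :=
  Num.sqrt (complex.Re (ip v v)).

(* pi is a *-representation of Cc on H by bounded operators; its values
   outside Cc are irrelevant. *)
Record star_rep (R : realType) (G : topgroupoid) (H : hilbert R)
    (pi : (G -> R[i]) -> H -> H) : Prop := StarRep {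
  rep_op_linear : forall f, Cc f ->
    forall (a : R[i]) v w, pi f (a *: v + w) = a *: pi f v + pi f w ;
  rep_op_bounded : forall f, Cc f ->
    exists M : R, forall v, hnorm (pi f v) <= M * hnorm v ;
  rep_linear : forall f g, Cc f -> Cc g -> forall (a : R[i]) v,
    pi (fun x => a * f x + g x) v = a *: pi f v + pi g v ;
  rep_conv : forall f g, Cc f -> Cc g ->
    forall v, pi (convolution f g) v = pi f (pi g v) ;
  rep_invol : forall f, Cc f ->
    forall v w, ip (pi f v) w = ip v (pi (invol f) w) }.

Section GroupoidCstar.
Context {R : realType} {G : topgroupoid}.
Implicit Types (f g : G -> R[i]) (u v : nat -> G -> R[i]).
Implicit Types A B : set (nat -> G -> R[i]).

(* sup of the operator norms of pi f over all *-representations pi *)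
Definition max_norm f : \bar R :=
  ereal_sup [set x | exists (H : hilbert R) (pi : (G -> R[i]) -> H -> H) (v : H),
    [/\ star_rep pi, hnorm v <= 1 & x = (hnorm (pi f v))%:E]].

Definition Cc_cauchy u : Prop :=
  (forall k, Cc (u k)) /\
  (forall e : R, 0 < e -> exists N, forall m k, (N <= m)%N -> (N <= k)%N ->
     (max_norm (u m \- u k)%R < e%:E)%E).

(* The point of the completion defined by the Cauchy sequence u. *)
Definition cauchy_class u : set (nat -> G -> R[i]) :=
  [set v | Cc_cauchy v /\ max_norm (u k \- v k) @[k --> \oo] --> 0%E].

(* C*(G): the Hausdorff completion of Cc for max_norm, a point being an
   equivalence class of Cauchy sequences. The operations are written on
   classes through all their representatives. *)
Definition cstar : set (set (nat -> G -> R[i])) :=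
  [set A | exists2 u, Cc_cauchy u & A = cauchy_class u].

Definition cstar_add A B : set (nat -> G -> R[i]) :=
  [set w | exists u v,
     [/\ A u, B v & cauchy_class (fun k => u k \+ v k) w]].

Definition cstar_scale (a : R[i]) A : set (nat -> G -> R[i]) :=
  [set w | exists2 u, A u & cauchy_class (fun k x => a * u k x) w].

Definition cstar_mul A B : set (nat -> G -> R[i]) :=
  [set w | exists u v,
     [/\ A u, B v & cauchy_class (fun k => convolution (u k) (v k)) w]].

Definition cstar_star A : set (nat -> G -> R[i]) :=
  [set w | exists2 u, A u & cauchy_class (fun k => invol (u k)) w].

End GroupoidCstar.
Arguments cstar R G : clear implicits.

(* Isometric *-isomorphism of C*(G) onto C*(H) *)
Definition cstar_iso (R : realType) (G H : topgroupoid) : Prop :=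
  exists Phi : set (nat -> G -> R[i]) -> set (nat -> H -> R[i]),
    set_bij (cstar R G) (cstar R H) Phi /\
    (forall A B, cstar R G A -> cstar R G B ->
      [/\ Phi (cstar_add A B) = cstar_add (Phi A) (Phi B),
          forall a, Phi (cstar_scale a A) = cstar_scale a (Phi A),
          Phi (cstar_mul A B) = cstar_mul (Phi A) (Phi B),
          Phi (cstar_star A) = cstar_star (Phi A) &
          forall u v, A u -> Phi A v ->
            lim (max_norm (u k) @[k --> \oo]) =
            lim (max_norm (v k) @[k --> \oo])]).

(* The data of an inverse semigroup with zero: the subset [isg_elt] of an
   ambient type on which the operations are defined. *)
Record invsemigroup := InvSemigroup {
  isg_sort :> Type ;
  isg_elt : set isg_sort ;
  smul : isg_sort -> isg_sort -> isg_sort ;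
  sstar : isg_sort -> isg_sort ;
  szero : isg_sort }.
Arguments szero : clear implicits.
Arguments isg_elt : clear implicits.

Definition idempotents (S : invsemigroup) : set S :=
  [set e | isg_elt S e /\ smul e e = e].
Arguments idempotents : clear implicits.

Section Germs.
(* [act s x y] means that theta_s is defined at x, with theta_s(x) = y;
   [D e] is the domain of theta_e for e idempotent, so that the domain of
   theta_s is [D (s^* s)]. *)
Context (S : invsemigroup) (X : topologicalType).
Context (D : S -> set X) (act : S -> X -> X -> Prop).

Definition germ_pair (s : S) (x : X) : Prop :=
  isg_elt S s /\ D (smul (sstar s) s) x.

Definition germ (s : S) (x : X) : set (S * X) :=
  [set p | germ_pair p.1 p.2 /\ x = p.2 /\
     exists e, [/\ idempotents S e, D e x & smul s e = smul p.1 e]].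

Definition is_germ : set (set (S * X)) :=
  [set g | exists s x, germ_pair s x /\ g = germ s x].

Definition germs : Type := set_type is_germ.
HB.instance Definition _ := Choice.on germs.

Definition germ_mul (g h k : germs) : Prop :=
  exists s t x y,
    [/\ germ_pair s x, germ_pair t y, act t y x,
        set_val g = germ s x /\ set_val h = germ t y &
        set_val k = germ (smul s t) y].

(* The germ [s^*, theta_s(x)], for g = [s, x]. *)
Definition germ_inv (g : germs) : germs :=
  xget g [set h | exists s x y,
    [/\ germ_pair s x, set_val g = germ s x, act s x y &
        set_val h = germ (sstar s) y]].

Definition germ_basic (s : S) (U : set X) : set germs :=
  [set g | exists2 x, U x & set_val g = germ s x].

Definition germ_base : set (set germs) :=
  [set W | exists s U, [/\ isg_elt S s, open U,
     U `<=` D (smul (sstar s) s) & W = germ_basic s U]].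

(* The topology generated by the sets Theta(s, U). *)
HB.instance Definition _ :=
  @isSubBaseTopological.Build germs (set germs) germ_base id.

Definition germ_groupoid : topgroupoid := TopGroupoid germ_mul germ_inv.

End Germs.

Section Tight.
Context (S : invsemigroup).
Local Notation E := (idempotents S).

Definition idem_le (e f : S) : Prop := e = smul e f.

Definition sfilter (xi : set S) : Prop :=
  [/\ xi `<=` E /\ xi !=set0, ~ xi (szero S),
      (forall e f, xi e -> E f -> idem_le e f -> xi f) &
      (forall e f, xi e -> xi f ->
         exists2 d, xi d & idem_le d e /\ idem_le d f)].

Definition ultra_sfilter (xi : set S) : Prop :=
  sfilter xi /\ forall zeta, sfilter zeta -> xi `<=` zeta -> zeta = xi.

(* A map E -> {0,1} is encoded by its extension by 0 to the ambient type. *)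
Definition characters : set {ptws S -> bool} :=
  [set phi : {ptws S -> bool} | [/\ forall e, phi e -> E e, exists e, phi e,
     (forall e f, E e -> E f -> phi (smul e f) = phi e && phi f) &
     phi (szero S) = false]].

Definition ultracharacters : set {ptws S -> bool} :=
  [set phi : {ptws S -> bool} | characters phi /\ ultra_sfilter [set e | phi e]].

(* Closure in the space of characters. *)
Definition tight_characters : set {ptws S -> bool} :=
  characters `&` closure ultracharacters.

Definition tight_dom (e : S) : set (set_type tight_characters) :=
  [set phi : set_type tight_characters | (set_val phi : S -> bool) e].

Definition tight_act (s : S) (phi psi : set_type tight_characters) : Prop :=
  tight_dom (smul (sstar s) s) phi /\
  forall e, E e ->
    (set_val psi : S -> bool) e =
    (set_val phi : S -> bool) (smul (smul (sstar s) e) s).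

Definition tight_groupoid : topgroupoid := germ_groupoid tight_dom tight_act.

End Tight.

Section Tilings.
Context {R : realType} {n : nat} {L : Type}.
Local Notation V := 'rV[R]_n.

Definition enorm (x : V) : R := Num.sqrt (\sum_(i < n) x ord0 i ^+ 2).

Definition eball (x : V) (r : R) : set V := [set y | enorm (y - x) < r].

Definition homeomorphic (A B : set V) : Prop :=
  exists f g : V -> V,
    [/\ {within A, continuous f}, {within B, continuous g},
        set_fun A B f, set_fun B A g &
        {in A, cancel f g} /\ {in B, cancel g f}].

(* A labelled tile; unlabelled tiles correspond to [L := unit]. *)
Definition ltile : Type := (set V * L)%type.

Definition is_tile (t : ltile) : Prop :=
  homeomorphic t.1 [set x | enorm x <= 1].

Definition ttranslate (t : ltile) (x : V) : ltile := ([set y + x | y in t.1], t.2).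

Definition translate (T : set ltile) (x : V) : set ltile :=
  [set ttranslate t x | t in T].

Definition tiling_support (T : set ltile) : set V := \bigcup_(t in T) t.1.

Definition partial_tiling (T : set ltile) : Prop :=
  (forall t, T t -> is_tile t) /\
  (forall t s, T t -> T s -> t <> s -> t.1° `&` s.1° = set0).

Definition tiling (T : set ltile) : Prop :=
  partial_tiling T /\ tiling_support T = setT.

Definition is_patch (P : set ltile) : Prop := partial_tiling P /\ finite_set P.

Definition meeting (T : set ltile) (U : set V) : set ltile :=
  [set t | T t /\ t.1 `&` U !=set0].

(* [protos] is the finite set of prototiles of T. *)
Definition has_prototiles (T protos : set ltile) : Prop :=
  [/\ finite_set protos,
      (forall p, protos p -> is_tile p /\ p.1° 0),
      (forall p q x, protos p -> protos q -> q = ttranslate p x -> p = q) &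
      (forall t, T t -> exists2 p, protos p & exists x, t = ttranslate p x)].

(* The second set only contains positive numbers, since enorm x < e. *)
Definition tdist (T T' : set ltile) : R :=
  inf ([set 1] `|` [set e | exists x x',
    [/\ enorm x < e, enorm x' < e &
        meeting (translate T (- x)) (eball 0 e^-1) =
        meeting (translate T' (- x')) (eball 0 e^-1)]]).

(* The completion of the orbit T0 + R^n for tdist, in its concrete form. *)
Definition in_hull (T0 : set ltile) : set (set ltile) :=
  [set T | tiling T /\
     forall P, is_patch P -> P `<=` T -> exists x, translate P x `<=` T0].

Definition periodic_tiling (T : set ltile) : Prop := exists2 x, x <> 0 & translate T x = T.

Definition finite_local_complexity (T0 : set ltile) : Prop :=
  forall r : R, 0 < r -> exists F : set (set ltile),
    [/\ finite_set F, (forall P, F P -> is_patch P) &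
        forall x, exists2 P, F P & exists y, meeting T0 (eball x r) = translate P y].

Definition repetitive (T0 : set ltile) : Prop :=
  forall P, is_patch P -> P `<=` T0 -> exists2 r : R, 0 < r &
    forall x, exists y, translate P y `<=` meeting T0 (eball x r).

Definition strongly_aperiodic (T0 : set ltile) : Prop :=
  forall T, in_hull T0 T -> ~ periodic_tiling T.

Lemma translate0 T : translate T 0 = T.
Proof.
have t0 t : ttranslate t 0 = t.
  case: t => A l; rewrite /ttranslate /=; congr pair; apply/seteqP; split => y /=.
    by move=> [z Az <-]; rewrite addr0.
  by move=> Ay; exists y => //; rewrite addr0.
apply/seteqP; split => t /=; first by move=> [s Ts <-]; rewrite t0.
by move=> Tt; exists t.
Qed.

Lemma translateD T x y : translate (translate T x) y = translate T (x + y).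
Proof.
have tD t : ttranslate (ttranslate t x) y = ttranslate t (x + y).
  case: t => A l; rewrite /ttranslate /=; congr pair; apply/seteqP; split => z /=.
    by move=> [_ [w Aw <-] <-]; exists w => //; rewrite addrA.
  by move=> [w Aw <-]; exists (w + x); [exists w | rewrite addrA].
apply/seteqP; split => t /=.
  by move=> [_ [s Ts <-] <-]; exists s.
by move=> [s Ts <-]; exists (ttranslate s x); [exists s | rewrite tD].
Qed.

Definition hull (T0 : set ltile) : Type := set_type (in_hull T0).
HB.instance Definition _ (T0 : set ltile) := gen_eqMixin (hull T0).
HB.instance Definition _ (T0 : set ltile) := gen_choiceMixin (hull T0).

Section HullTopology.
Context (T0 : set ltile).

Definition hull_open (U : set (hull T0)) : Prop :=
  forall T, U T -> exists2 r : R, 0 < r &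
    forall T', tdist (set_val T) (set_val T') < r -> U T'.

Lemma hull_openT : hull_open setT.
Proof. by move=> T _; exists 1. Qed.

Lemma hull_openI U W : hull_open U -> hull_open W -> hull_open (U `&` W).
Proof.
move=> oU oW T [/oU[r r0 rU] /oW[s s0 sW]]; exists (Num.min r s).
  by rewrite lt_min r0 s0.
by move=> T'; rewrite lt_min => /andP[/rU UT' /sW WT'].
Qed.

Lemma hull_open_bigU (I : Type) (U : I -> set (hull T0)) :
  (forall i, hull_open (U i)) -> hull_open (\bigcup_i U i).
Proof.
by move=> oU T [i _ /oU[r r0 rU]]; exists r => // T' /rU UT'; exists i.
Qed.

(* The topology of the metric tdist. *)
HB.instance Definition _ :=
  isOpenTopological.Build (hull T0) hull_openT hull_openI hull_open_bigU.

End HullTopology.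

Section PuncturedHull.
Context (T0 protos : set ltile).

(* A tile with puncture at the origin is a prototile. *)
Definition in_hull_punc : set (hull T0) :=
  [set T | exists2 p, protos p & set_val T p].

(* with the subspace topology *)
Definition hull_punc : Type := set_type in_hull_punc.
HB.instance Definition _ := Topological.on hull_punc.

Definition tiling_of (T : hull_punc) : set ltile := set_val (set_val T).

Definition translates : set (hull_punc * hull_punc) :=
  [set p | exists x, tiling_of p.2 = translate (tiling_of p.1) x].

Definition Rpunc_pairs : Type := {p : hull_punc * hull_punc | translates p}.
HB.instance Definition _ := gen_eqMixin Rpunc_pairs.
HB.instance Definition _ := gen_choiceMixin Rpunc_pairs.

(* (T, T + x) |-> (T, x); x is unique when T0 is strongly aperiodic. *)
Definition Rpunc_coord (p : Rpunc_pairs) : hull_punc * V :=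
  ((sval p).1,
   xget 0 [set x | tiling_of (sval p).2 = translate (tiling_of (sval p).1) x]).

(* The topology carried over from hull_punc * R^n along Rpunc_coord. *)
HB.instance Definition _ :=
  Topological.copy Rpunc_pairs (initial_topology Rpunc_coord).

Definition Rpunc_mul (a b c : Rpunc_pairs) : Prop :=
  (sval a).2 = (sval b).1 /\ sval c = ((sval a).1, (sval b).2).

Lemma translates_sym p : translates p -> translates (p.2, p.1).
Proof. by move=> [x e]; exists (- x); rewrite /= e translateD subrr translate0. Qed.

Definition Rpunc_inv (a : Rpunc_pairs) : Rpunc_pairs :=
  exist _ _ (translates_sym (svalP a)).

Definition Rpunc : topgroupoid := TopGroupoid Rpunc_mul Rpunc_inv.

End PuncturedHull.

Section TilingSemigroup.
Context (T0 : set ltile).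

Definition connected_patches : set (set ltile) :=
  [set P | [/\ is_patch P, exists x, translate P x `<=` T0 & connected (tiling_support P)°]].

Definition ptriple : Type := (ltile * set ltile * ltile)%type.

(* The class [t1, P, t2]. *)
Definition pclass (t1 : ltile) (P : set ltile) (t2 : ltile) : set ptriple :=
  [set w | exists x, w = (ttranslate t1 x, translate P x, ttranslate t2 x)].

(* Elements are classes of triples, and the zero is the empty set. *)
Definition psemigroup_elt : set (set ptriple) :=
  [set a | a = set0 \/
     exists t1 P t2, [/\ connected_patches P, P t1, P t2 & a = pclass t1 P t2]].

(* When x and x' as required exist, x - x' is determined by t2 and t1' and the
   set below is a single class; otherwise it is empty, that is, the zero. *)
Definition pmul (a b : set ptriple) : set ptriple :=
  [set w | exists t1 P t2 t1' P' t2' x x',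
     [/\ a (t1, P, t2), b (t1', P', t2'),
         translate P x `<=` T0 /\ translate P' x' `<=` T0,
         ttranslate t2 x = ttranslate t1' x' &
         pclass (ttranslate t1 x) (translate P x `|` translate P' x') (ttranslate t2' x') w]].

Definition pstar (a : set ptriple) : set ptriple :=
  [set w | a (w.2, w.1.2, w.1.1)].

Definition tiling_semigroup : invsemigroup :=
  InvSemigroup psemigroup_elt pmul pstar set0.

End TilingSemigroup.

End Tilings.
Arguments ltile : clear implicits.

(* Main.v *)
From HB Require Import structures.
Require Import Defs.
From mathcomp Require Import all_boot all_order all_algebra.
From mathcomp Require Import complex.
From mathcomp Require Import all_classical all_reals all_analysis.
From mathcomp Require Import ring lra.

(* A tile is the closure of a connected open set: by invariance of domain the
   homeomorphism with the closed ball maps the open ball onto an open set.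
   (Invariance of domain is deduced, after Kulpa, from the Poincare-Miranda
   theorem, and the latter from a discrete version, a mod 2 Stokes formula for
   cup products on a grid.) Hence the tiles of a tiling [T] that meet a ball
   around the origin form a patch whose support has connected interior, and such
   patches exhaust [T].

   By finite local complexity, the tight characters of the semigroup are then
   exactly the characters [chi T], [chi T [p, P, p] = 1 <-> P <= T], of the
   punctured tilings [T], with [p] the tile of [T] at the origin, and [chi] is a
   homeomorphism. If [P <= T] and [p, t] are in [P], with [p] at the origin,
   then the germ of [[t, P, p]] at [chi T] only depends on [T] and [t], and it
   goes from [T] to the translate [T - x] having the puncture of [t] at the
   origin. Strong aperiodicity makes [x] a function of the pair [(T - x, T)], so
   that germs are the same as arrows of [Rpunc]. *)
Set Implicit Arguments.
Unset Strict Implicit.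
Unset Printing Implicit Defensive.
Import Order.TTheory GRing.Theory Num.Theory.
Import numFieldNormedType.Exports.
Local Open Scope ring_scope.

(** * Discrete Poincare-Miranda theorem *)

(** A homeomorphism of a tile with the closed ball says nothing by itself about the interior of the
    tile in the ambient space, while membership in the semigroup is decided by connected interiors
    of supports: hence the need for invariance of domain. Products stay among the allowed patches
    because the union of two patches sharing a tile again has connected interior.

    Infinite tilings are reached through balls around the origin. The tiles of a tiling that meet
    such a ball cover it, so another tiling containing them has no further tile meeting the ball.
    For each radius finite local complexity leaves finitely many idempotents of this kind. An
    ultracharacter takes the value 1 on one of them, and such a condition on finitely many
    coordinates passes to the closure.

    The hull metric allows small translations, but a prototile at the origin excludes them. The
    displacement is therefore locally constant on arrows, which reconciles the topology taken from
    $\mathbb{R}^n$ with that of germs. A germ from $T'$ to $T$ stands for the pair $(T,T')$, the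
    order in which the two compositions agree. *)

Section DiscreteMiranda.
Variables (D : finType) (N : nat).
Local Notation vertex := (D -> nat).
Local Notation cochain := ({set D} -> vertex -> 'F_2).
Implicit Types (v : vertex) (a b : D) (A : {set D}).

Definition upd v a (k : nat) : vertex := fun d => if d == a then k else v d.
Definition stepv v a : vertex := upd v a (v a).+1.

(* Cubical cochains mod 2 on the grid: [c A v] is the value on the cube with
   base vertex [v] and directions [A]; [cup g c] is the cup product [dg u c]. *)
Definition coboundary (c : cochain) : cochain := fun A v =>
  \sum_(b in A) (c (A :\ b) (stepv v b) - c (A :\ b) v).

Definition cup (g : vertex -> 'F_2) (c : cochain) : cochain := fun A v =>
  \sum_(b in A) (g (stepv v b) - g v) * c (A :\ b) (stepv v b).

Lemma updC v a b k l : a != b -> upd (upd v a k) b l = upd (upd v b l) a k.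
Proof.
move=> ab; apply/funext => d; rewrite /upd; have [->|//] := eqVneq d b.
by rewrite eq_sym (negbTE ab).
Qed.

Lemma updd v a k l : upd (upd v a k) a l = upd v a l.
Proof. by apply/funext => d; rewrite /upd; case: eqP. Qed.

Lemma updE v a k : upd v a k a = k.
Proof. by rewrite /upd eqxx. Qed.

Lemma updN v a b k : b != a -> upd v a k b = v b.
Proof. by rewrite /upd => /negbTE ->. Qed.

Lemma stepvC v a b : stepv (stepv v a) b = stepv (stepv v b) a.
Proof.
have [->//|ab] := eqVneq a b; rewrite /stepv (updC _ _ _ ab) !updN //.
by rewrite eq_sym.
Qed.

Lemma F2_addxx (x : 'F_2) : x + x = 0.
Proof. exact/addrr_pchar2/pchar_Fp. Qed.

(** Expanded over two directions, the sum has terms [h a b] that are symmetric in [a] and [b]; each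
    unordered pair occurs twice and cancels mod 2. The order [enum_rank] only serves to split the
    pairs into two halves exchanged by the symmetry. *)
Lemma coboundary2 (c : cochain) A v : coboundary (coboundary c) A v = 0.
Proof.
pose h a b := c (A :\ a :\ b) (stepv (stepv v a) b) + c (A :\ a :\ b) (stepv v a)
  + c (A :\ a :\ b) (stepv v b) + c (A :\ a :\ b) v.
have hC a b : h a b = h b a.
  have -> : h b a = c (A :\ b :\ a) (stepv (stepv v b) a) + c (A :\ b :\ a) (stepv v a)
  + c (A :\ b :\ a) (stepv v b) + c (A :\ b :\ a) v.
    by rewrite /h; congr (_ + _); rewrite -!addrA; congr (_ + _); rewrite addrC.
  by rewrite /h !finset.setDDl (finset.setUC [set a]) stepvC.
have opp2 (x : 'F_2) : - x = x by apply/eqP; rewrite eq_sym -addr_eq0 F2_addxx.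
have -> : coboundary (coboundary c) A v =
    \sum_(a in A) \sum_(b in A | b != a) h a b.
  rewrite /coboundary; apply: eq_bigr => a aA; rewrite -sumrB.
  apply: eq_big => [b|b _]; first by rewrite !inE andbC.
  by rewrite !opp2 /h -!addrA.
have key : \sum_(a in A) \sum_(b in A | b != a) h a b =
  \sum_(a in A) \sum_(b in A | (enum_rank b < enum_rank a)%N) h a b +
  \sum_(a in A) \sum_(b in A | (enum_rank a < enum_rank b)%N) h a b.
  rewrite -big_split /=; apply: eq_bigr => a aA.
  rewrite (bigID (fun b => (enum_rank b < enum_rank a)%N)) /=.
  congr (_ + _); apply: eq_bigl => b; rewrite -andbA; congr (_ && _).
    by case: eqVneq => // ->; rewrite ltnn.
  rewrite -leqNgt leq_eqVlt; case: (eqVneq b a) => [->|ba] /=.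
    by rewrite ltnn.
  suff /negbTE -> : (enum_rank a != enum_rank b :> nat) by [].
  by apply: contraNneq ba => /ord_inj/enum_rank_inj ->.
rewrite key; set S1 := (X in X + _); suff -> : \sum_(a in A)
  \sum_(b in A | (enum_rank a < enum_rank b)%N) h a b = S1 by rewrite F2_addxx.
rewrite /S1 [in RHS](exchange_big_dep (mem A)) //=.
  by apply: eq_bigr => a aA; apply: eq_big => [b|b _]; [rewrite !aA|rewrite hC].
by move=> i j iA /andP[].
Qed.

(** Leibniz rule $dg \cup c = \delta(gc) - g\,\delta c$ for a function [g]. *)
Lemma cupE g c A v :
  cup g c A v = coboundary (fun B w => g w * c B w) A v - g v * coboundary c A v.
Proof.
rewrite /cup /coboundary mulr_sumr -sumrB; apply: eq_bigr => b bA.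
by rewrite mulrBl mulrBr opprB addrA subrK.
Qed.

Variable f : D -> vertex -> 'F_2.

Fixpoint cups (s : seq D) : cochain :=
  if s is a :: s' then cup (f a) (cups s') else fun A _ => (A == finset.set0)%:R.

Lemma cups_cocycle s A v : coboundary (cups s) A v = 0.
Proof.
elim: s A v => [|a s IHs] A v; first by rewrite /coboundary big1 // => b _; exact: subrr.
transitivity (coboundary (coboundary (fun B w => f a w * cups s B w)) A v); last first.
  exact: coboundary2.
by apply: eq_bigr => b bA /=; rewrite !cupE !IHs !mulr0 !subr0.
Qed.

(* [cups] of a nonempty list is exact, so its sum over a grid is a boundary
   term, where it reduces to [cups] of the tail. *)
Lemma cups_cons a s A v :
  cups (a :: s) A v = coboundary (fun B w => f a w * cups s B w) A v.
Proof. by rewrite /= cupE cups_cocycle mulr0 subr0. Qed.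

(** Since [b] is not a direction of the cube, all its vertices keep the coordinate [k] in direction
    [b]; there [f b] is constant, and its factor in the cup product is a difference of equal
    values. *)
Lemma cups_face s b A v (k : nat) (x : 'F_2) :
  (forall u, u b = k -> f b u = x) -> b \in s -> b \notin A -> v b = k ->
  cups s A v = 0.
Proof.
move=> fb; elim: s A v => // a s IHs A v; rewrite in_cons => bs bA vb /=.
rewrite /cup big1 // => c cA.
have vcb : stepv v c b = k.
  by rewrite /stepv updN //; apply: contraNneq bA => ->.
have [eab|ab] := eqVneq b a; first by rewrite -eab !fb // subrr mul0r.
rewrite IHs ?mulr0 //; first by move: bs; rewrite (negbTE ab).
by rewrite !inE (negbTE bA) andbF.
Qed.

Definition in_cube v A (u : vertex) :=
  forall d, (v d <= u d <= v d + (d \in A))%N.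

(** A nonzero term of the iterated cup product is an edge path inside the cube, along which the
    functions of the list change value one after the other. *)
Lemma cups_vary s A v : cups s A v != 0 -> forall a, a \in s ->
  exists u w, [/\ in_cube v A u, in_cube v A w & f a u != f a w].
Proof.
elim: s A v => // a s IHs A v; rewrite /= /cup.
have [/existsP[b /andP[bA]]|/existsPn nz] := boolP [exists b, (b \in A) &&
    ((f a (stepv v b) - f a v) * cups s (A :\ b) (stepv v b) != 0)]; last first.
  rewrite big1 ?eqxx // => b bA; apply/eqP; have := nz b.
  by rewrite bA /= negbK.
rewrite mulf_eq0 negb_or => /andP[fab nz] _ c.
have cube u : in_cube (stepv v b) (A :\ b) u -> in_cube v A u.
  move=> h d; move: (h d); rewrite /stepv /upd !inE.
  by have [->/=|/=] := eqVneq d b; rewrite ?bA // addn0 addn1 => /andP[/ltnW -> ->].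
rewrite in_cons => /orP[/eqP->|cs].
  exists (stepv v b), v; split; last by rewrite -subr_eq0.
    by apply: cube => d; rewrite leqnn leq_addr.
  by move=> d; rewrite leqnn leq_addr.
by have [u [w [/cube uA /cube wA uw]]] := IHs _ _ nz _ cs; exists u, w.
Qed.

(** * Sums of cochains over the grid *)

Definition lsum a (g : vertex -> 'F_2) : vertex -> 'F_2 :=
  fun v => \sum_(k < N) g (upd v a k).

Fixpoint lsums (s : seq D) (g : vertex -> 'F_2) : vertex -> 'F_2 :=
  if s is a :: s' then lsums s' (lsum a g) else g.

Lemma lsumC a b g : lsum a (lsum b g) = lsum b (lsum a g).
Proof.
have [->//|ab] := eqVneq a b.
apply/funext => v; rewrite /lsum exchange_big /=.
by apply: eq_bigr => i _; apply: eq_bigr => j _; rewrite updC.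
Qed.

Lemma lsum0 a : lsum a (fun=> 0) = fun=> 0.
Proof. by apply/funext => v; rewrite /lsum big1. Qed.

Lemma lsums0 s : lsums s (fun=> 0) = fun=> 0.
Proof. by elim: s => //= a s; rewrite lsum0. Qed.

Lemma lsums_eq0 s b g : b \in s -> lsum b g = (fun=> 0) -> lsums s g = fun=> 0.
Proof.
elim: s g => //= a s IHs g; rewrite in_cons => /orP[/eqP -> ->|bs gb].
  exact: lsums0.
by apply: IHs => //; rewrite lsumC gb lsum0.
Qed.

Lemma lsumsD s g h :
  lsums s (fun v => g v + h v) = (fun v => lsums s g v + lsums s h v).
Proof.
elim: s g h => //= a s IHs g h; rewrite -IHs; congr lsums.
by apply/funext => v; rewrite /lsum big_split.
Qed.

Lemma lsums_sum s (I : Type) (r : seq I) (P : pred I) (G : I -> vertex -> 'F_2) :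
  lsums s (fun v => \sum_(i <- r | P i) G i v) =
  (fun v => \sum_(i <- r | P i) lsums s (G i) v).
Proof.
elim: r => [|i r IHr].
  transitivity (lsums s (fun=> 0)); last first.
    by rewrite lsums0; apply/funext => v; rewrite big_nil.
  by congr lsums; apply/funext => v; rewrite big_nil.
transitivity (lsums s (fun v => (if P i then G i v else 0) +
                                \sum_(j <- r | P j) G j v)).
  by congr lsums; apply/funext => v; rewrite big_cons; case: ifP; rewrite ?add0r.
rewrite lsumsD IHr; apply/funext => v; rewrite big_cons.
by case: ifP => //; rewrite lsums0 add0r.
Qed.

Lemma lsums_upd s a g k : a \notin s ->
  lsums s (fun v => g (upd v a k)) = (fun v => lsums s g (upd v a k)).
Proof.
elim: s g => //= b s IHs g; rewrite in_cons negb_or => /andP[ab /IHs <-].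
congr lsums; apply/funext => v; rewrite /lsum; apply: eq_bigr => i _.
by rewrite updC // eq_sym.
Qed.

Lemma lsum_telescope a (g : vertex -> 'F_2) v :
  lsum a (fun v => g (stepv v a) - g v) v = g (upd v a N) - g (upd v a 0).
Proof.
rewrite /lsum -(big_mkord xpredT (fun i => g (stepv (upd v a i) a) - g (upd v a i))).
rewrite -(telescope_sumr (fun i => g (upd v a i))) //.
by apply: eq_bigr => i _; rewrite /stepv updE updd.
Qed.

Lemma lsums_neq0 s g v : lsums s g v != 0 ->
  exists w, [/\ forall d, d \in s -> (w d < N)%N,
    forall d, d \notin s -> w d = v d & g w != 0].
Proof.
elim: s g v => [|a s IHs] g v /=; first by exists v.
move=> /IHs[w [wN ws]]; rewrite /lsum => nz.
have [/existsP[k gk]|/existsPn g0] := boolP [exists k : 'I_N, g (upd w a k) != 0];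
  last by rewrite big1 ?eqxx // in nz => k _; apply/eqP; have := g0 k; rewrite negbK.
 exists (upd w a k); split => // d; rewrite in_cons.
  by rewrite /upd; case: eqP => //= _; exact: wN.
by rewrite negb_or => /andP[da ds]; rewrite updN // ws.
Qed.

Hypothesis f0 : forall a v, v a = 0%N -> f a v = 0.
Hypothesis fN : forall a v, v a = N -> f a v = 1.

(** Discrete Stokes formula: the cup product is a coboundary, and only faces of the grid contribute.
    On the faces normal to [b] in the tail, [cups_face] applies; on [v a = 0] the factor [f a]
    vanishes; on [v a = N] it is 1 and leaves the same sum for the tail. *)
Lemma lsums_cups s v : uniq s -> lsums s (cups s [set d in s]) v = 1.
Proof.
elim: s v => [|a s IHs] v /=; first by rewrite /= (_ : [set d in [::]] = finset.set0) ?eqxx //;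
  apply/finset.setP => d; rewrite !inE.
move=> /andP[as_ us].
have -> : lsum a (cups (a :: s) [set d in a :: s]) = fun v =>
   lsum a (fun v => \sum_(b in [set d in a :: s])
     (f a (stepv v b) * cups s ([set d in a :: s] :\ b) (stepv v b) -
      f a v * cups s ([set d in a :: s] :\ b) v)) v.
  by apply/funext => w; rewrite /lsum; apply: eq_bigr => i _; rewrite cups_cons.
set G := fun b v => f a (stepv v b) * cups s ([set d in a :: s] :\ b) (stepv v b) -
      f a v * cups s ([set d in a :: s] :\ b) v.
have -> : lsums s (fun v => lsum a (fun v => \sum_(b in [set d in a :: s]) G b v) v) =
  lsums (a :: s) (fun v => \sum_(b in [set d in a :: s]) G b v) by [].
rewrite lsums_sum (bigD1 a) ?inE ?eqxx //= [X in _ + X]big1 ?addr0; last first.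
  move=> b; rewrite !inE => /andP[+ ba]; rewrite (negbTE ba) /= => bs.
  rewrite (_ : lsums s _ = fun=> 0) //; apply: (@lsums_eq0 (a :: s) b (G b)).
    by rewrite in_cons bs orbT.
  apply/funext => w; rewrite /G.
  rewrite [LHS](lsum_telescope b (fun w => f a w * cups s ([set d in a :: s] :\ b) w)).
  have bA : b \notin [set d in a :: s] :\ b by rewrite !inE eqxx.
  rewrite (cups_face (@fN b) bs bA (updE _ _ _)).
  rewrite (cups_face (@f0 b) bs bA (updE _ _ _)).
  by rewrite !mulr0 subrr.
have -> : lsum a (G a) = fun w => cups s [set d in s] (upd w a N).
  apply/funext => w; rewrite /G.
  rewrite [LHS](lsum_telescope a (fun w => f a w * cups s ([set d in a :: s] :\ a) w)).
  rewrite fN ?updE // f0 ?updE // mul0r subr0 mul1r; congr cups.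
  apply/finset.setP => d; rewrite !inE; have [->/=|//] := eqVneq d a.
  by rewrite (negbTE as_).
by rewrite lsums_upd // IHs.
Qed.

End DiscreteMiranda.

(** The cup product of all the labels has total sum 1, so it is nonzero on some cube of the grid,
    and on that cube no label is constant. *)
Lemma discrete_miranda (D : finType) (N : nat) (f : D -> (D -> nat) -> bool) :
  (forall a v, v a = 0%N -> f a v = false) ->
  (forall a v, v a = N -> f a v = true) ->
  exists v : D -> nat, (forall d, (v d < N)%N) /\
    forall a, exists u w, [/\ forall d, (v d <= u d <= v d + 1)%N,
      forall d, (v d <= w d <= v d + 1)%N, f a u = false & f a w = true].
Proof.
move=> f0 fN; pose g a v : 'F_2 := (f a v)%:R.
have := @lsums_cups D N g _ _ (enum D) (fun=> 0%N) (enum_uniq D).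
move=> /(_ (fun a v va => congr1 (fun b : bool => b%:R) (f0 a v va))).
move=> /(_ (fun a v va => congr1 (fun b : bool => b%:R) (fN a v va))) h1.
have /lsums_neq0 [v [vN _ vary]] : lsums N (enum D)
   (cups g (enum D) [set d in enum D]) (fun=> 0%N) != 0 by rewrite h1.
exists v; split=> [d|a]; first by apply: vN; rewrite mem_enum.
have cube u : in_cube v [set d in enum D] u -> forall d, (v d <= u d <= v d + 1)%N.
  by move=> h d; move: (h d); rewrite inE mem_enum.
have [|u [w [/cube uv /cube wv uw]]] := cups_vary vary (a := a); first by rewrite mem_enum.
move: uw; rewrite /g; case E1 : (f a u); case E2 : (f a w); rewrite ?eqxx // => _.
  by exists w, u.
by exists u, w.
Qed.

(** * Poincare-Miranda theorem *)

Local Open Scope classical_set_scope.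

Lemma within_continuous_normP (R : realFieldType) (V W : normedModType R)
    (A : set V) (f : V -> W) :
  {within A, continuous f} <->
  forall x, A x -> forall e : R, 0 < e -> exists2 d : R, 0 < d &
    forall y, A y -> `|x - y| < d -> `|f x - f y| < e.
Proof.
rewrite (subspace_continuousP A f); split => [cf x Ax e e0|cf x Ax].
  have /cvgrPdist_lt/(_ e e0) := cf x Ax.
  rewrite near_withinE => /nbhs_normP[d /= d0 dA]; exists d => // y Ay xy.
  exact: (dA y).
apply/cvgrPdist_lt => e e0; rewrite near_withinE.
have [d d0 dA] := cf x Ax e e0.
by apply/nbhs_normP; exists d => // y /= xy Ay; exact: dA.
Qed.

Section PoincareMiranda.
Context {R : realType} {n : nat}.
Local Notation V := 'rV[R]_n.

Lemma mx_norm_leP (x : V) (r : R) : 0 <= r -> (`|x| <= r) <-> forall i, `|x ord0 i| <= r.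
Proof.
move=> r0; rewrite [`|x|]mx_normrE; split=> [/bigmax_leP[_ h] i|h].
  exact: (h (ord0, i)).
by apply/bigmax_leP; split => // -[j i] _ /=; rewrite ord1.
Qed.

Lemma mx_norm_ltP (x : V) (r : R) : 0 < r -> (`|x| < r) <-> forall i, `|x ord0 i| < r.
Proof.
move=> r0; rewrite [`|x|]mx_normrE; split=> [/bigmax_ltP[_ h] i|h].
  exact: (h (ord0, i)).
by apply/bigmax_ltP; split => // -[j i] _ /=; rewrite ord1.
Qed.

Lemma coord_le_norm (x : V) i : `|x ord0 i| <= `|x|.
Proof. by apply: (mx_norm_leP _ _).1. Qed.

Lemma compact_norm_le (c : V) (r : R) : compact [set x : V | `|x - c| <= r].
Proof.
apply: bounded_closed_compact.
  exists (r + `|c|); split; first exact: num_real.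
  move=> M rM x /= xr; rewrite -(subrK c x) (le_trans (ler_normD _ _))//.
  by rewrite (le_trans _ (ltW rM))// lerD2r.
apply: (@preimage_closed _ _ (fun x : V => `|x - c|) [set y | y <= r]); last exact: closed_le.
move=> x _; apply: continuous_comp; last exact: norm_continuous.
by apply: (@continuousB _ V V id (cst c)); [exact: cvg_id|exact: cst_continuous].
Qed.

Definition grid_point (N : nat) (v : 'I_n -> nat) : V :=
  \row_i (2 * (v i)%:R / N.+1%:R - 1).

Lemma grid_point_cube N v : (forall i, v i <= N.+1)%N -> `|grid_point N v| <= 1.
Proof.
move=> vN; apply/mx_norm_leP => // i; rewrite mxE ler_norml.
rewrite lerBlDr lerBrDr addNr divr_ge0 ?mulr_ge0 //= ler_pdivrMr ?ltr0Sn //.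
have -> : 1 + 1 = 2 :> R by [].
by rewrite ler_pM2l // ler_nat.
Qed.

(** Each cell found by the discrete version contains, for every coordinate of [F], points of both
    weak signs. At a cluster point of these shrinking cells no coordinate of [F] can have a strict
    sign. *)
Lemma poincare_miranda (F : V -> V) :
  {within [set x | `|x| <= 1], continuous F} ->
  (forall (x : V) i, `|x| <= 1 -> x ord0 i = -1 -> F x ord0 i <= 0) ->
  (forall (x : V) i, `|x| <= 1 -> x ord0 i = 1 -> 0 <= F x ord0 i) ->
  exists2 x, `|x| <= 1 & F x = 0.
Proof.
move=> /within_continuous_normP cF Fneg Fpos.
have cell N : exists v : 'I_n -> nat, (forall i, v i < N.+1)%N /\
    forall i, exists u w : V, [/\ `|u| <= 1 /\ `|w| <= 1,
      `|grid_point N v - u| <= 2 / N.+1%:R, `|grid_point N v - w| <= 2 / N.+1%:R,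
      F u ord0 i <= 0 & 0 <= F w ord0 i].
  (* On the two faces normal to [i] the label is forced, since [F] may vanish there; the boundary
     hypotheses supply the sign that the label stands for. *)
  pose f (i : 'I_n) (v : 'I_n -> nat) := if v i == 0%N then false else
    if v i == N.+1 then true else 0 <= F (grid_point N v) ord0 i.
  have [| |v [vN vP]] := @discrete_miranda _ N.+1 f.
  - by move=> i v; rewrite /f => ->.
  - by move=> i v; rewrite /f => ->; rewrite eqxx.
  exists v; split => // i; have [u [w [uv wv fu fw]]] := vP i.
  have near (z : 'I_n -> nat) : (forall d, (v d <= z d <= v d + 1)%N) ->
      `|grid_point N v - grid_point N z| <= 2 / N.+1%:R /\ `|grid_point N z| <= 1.
    move=> zv; split; last first.
      apply: grid_point_cube => d; have /andP[_ /leq_trans] := zv d; apply.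
      by rewrite addn1.
    apply/mx_norm_leP => [|d]; first by rewrite divr_ge0.
    rewrite !mxE.
    have -> : 2 * (v d)%:R / N.+1%:R - 1 - (2 * (z d)%:R / N.+1%:R - 1)
       = (2 / N.+1%:R) * ((v d)%:R - (z d)%:R) :> R by ring.
    rewrite normrM ger0_norm ?divr_ge0 // ler_piMr ?divr_ge0 //.
    have /andP[z1 z2] := zv d.
    rewrite distrC ger0_norm ?subr_ge0 ?ler_nat // lerBlDl.
    by rewrite natr1 -addn1 ler_nat.
  exists (grid_point N u), (grid_point N w).
  have [? u1] := near u uv; have [? w1] := near w wv; split => //.
    move: fu; rewrite /f; case: eqP => [u0 _|_].
      by apply: Fneg => //; rewrite mxE u0 mulr0 mul0r sub0r.
    by case: eqP => // _ /negbT; rewrite -ltNge => /ltW.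
  move: fw; rewrite /f; case: eqP => // _; case: eqP => [wN _|//].
  by apply: Fpos => //; rewrite mxE wN mulfK ?pnatr_eq0 //; ring.
have [v vP] := choice cell; pose x N := grid_point N (v N).
have xC N : `|x N| <= 1 by apply: grid_point_cube => i; exact/ltnW/(vP N).1.
have Ccomp : compact [set x : V | `|x| <= 1].
  by have := @compact_norm_le 0 1; under eq_set do rewrite subr0.
have xF : (x @ \oo) [set x | `|x| <= 1] by exists 0%N => // N _; exact: xC.
have [c [/= c1 cl]] := Ccomp (x @ \oo) _ xF.
exists c => //; apply/rowP => i; rewrite mxE; apply/eqP/negPn/negP => Fc.
have [d d0 dP] := cF c c1 `|F c ord0 i| (eqbRL (normr_gt0 _) Fc).
have d20 : 0 < d / 2 by rewrite divr_gt0.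
have [N0 N0d] : exists N0, forall N, (N0 <= N)%N -> 2 / N.+1%:R < d / 2.
  exists (Num.truncn (4 / d)) => N N0N.
  rewrite ltr_pdivrMr ?ltr0Sn //.
  have : 4 / d < N.+1%:R.
    by rewrite (lt_le_trans (truncnS_gt _))// ler_nat ltnS.
  by rewrite ltr_pdivrMr // => h; rewrite -[2 in ltLHS](mulfK (_ : 2 != 0 :> R)) //; lra.
have [_ [[N NN0 <-] xNc]] : ((x @` [set N | (N0 <= N)%N]) `&` ball c (d/2)) !=set0.
  apply: cl; last exact: nbhsx_ballx.
  by exists N0 => // N /= N0N; exists N.
move: xNc; rewrite -ball_normE /= => xNc.
have [u [w [[u1 w1] xu xw Fu Fw]]] := (vP N).2 i.
have key z : `|z| <= 1 -> `|x N - z| <= 2 / N.+1%:R ->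
    `|F c ord0 i - F z ord0 i| < `|F c ord0 i|.
  move=> z1 xz; have cz : `|c - z| < d.
    rewrite -(subrK (x N) c) -addrA (le_lt_trans (ler_normD _ _))//.
    by rewrite [d]splitr ltrD// (le_lt_trans xz)// N0d.
  have := dP z z1 cz; apply: le_lt_trans.
  by have := coord_le_norm (F c - F z) i; rewrite !mxE.
have := key u u1 xu; have := key w w1 xw.
have [Fc0|Fc0] := ltP 0 (F c ord0 i).
  by rewrite !ltr_distl => _ /andP[_]; rewrite (gtr0_norm Fc0); lra.
by rewrite !ltr_distl => /andP[+ _] _; rewrite (ler0_norm Fc0); lra.
Qed.

End PoincareMiranda.

(** * Lipschitz maps *)

(** Only [x] is restricted to [K]: the infimal convolution below lets [y] range over the whole
    space. *)
Lemma compact_uniform_continuity (R : realFieldType) (V W : normedModType R) (K : set V)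
    (G : V -> W) : compact K -> continuous G ->
  forall e : R, 0 < e -> exists2 d : R, 0 < d &
    forall x y, K x -> `|x - y| < d -> `|G x - G y| < e.
Proof.
move=> /compact_near_coveringP cK cG e e0.
have e20 : 0 < e / 2 by rewrite divr_gt0.
pose P (d : R) x := forall y, `|x - y| < d -> `|G x - G y| < e.
have [x Kx|d /= d0 dP] := cK R 0^'+ P _; last first.
  exists (d / 2); first by rewrite divr_gt0.
  move=> x y Kx xy; apply: (dP (d / 2)) => //=; last by rewrite divr_gt0.
  by rewrite sub0r normrN gtr0_norm ?divr_gt0 // ltr_pdivrMr // ltr_pMr // ltr1n.
have /cvgrPdist_lt/(_ _ e20)/nbhs_normP[r /= r0 rP] := cG x.
have r20 : 0 < r / 2 by rewrite divr_gt0.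
exists ([set x' | `|x - x'| < r / 2], [set d | 0 < d < r / 2]).
  split; first by apply/nbhs_normP; exists (r / 2).
  by exists (r / 2) => //= d /=; rewrite sub0r normrN => /ltr_normlW -> ->.
move=> [x' d] /= [xx' /andP[d0 dr]] y x'y.
have xy : `|x - y| < r.
  rewrite -(subrK x' x) -addrA (le_lt_trans (ler_normD _ _))// [r]splitr.
  by rewrite ltrD// (lt_trans x'y).
rewrite -(subrK (G x) (G x')) -addrA (le_lt_trans (ler_normD _ _))// [e]splitr ltrD//.
  by rewrite distrC; apply: rP; rewrite /= (lt_trans xx')// ltr_pdivrMr// ltr_pMr// ltr1n.
exact: rP.
Qed.

Section Lipschitz.
Context {R : realType} {n : nat}.
Local Notation V := 'rV[R]_n.

(* The infimal convolution of [G] with [k * `|.|], for [k] large. *)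
Lemma lipschitz_approx_real (K : set V) (G : V -> R) (e : R) :
  compact K -> continuous G -> (forall x, `|G x| <= 1) -> 0 < e ->
  exists (k : R) (P : V -> R), [/\ 0 <= k,
    forall x y, `|P x - P y| <= k * `|x - y| &
    forall x, K x -> `|P x - G x| <= e].
Proof.
move=> cK cG G1 e0.
have [d d0 dP] := compact_uniform_continuity cK cG e0.
(* At distance at least [d] the penalty is at least 2, the largest possible oscillation of [G];
   closer points are handled by uniform continuity. *)
pose k := 2 / d; have k0 : 0 <= k by rewrite divr_ge0 // ltW.
pose E x := [set G y + k * `|x - y| | y in [set: V]].
have Ene x : E x !=set0 by exists (G x + k * `|x - x|), x.
have Gge y : -1 <= G y by have := G1 y; rewrite ler_norml => /andP[].
have Gle y : G y <= 1 by have := G1 y; rewrite ler_norml => /andP[].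
have Elb x : has_lbound (E x).
  exists (-1) => _ [y _ <-]; rewrite -[-1]addr0 lerD// mulr_ge0//.
have Plip x y : inf (E x) <= inf (E y) + k * `|x - y|.
  rewrite -lerBlDr; apply: lb_le_inf => // _ [z _ <-].
  rewrite lerBlDr; apply: (@le_trans _ _ (G z + k * `|x - z|)).
    by apply: ge_inf => //; exists z.
  by rewrite -addrA lerD2l -mulrDr ler_wpM2l // [leRHS]addrC ler_distD.
exists k, (fun x => inf (E x)); split => // [x y|x Kx].
  by have := Plip x y; have := Plip y x; rewrite ler_norml (distrC y x); lra.
have xx : inf (E x) <= G x.
  by apply: ge_inf => //; exists x => //; rewrite subrr normr0 mulr0 addr0.
rewrite ler0_norm ?subr_le0 // opprB lerBlDr -lerBlDl.
apply: lb_le_inf => // _ [y _ <-]; have [xy|xy] := ltP `|x - y| d.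
  have := dP x y Kx xy; rewrite ltr_norml => /andP[_ h].
  have ky : 0 <= k * `|x - y| by rewrite mulr_ge0.
  move: h ky; clear; move: (k * _) => kk; lra.
have : 2 <= k * `|x - y|.
  by rewrite (le_trans _ (ler_wpM2l k0 xy)) // /k divfK // gt_eqF.
by have := Gge y; have := Gle x; lra.
Qed.

Lemma lipschitz_approx (K : set V) (G : V -> V) (e : R) :
  compact K -> continuous G -> (forall x, `|G x| <= 1) -> 0 < e ->
  exists (k : R) (P : V -> V), [/\ 0 <= k,
    forall x y, `|P x - P y| <= k * `|x - y| &
    forall x, K x -> `|P x - G x| <= e].
Proof.
move=> cK cG G1 e0.
have h i : exists kP : R * (V -> R), [/\ 0 <= kP.1,
    forall x y, `|kP.2 x - kP.2 y| <= kP.1 * `|x - y| &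
    forall x, K x -> `|kP.2 x - G x ord0 i| <= e].
  have [|x||k [P kP]] := @lipschitz_approx_real K (fun x => G x ord0 i) e cK; last by exists (k, P).
  - move=> x; apply: (@continuous_comp _ _ _ G (fun M : V => M ord0 i)); first exact: cG.
    exact: coord_continuous.
  - exact: le_trans (coord_le_norm _ _) (G1 x).
  - by [].
have [kP hP] := choice h; exists (\sum_i (kP i).1), (fun x => \row_i (kP i).2 x).
have k0 : 0 <= \sum_i (kP i).1 by apply: sumr_ge0 => i _; have [] := hP i.
split => // [x y|x Kx].
  apply/mx_norm_leP => [|i]; first by rewrite mulr_ge0.
  rewrite !mxE; have [_ /(_ x y) /le_trans + _] := hP i; apply.
  rewrite ler_wpM2r // (bigD1 i) //= lerDl; apply: sumr_ge0 => j _.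
  by have [] := hP j.
apply/mx_norm_leP => [|i]; first exact: ltW.
by rewrite !mxE; have [_ _] := hP i; apply.
Qed.

End Lipschitz.

Lemma mx_norm_attained (R : realType) n (x : 'rV[R]_n.+1) :
  exists i, `|x| = `|x ord0 i|.
Proof.
have [x0|x0] := eqVneq `|x| 0.
  exists ord0; apply/eqP; rewrite eq_le coord_le_norm andbT.
  by rewrite x0 normr_ge0.
by have [[j i] /= xi] := mx_norm_neq0 x0; exists i; rewrite [LHS]xi ord1.
Qed.

(* Pigeonhole: a [k]-Lipschitz image of the boundary of an [n]-cube meets
   O(m^(n-1)) cells of side 1/m, too few to fill an open set. *)
Lemma lipschitz_sphere_avoids (R : realType) n (P : 'rV[R]_n -> 'rV[R]_n) (k : R)
    (c : 'rV[R]_n) (r d : R) : 0 <= k -> 0 < r -> 0 < d ->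
  (forall x y, `|P x - P y| <= k * `|x - y|) ->
  exists2 a, `|a| < d & forall y, `|y - c| = r -> P y <> a.
Proof.
move=> k0 r0 d0 Plip.
apply: contrapT => no; have {no}hit a : `|a| < d -> exists y, `|y - c| = r /\ P y = a.
  move=> ad; apply: contrapT => /forallNP na; apply: no; exists a => // y yr Py.
  exact: (na y).
case: n c P Plip hit => [|n] c P Plip hit.
  (* In dimension 0 no point lies at distance [r > 0] from [c], so not even [0] is hit. *)
  have [|y [yr _]] := hit 0; first by rewrite normr0.
  by move: r0; rewrite -yr (_ : y - c = 0) ?normr0 ?ltxx //; apply/rowP => -[].
(* In dimension $n+1$, the $2(n+1)(m+1)^n$ cells number at most $M(M+1)^n$, fewer than the
   $(M+1)^{n+1}$ targets [pt u]; and [C] makes the image of a cell narrower than the spacing of the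
   targets, which is [small]. *)
pose C := Num.truncn (4 * k * r / d).
pose M := (2 * n.+1 * (C.+2) ^ n)%N.
pose m := (C.+1 * M.+1)%N.
have m0 : 0 < m%:R :> R by rewrite ltr0n muln_gt0.
have small : k * (2 * r / m%:R) < d / 2 / M.+1%:R.
  have : 4 * k * r / d < C.+1%:R by exact: truncnS_gt.
  rewrite ltr_pdivrMr // => h.
  rewrite ltr_pdivlMr ?ltr0Sn // natrM.
  have -> : k * (2 * r / (C.+1%:R * M.+1%:R)) * M.+1%:R = 2 * k * r / C.+1%:R :> R.
    have : C.+1%:R != 0 :> R by rewrite pnatr_eq0.
    have : M.+1%:R != 0 :> R by rewrite pnatr_eq0.
    by move: (C.+1%:R : R) (M.+1%:R : R) => C' M' C0 M0; field; rewrite C0 M0.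
  by rewrite ltr_pdivrMr ?ltr0Sn //; lra.
pose pt (u : {ffun 'I_n.+1 -> 'I_M.+1}) : 'rV[R]_n.+1 :=
  \row_i (d / 2 / M.+1%:R * (u i)%:R).
have dM0 : 0 < d / 2 / M.+1%:R by rewrite !divr_gt0 ?ltr0Sn.
have ptd u : `|pt u| < d.
  apply/mx_norm_ltP => // i; rewrite mxE ger0_norm; last by rewrite mulr_ge0 // ltW.
  rewrite -mulrA (@le_lt_trans _ _ (d / 2)) //; last by rewrite ltr_pdivrMr // ltr_pMr // ltr1n.
  rewrite ger_pMr ?divr_gt0 // mulrC ler_pdivrMr ?ltr0Sn // mul1r ler_nat.
  exact/ltnW.
have /choice[s sP] : forall w, exists y, `|y - c| = r /\ P y = pt w by move=> w; exact/hit/ptd.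
have /choice[f fP] : forall w, exists i, r = `|(s w - c) ord0 i|.
  by move=> w; have [i e] := mx_norm_attained (s w - c); exists i; exact: etrans (esym (sP w).1) e.
have cr u i : -r <= (s u - c) ord0 i <= r.
  by rewrite -ler_norml -[X in _ <= X](sP u).1 coord_le_norm.
pose cell u i := Num.truncn (((s u - c) ord0 i + r) / (2 * r) * m%:R).
have cell0 u i : 0 <= ((s u - c) ord0 i + r) / (2 * r) * m%:R.
  have /andP[h _] := cr u i.
  by rewrite mulr_ge0 // divr_ge0 ?mulr_ge0 ?(ltW r0) //; lra.
(* A coordinate equal to [r] falls into cell [m], hence [m.+1] cells in each direction. *)
have cellm u i : (cell u i < m.+1)%N.
  rewrite ltnS -(ler_nat R) (le_trans (_ : _ <= ((s u - c) ord0 i + r) / (2 * r) * m%:R)) //.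
    by rewrite truncn_le // cell0.
  have /andP[_ h] := cr u i.
  by rewrite ger_pMl // ler_pdivrMr ?mulr_gt0 //; lra.
have cell_close u v i : cell u i = cell v i -> `|s u ord0 i - s v ord0 i| <= 2 * r / m%:R.
  move=> uv; have := truncn_itv (cell0 u i); have := truncn_itv (cell0 v i).
  rewrite -/(cell u i) -/(cell v i) uv -natr1 => /andP[a1 a2] /andP[b1 b2].
  set A := (_ * m%:R) in a1 a2; set B := (_ * m%:R) in b1 b2.
  have -> : s u ord0 i - s v ord0 i = (B - A) * (2 * r / m%:R).
    rewrite /A /B !mxE; field.
    by rewrite (gt_eqF r0) (gt_eqF m0).
  rewrite normrM (ger0_norm (_ : 0 <= 2 * r / m%:R)); last by rewrite divr_ge0 // mulr_ge0 ?(ltW r0).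
  rewrite ler_piMl ?divr_ge0 ?mulr_ge0 ?(ltW r0) ?(ltW m0) //.
  by rewrite ler_norml; lra.
(* A point of the sphere, the boundary of a cube, is located by its face (a coordinate of maximal
   size and its sign) and by the cells of the other coordinates. *)
pose code u : 'I_n.+1 * bool * {ffun 'I_n -> 'I_m.+1} :=
  (f u, 0 < (s u - c) ord0 (f u), [ffun j => Ordinal (cellm u (lift (f u) j))]).
have : ~ injective code.
  move=> /leq_card; rewrite !card_prod !card_ffun !card_ord card_bool.
  apply/negP; rewrite -ltnNge expnS.
  apply: (@leq_ltn_trans (n.+1 * 2 * (C.+2 * M.+1) ^ n)%N).
    have mono x y : (x <= y -> x ^ n <= y ^ n)%N by move=> xy; case: (n) => // n'; rewrite leq_exp2r.
    rewrite leq_mul2l; apply/orP; right; apply: mono.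
    by rewrite /m [in leqRHS]mulSn -addn1 addnC leq_add2r.
  by rewrite expnMn mulnA ltn_mul2r expn_gt0 /= ltnS /M [(2 * _)%N]mulnC.
apply => u v [fuv sgn cells].
apply/eqP/negPn/negP => uv.
have close : `|s u - s v| <= 2 * r / m%:R.
  apply/mx_norm_leP => [|i]; first by rewrite divr_ge0 ?mulr_ge0 ?(ltW r0) ?(ltW m0).
  rewrite [in X in `|X|]mxE [in X in _ + X]mxE.
  have [j ->|->] := unliftP (f u) i.
    apply: cell_close; move/ffunP: cells => /(_ j); rewrite !ffunE => /(congr1 val) /=.
    by rewrite -fuv.
  suff -> : s u ord0 (f u) = s v ord0 (f u).
    by rewrite subrr normr0 divr_ge0 ?mulr_ge0 ?(ltW r0) ?(ltW m0).
  have := fP u; have := fP v; move: sgn; rewrite -fuv !mxE.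
  case: ltrP => h; case: ltrP => h' // _.
    by rewrite !gtr0_norm //; lra.
  by rewrite !ler0_norm //; lra.
have [i uvi] : exists i, u i != v i.
  by apply/existsP; apply: contraNT uv => /existsPn h; apply/eqP/ffunP => i; apply/eqP/negbNE/h.
have : `|pt u - pt v| <= k * (2 * r / m%:R).
  rewrite -(sP u).2 -(sP v).2 (le_trans (Plip _ _))// ler_wpM2l //.
apply/negP; rewrite -ltNge (lt_le_trans small) //.
apply: le_trans (coord_le_norm _ i); rewrite !mxE -mulrBr normrM gtr0_norm //.
rewrite ler_pMr //.
by case: (ltngtP (u i) (v i)) uvi => [h _|h _|/ord_inj -> ]; rewrite ?eqxx //;
  [rewrite distrC|]; rewrite -natrB ?(ltnW h) // normr_nat ler1n subn_gt0.
Qed.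

(** * Invariance of domain *)

Section InvarianceOfDomain.
Context {R : realType} {n : nat}.
Local Notation V := 'rV[R]_n.
Implicit Types (f g : V -> V) (K : set V).

(** Tietze's theorem for each coordinate; the bound survives because the norm is the sup norm. *)
Lemma tietze_rV K g : closed K -> {within K, continuous g} ->
  (forall y, K y -> `|g y| <= 1) ->
  exists G : V -> V, [/\ continuous G, forall y, K y -> G y = g y &
    forall y, `|G y| <= 1].
Proof.
move=> cK cg g1.
have h i : exists G : V -> R^o, [/\ {in K, (fun y => g y ord0 i) =1 G},
    continuous G & forall y, `|G y| <= 1].
  apply: (@continuous_bounded_extension _ R pseudometric_normal K cK
    (fun y => g y ord0 i) 1) => // [y|y Ky]; last first.
    exact: le_trans (coord_le_norm _ _) (g1 y Ky).
  apply: (@continuous_comp (subspace K) V R^o g (fun M : V => M ord0 i)); first exact: cg.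
  exact: coord_continuous.
have [G GP] := choice h; exists (fun y => \row_i G i y); split.
- move=> y; apply: (cvgrPdist_lt (FF := nbhs_filter y) _ _).2 => e e0.
  have : \forall z \near y, forall i, `|G i y - G i z| < e.
    apply: (filter_forall (nbhs_filter y)) => i; have [_ cG _] := GP i.
    by have /cvgrPdist_lt := cG y; apply.
  apply: (@filterS _ (nbhs y)) => z Gz; apply/mx_norm_ltP => // i.
  by rewrite !mxE; exact: Gz.
- move=> y Ky; apply/rowP => i; rewrite mxE; have [<-//] := GP i.
  by rewrite inE.
- move=> y; apply/mx_norm_leP => // i; rewrite mxE.
  by have [_ _] := GP i; apply.
Qed.

(* Kulpa's argument: [Q] is close to [g] on the image of [f], so that
   [Q \o f] has a zero by Poincare-Miranda. *)
Lemma perturbed_inverse_zero f g K (Q : V -> V) :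
  {within [set x : V | `|x| <= 1], continuous f} ->
  K = f @` [set x : V | `|x| <= 1] ->
  (forall x, `|x| <= 1 -> g (f x) = x) ->
  {within K, continuous Q} ->
  (forall y, K y -> `|Q y - g y| <= 1) -> exists2 y, K y & Q y = 0.
Proof.
move=> cf KE gf cQ Qg.
have Kf x : `|x| <= 1 -> K (f x) by move=> x1; rewrite KE; exists x.
have close x i : `|x| <= 1 -> `|Q (f x) ord0 i - x ord0 i| <= 1.
  move=> x1; have := Qg _ (Kf x x1); rewrite gf // => /(le_trans (coord_le_norm _ i)).
  by rewrite !mxE.
have [|||x x1 Qx] := @poincare_miranda R n (Q \o f).
- apply/within_continuous_normP => x /= x1 e e0.
  have [d d0 dP] := (within_continuous_normP _ _).1 cQ _ (Kf x x1) e e0.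
  have [d' d'0 d'P] := (within_continuous_normP _ _).1 cf _ x1 d d0.
  by exists d' => // y y1 xy; apply: dP; [exact: Kf|exact: d'P].
- by move=> x i x1 xi; have := close x i x1; rewrite xi ler_norml /=; lra.
- by move=> x i x1 xi; have := close x i x1; rewrite xi ler_norml /=; lra.
- by exists (f x); [exact: Kf|].
Qed.

(** Away from [c], this is the radial retraction onto the complement of the open ball of radius [r]
    about [c]. *)
Definition radial_push (c : V) (r : R) (y : V) : V :=
  c + Num.max 1 (r / `|y - c|) *: (y - c).

Lemma radial_push_continuous c r (y : V) : y != c ->
  {for y, continuous (radial_push c r)}.
Proof.
move=> yc; have yc0 : `|y - c| != 0 by rewrite normr_eq0 subr_eq0.
have csub : {for y, continuous (fun y : V => y - c)}.
  by apply: (@continuousB _ V V id (cst c)); [exact: cvg_id|exact: cst_continuous].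
apply: (@continuousD _ V V (cst c)); first exact: cst_continuous.
apply: (@continuousZ R V V (fun y => Num.max 1 (r / `|y - c|)) (fun y => y - c)); last exact: csub.
apply: (@continuous_max R V (cst 1)); first exact: cst_continuous.
apply: (@continuousM R V (cst r)); first exact: cst_continuous.
apply: (@continuousV R V (fun y => `|y - c|)) => //.
apply: (@continuous_comp _ _ _ (fun y : V => y - c) (fun z : V => `|z|)); first exact: csub.
exact: norm_continuous.
Qed.

Lemma radial_push_out c r (y : V) : 0 < r -> r <= `|y - c| -> radial_push c r y = y.
Proof.
move=> r0 ry; rewrite /radial_push max_l ?scale1r; first by rewrite addrC subrK.
by rewrite ler_pdivrMr ?mul1r // (lt_le_trans r0).
Qed.

Lemma radial_push_in c r (y : V) : 0 < r -> y != c -> `|y - c| <= r ->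
  `|radial_push c r y - c| = r.
Proof.
move=> r0 yc yr; have yc0 : 0 < `|y - c| by rewrite normr_gt0 subr_eq0.
rewrite /radial_push max_r; last by rewrite ler_pdivlMr ?mul1r.
by rewrite addrAC subrr add0r normrZ ger0_norm ?divr_ge0 ?(ltW r0) // divfK ?gt_eqF.
Qed.

(** If [f 0] were not interior to the image [K], there would be a point [c] outside [K] close to it.
    Pushing [K] radially off a ball around [c] and following by a Lipschitz approximation of the
    inverse, shifted by a small [a], gives a map [Q] close to [g] on [K] without zeros, against
    [perturbed_inverse_zero]. The inverse is first extended to [G] on the whole space, as the pushed
    points may leave [K]. *)
Lemma invariance_of_domain_cube f g :
  {within [set x : V | `|x| <= 1], continuous f} ->
  {within f @` [set x : V | `|x| <= 1], continuous g} ->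
  (forall x, `|x| <= 1 -> g (f x) = x) ->
  nbhs (f 0) (f @` [set x : V | `|x| <= 1]).
Proof.
move=> cf cg gf; set K := f @` _; apply: contrapT => noK.
have C1 : compact [set x : V | `|x| <= 1].
  by have := @compact_norm_le R n 0 1; under eq_set do rewrite subr0.
have cK : compact K by exact: continuous_compact.
have clK : closed K by apply: compact_closed => //; exact: norm_hausdorff.
have g1 y : K y -> `|g y| <= 1 by move=> [x x1 <-]; rewrite gf.
have [G [cG Gg G1]] := tietze_rV clK cg g1.
set y0 := f 0; have Ky0 : K y0 by exists 0 => //=; rewrite normr0.
have Gy0 : G y0 = 0 by rewrite Gg // gf // normr0.
have q0 : 0 < 1 / 4 :> R by rewrite divr_gt0.
have /cvgrPdist_lt/(_ _ q0)/nbhs_normP[e /= e0 eG] := cG y0.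
rewrite Gy0 in eG.
have {}eG y : `|y0 - y| < e -> `|G y| < 1 / 4.
  by move=> /eG; rewrite sub0r normrN.
pose r := e / 2; have r0 : 0 < r by rewrite divr_gt0.
have [c cK' cy0] : exists2 c, ~ K c & `|y0 - c| < r.
  apply: contrapT => no; apply: noK; apply/nbhs_ballP; exists r => // y; rewrite -ball_normE /= => y0y.
  by apply: contrapT => Ky; apply: no; exists y.
have Gball y : `|y - c| <= r -> `|G y| < 1 / 4.
  move=> yc; apply: eG; rewrite (le_lt_trans (ler_distD c _ _))// [e]splitr.
  by rewrite ltr_leD // distrC.
pose S1 := K `&` [set y | r <= `|y - c|].
(* On [K] the only zero of [G] is [y0], which lies in the open ball about [c]; off that ball
   compactness bounds [G] away from 0. *)
have [d d0 dG] : exists2 d, 0 < d & forall y, S1 y -> d <= `|G y|.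
  have [->|S10] := eqVneq S1 set0; first by exists 1.
  have cS1 : compact S1.
    apply: subclosed_compact cK _; last exact: subIsetl.
    apply: closedI => //.
    apply: (@preimage_closed _ _ (fun y : V => `|y - c|) [set s | r <= s]); last exact: closed_ge.
    move=> y _; apply: continuous_comp; last exact: norm_continuous.
    by apply: (@continuousB _ V V id (cst c)); [exact: cvg_id|exact: cst_continuous].
  have [||y Sy yP] := @EVT_min_rV R n (fun y => `|G y|) S1 _ cS1.
  - exact/set0P.
  - apply: continuous_subspaceT => y.
    by apply: continuous_comp; [exact: cG|exact: norm_continuous].
  exists `|G y|; last by move=> z Sz; apply: yP; rewrite inE.
  move: Sy; rewrite inE => -[Ky ry]; rewrite normr_gt0; apply/eqP => Gy.
  move: ry => /=; rewrite leNgt => /negP; apply.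
  suff -> : y = y0 by [].
  by move: Ky Gy => [x x1 <-]; rewrite Gg ?gf //; [move=> ->|exists x].
(* The bound [d / 4] keeps [P], of norm at least [3 * d / 4] on [K] off the ball, away from [a].
   Inside the ball [Q] differs from [g] by at most 1/8 for the approximation, 1/8 for [a] and 1/4
   for each of the two values of [G]. *)
pose d' := Num.min (d / 4) (1 / 8).
have d'0 : 0 < d' by rewrite lt_min !divr_gt0.
have d'd : d' <= d / 4 by rewrite ge_min lexx.
have d'8 : d' <= 1 / 8 by rewrite ge_min lexx orbT.
have cS : compact (K `|` [set y | `|y - c| <= r]).
  by apply: compactU => //; exact: compact_norm_le.
have [k [P [k0 Plip PG]]] := lipschitz_approx cS cG G1 d'0.
have [a ad aP] := lipschitz_sphere_avoids c k0 r0 d'0 Plip.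
pose Q y := P (radial_push c r y) - a.
have Kc y : K y -> y != c by move=> Ky; apply: contra_notN cK' => /eqP <-.
have cP : continuous P.
  move=> x; apply: (cvgrPdist_lt (FF := nbhs_filter x) _ _).2 => s s0.
  apply/nbhs_ballP; exists (s / (k + 1)); first by rewrite /= divr_gt0 // ltr_wpDl.
  move=> y; rewrite -ball_normE /= => xy; rewrite (le_lt_trans (Plip _ _)) //.
  rewrite (@le_lt_trans _ _ ((k + 1) * `|x - y|)) ?ler_wpM2r ?lerDl //.
  by rewrite mulrC -ltr_pdivlMr // ltr_wpDl.
have [||y Ky Qy] := @perturbed_inverse_zero f g K Q cf erefl gf.
- apply: continuous_in_subspaceT => y; rewrite inE => Ky.
  apply: (@continuousB _ V V (P \o radial_push c r) (cst a)); last exact: cst_continuous.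
  by apply: continuous_comp; [exact/radial_push_continuous/Kc|exact: cP].
- move=> y Ky; rewrite -Gg // /Q.
  have [ry|yr] := leP r `|y - c|.
    rewrite radial_push_out // addrAC (le_trans (ler_normB _ _)) //.
    have := PG y (or_introl Ky); lra.
  have zr := radial_push_in r0 (Kc _ Ky) (ltW yr).
  set z := radial_push _ _ _ in zr *; have zr' : `|z - c| <= r by rewrite zr.
  have Pz := PG z (or_intror zr').
  have Gz := Gball z zr'.
  have Gy := Gball y (ltW yr).
  rewrite (le_trans (ler_normB _ _)) // (le_trans (lerD (ler_normB _ _) (lexx _))) //.
  have := ler_normD (P z - G z) (G z); rewrite subrK; lra.
move: Qy => /eqP; rewrite subr_eq0 => /eqP.
have [ry|yr] := leP r `|y - c|; last first.
  by apply: aP; exact/radial_push_in/ltW/yr/Kc.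
rewrite radial_push_out // => Py.
have := PG y (or_introl Ky); have := dG y (conj Ky ry).
have := ler_normB (P y) (P y - G y); rewrite opprB addrC subrK Py; lra.
Qed.
End InvarianceOfDomain.

(** * Tiles *)

Lemma finite_set_elim (T : Type) (Q : set T -> Prop) :
  Q set0 -> (forall a B, Q B -> Q (a |` B)) -> forall A, finite_set A -> Q A.
Proof.
move=> Q0 QU A /(@finite_seqP {classic T})[s ->].
elim: s => [|a s IHs]; first by rewrite set_nil.
have -> : [set` (a :: s)] = a |` [set` s]; last exact: QU.
apply/seteqP; split => x /=; rewrite in_cons; first by case/orP => [/eqP|]; [left|right].
by case=> [->|->]; rewrite ?eqxx ?orbT.
Qed.

Lemma connected_between (T : topologicalType) (A B : set T) :
  connected A -> A `<=` B -> B `<=` closure A -> connected B.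
Proof.
move=> cA AB BA; apply/connectedP => E [E0 BE sepE].
have AE : A `<=` E false `|` E true by rewrite -BE.
have [h|h] := connected_subset sepE AE cA.
  have [y Ey] := E0 true; have [+ _] := sepE; apply/eqP/set0P; exists y; split => //.
  by apply: closureS h _ _; apply: BA; rewrite BE; right.
have [y Ey] := E0 false; have [_] := sepE; apply/eqP/set0P; exists y; split => //.
by apply: closureS h _ _; apply: BA; rewrite BE; left.
Qed.

(** If [F a] has no interior point in [U], then [U] minus [F a] is still open and nonempty, and the
    other sets cover it. *)
Lemma finite_closed_cover_interior (T : topologicalType) (I : Type) (P : set I)
    (F : I -> set T) (U : set T) :
  finite_set P -> (forall i, P i -> closed (F i)) -> open U -> U !=set0 ->
  U `<=` \bigcup_(i in P) F i -> exists2 i, P i & (F i)° `&` U !=set0.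
Proof.
move=> finP; move: P finP U.
apply: (@finite_set_elim _ (fun P => forall U, _ -> _ -> _ -> _ -> _)) => [U _ _ [x Ux] /(_ x Ux)[]//|].
move=> a B IHB U clF oU U0 UF.
have [|no] := pselect ((F a)° `&` U !=set0); first by exists a => //; left.
have [||||i Bi [x [Fx [Ux _]]]] := IHB (U `&` ~` F a); last by exists i; [right|exists x; split].
- by move=> i Bi; apply: clF; right.
- by apply: openI => //; apply: closed_openC; apply: clF; left.
- apply: contrapT => no'; apply: no; have [x Ux] := U0; exists x; split => //.
  move: (oU); rewrite openE => /(_ _ Ux); apply: filterS => y Uy.
  by apply: contrapT => Fy; apply: no'; exists y.
- by move=> x [/UF[i [->|Bi] Fi] nFa]; [|exists i].
Qed.

(** * Euclidean balls in the topology of the sup norm *)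

Section Euclid.
Context {R : realType} {n : nat}.
Local Notation V := 'rV[R]_n.
Implicit Types x y : V.

Lemma enorm_sum_ge0 x : 0 <= \sum_(i < n) x ord0 i ^+ 2.
Proof. by apply: sumr_ge0 => i _; exact: sqr_ge0. Qed.

Lemma norm_le_enorm x : `|x| <= enorm x.
Proof.
apply/mx_norm_leP => [|i]; first exact: sqrtr_ge0.
rewrite -sqrtr_sqr ler_sqrt ?enorm_sum_ge0 // (bigD1 i) //= lerDl.
by apply: sumr_ge0 => j _; exact: sqr_ge0.
Qed.

(** A crude constant, chosen positive in every dimension, 0 included. *)
Lemma enorm_le_norm x : enorm x <= n.+1%:R * `|x|.
Proof.
rewrite -[leRHS]ger0_norm ?mulr_ge0 // -sqrtr_sqr ler_sqrt ?sqr_ge0 //.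
rewrite (@le_trans _ _ (\sum_(i < n) `|x| ^+ 2)) //.
  apply: ler_sum => i _; rewrite -real_normK ?num_real //.
  by rewrite lerXn2r ?nnegrE // coord_le_norm.
rewrite sumr_const card_ord -[_ *+ n]mulr_natl exprMn ler_wpM2r ?sqr_ge0 //.
by rewrite -natrX ler_nat (leq_trans (leqnSn n)) // leq_pmulr.
Qed.

Lemma enorm0 : enorm (0 : V) = 0.
Proof. by apply/eqP; rewrite eq_le sqrtr_ge0 andbT (le_trans (enorm_le_norm _)) // normr0 mulr0. Qed.

Lemma enormZ (a : R) x : enorm (a *: x) = `|a| * enorm x.
Proof.
rewrite /enorm -sqrtr_sqr -sqrtrM ?sqr_ge0 // mulr_sumr; congr Num.sqrt.
by apply: eq_bigr => i _; rewrite mxE exprMn.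
Qed.

Lemma enorm_continuous : continuous (enorm : V -> R).
Proof.
move=> x; apply: (@continuous_comp _ _ _ (fun y : V => \sum_(i < n) y ord0 i ^+ 2) Num.sqrt);
  last exact: sqrt_continuous.
apply: (@continuous_big R^o 'I_n +%R 0 xpredT (@add_continuous R^o) V (index_enum _)
  (fun i y => y ord0 i ^+ 2)) => i _ y.
apply: (@continuous_comp _ _ _ (fun y : V => y ord0 i) (fun z : R => z ^+ 2)).
  exact: coord_continuous.
exact: exprn_continuous.
Qed.

Lemma open_eball r : open (eball (0 : V) r).
Proof.
have -> : eball (0 : V) r = enorm @^-1` [set z | z < r].
  by apply/seteqP; split => y; rewrite /eball /= subr0.
by apply: open_comp => [y _|]; [exact: enorm_continuous|exact: open_lt].
Qed.

Lemma compact_enorm_le r : compact [set x : V | enorm x <= r].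
Proof.
apply: subclosed_compact (@compact_norm_le R n 0 r) _; last first.
  by move=> x /= xr; rewrite subr0 (le_trans (norm_le_enorm x)).
apply: (@preimage_closed _ _ (enorm : V -> R) [set y | y <= r]); last exact: closed_le.
by move=> x _; exact: enorm_continuous.
Qed.

Lemma segment0_connected (x : V) : connected [set s *: x | s in `[0, 1]].
Proof.
apply: connected_continuous_connected; first exact: segment_connected.
apply: continuous_subspaceT => s.
by apply: (@continuousZ R V R id (cst x)); [exact: cvg_id|exact: cst_continuous].
Qed.

Lemma connected_eball r : connected (eball (0 : V) r).
Proof.
have [r0|r0] := leP r 0.
  rewrite (_ : eball _ _ = set0); first exact: connected0.
  apply/seteqP; split => // y; rewrite /eball /= => yr.
  by have := lt_le_trans yr r0; rewrite ltNge sqrtr_ge0.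
have -> : eball (0 : V) r = \bigcup_(x in eball (0 : V) r) [set s *: x | s in `[0, 1]].
  apply/seteqP; split => y.
    by move=> yr; exists y => //; exists 1; rewrite ?scale1r //= in_itv /= ler01 lexx.
  move=> [x xr [s]]; rewrite /= in_itv /= => /andP[s0 s1] <-.
  move: xr; rewrite /eball /= !subr0 enormZ ger0_norm //; apply: le_lt_trans.
  by rewrite ler_piMl // sqrtr_ge0.
apply: bigcup_connected => [|x _]; last exact: segment0_connected.
by exists 0 => x _; exists 0; rewrite ?scale0r //= in_itv /= lexx ler01.
Qed.

End Euclid.

(** * Tiles as closures of connected open sets *)

Section TileCore.
Context {R : realType} {n : nat} {L : Type}.
Local Notation V := 'rV[R]_n.
Implicit Types (t : ltile R n L).

Lemma tile_nonempty t : is_tile t -> t.1 !=set0.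
Proof.
move=> [f [g [_ _ _ gB _]]]; exists (g 0); apply: gB.
by rewrite /= enorm0.
Qed.

Lemma compact_tile t : is_tile t -> compact t.1.
Proof.
move=> [f [g [_ cg fA gB [fK gK]]]].
have -> : t.1 = g @` [set x | enorm x <= 1].
  apply/seteqP; split => [x tx|_ [x x1 <-]]; last exact: gB.
  by exists (f x); [exact: fA|rewrite fK // inE].
exact: continuous_compact cg (@compact_enorm_le R n 1).
Qed.

Lemma closed_tile t : is_tile t -> closed t.1.
Proof. by move=> /compact_tile; apply: compact_closed; exact: norm_hausdorff. Qed.

Lemma tile_bounded t : is_tile t -> exists2 M : R, 0 < M & forall x, t.1 x -> `|x| <= M.
Proof.
move=> /compact_tile/compact_bounded[M [_ MP]].
exists (`|M| + 1) => [|x tx]; first by rewrite ltr_wpDl.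
by apply: (MP (`|M| + 1)) => //; rewrite (le_lt_trans (ler_norm M)) // ltrDl.
Qed.

(* The image of the open unit ball: open by invariance of domain. *)
Lemma tile_core t : is_tile t ->
  exists O : set V, [/\ open O, O !=set0, connected O, O `<=` t.1 & t.1 `<=` closure O].
Proof.
move=> [f [g [cf cg fA gB [fK gK]]]]; exists (g @` eball 0 1).
have subB : eball (0 : V) 1 `<=` [set x | enorm x <= 1].
  by move=> x; rewrite /eball /= subr0 => /ltW.
have cg' := (within_continuous_normP _ _).1 cg.
have cf' := (within_continuous_normP _ _).1 cf.
split.
- rewrite openE => _ [x x1 <-].
  (* A small cube around [x] inside the ball, rescaled to the unit cube, puts [g] into the form
     required by [invariance_of_domain_cube]. *)
  have [r r0 rP] : exists2 r : R, 0 < r & forall u : V, `|u| <= 1 -> eball (0 : V) 1 (x + r *: u).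
    have /nbhs_ballP[d /= d0 dP] : nbhs x (eball (0 : V) 1).
      by apply: open_nbhs_nbhs; split => //; exact: open_eball.
    exists (d / 2); first by rewrite divr_gt0.
    move=> u u1; apply: dP; rewrite -ball_normE /=.
    rewrite opprD addNKr normrN normrZ ger0_norm; last by rewrite divr_ge0 ?(ltW d0).
    by rewrite (@le_lt_trans _ _ (d / 2)) ?ler_piMr ?divr_ge0 ?(ltW d0) // ltr_pdivrMr // ltr_pMr // ltr1n.
  have rN0 : r != 0 by rewrite gt_eqF.
  pose h u := g (x + r *: u); pose k y := r^-1 *: (f y - x).
  have hA u : `|u| <= 1 -> t.1 (h u) by move=> u1; apply: gB; exact/subB/rP.
  have hK u : `|u| <= 1 -> f (h u) = x + r *: u.
    by move=> u1; rewrite gK // inE; exact/subB/rP.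
  have gx : g x = h 0 by rewrite /h scaler0 addr0.
  rewrite /interior gx; apply: (@filterS _ (nbhs (h 0)) _ (h @` [set u | `|u| <= 1])).
    by move=> _ [u u1 <-]; exists (x + r *: u) => //; exact: rP.
  apply: (@invariance_of_domain_cube R n h k).
  + apply/within_continuous_normP => u u1 e e0.
    have [d d0 dP] := cg' _ (subB _ (rP u u1)) e e0.
    exists (d / r); first by rewrite divr_gt0.
    move=> v v1 uv; apply: dP; first exact/subB/rP.
    rewrite opprD addrACA subrr add0r -scalerBr normrZ gtr0_norm // mulrC.
    by rewrite -ltr_pdivlMr.
  + apply/within_continuous_normP => _ [u u1 <-] e e0.
    have [d d0 dP] := cf' _ (hA u u1) (e * r) (mulr_gt0 e0 r0).
    exists d => // _ [v v1 <-] uv; rewrite /k -scalerBr normrZ gtr0_norm ?invr_gt0 //.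
    rewrite opprB addrA subrK mulrC ltr_pdivrMr //; apply: dP => //; exact: hA.
  + by move=> u u1; rewrite /k hK // addrC addKr scalerA mulVf // scale1r.
- by exists (g 0); exists 0 => //; rewrite /eball /= subrr enorm0.
- apply: connected_continuous_connected; first exact: connected_eball.
  exact: continuous_subspaceW cg.
- by move=> _ [x x1 <-]; apply: gB; exact: subB.
- move=> y ty W /nbhs_ballP[e /= e0 eW].
  have x1 := fA y ty; have [d d0 dP] := cg' _ x1 e e0.
  (* Shrinking [f y] by the factor [1 - s] brings it into the open ball and moves it by less than
     [d]. *)
  pose s := Num.min (1 / 2) (d / (`|f y| + 1) / 2).
  have fy0 : 0 < `|f y| + 1 by rewrite ltr_wpDl.
  have s0 : 0 < s by rewrite lt_min !divr_gt0.
  have s2 : s <= 1 / 2 by rewrite ge_min lexx.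
  have s1 : 0 <= 1 - s by rewrite subr_ge0 (le_trans s2) // ler_pdivrMr // mul1r ler1n.
  have sx1 : enorm ((1 - s) *: f y) < 1.
    rewrite enormZ ger0_norm // (@le_lt_trans _ _ (1 - s)) ?gtrBl //.
    by rewrite ler_piMr.
  exists (g ((1 - s) *: f y)); split.
    by exists ((1 - s) *: f y) => //; rewrite /eball /= subr0.
  apply: eW; rewrite -ball_normE /= -{1}(fK y) ?inE //; apply: dP; first exact/ltW.
  rewrite scalerBl scale1r opprB addrC subrK normrZ gtr0_norm //.
  have sd : s <= d / (`|f y| + 1) / 2 by rewrite ge_min lexx orbT.
  rewrite (@le_lt_trans _ _ (s * (`|f y| + 1))) //; first by rewrite ler_wpM2l ?(ltW s0) // lerDl.
  rewrite -ltr_pdivlMr // (le_lt_trans sd) // ltr_pdivrMr // ltr_pMr ?ltr1n //.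
  by rewrite divr_gt0.
Qed.

End TileCore.

(** * Patches and the hull *)

Lemma finite_card_bound (I : Type) (F : set (set I)) : finite_set F ->
  (forall A, F A -> finite_set A) -> exists N, forall A, F A -> (A #<= `I_N)%card.
Proof.
move: F; apply: finite_set_elim => [|A F IHF FA]; first by exists 0%N.
have [|N NP] := IHF; first by move=> B FB; apply: FA; right.
have /finite_setP[m Am] : finite_set A by apply: FA; left.
exists (maxn N m) => B [->|/NP BN].
  by rewrite (card_le_eql Am) card_le_II leq_maxr.
by rewrite (card_le_trans BN) // card_le_II leq_maxl.
Qed.

Lemma infinite_subset_card (I : Type) (A : set I) k : infinite_set A ->
  exists2 B, B `<=` A & (B #= `I_k)%card.
Proof.
elim/Ppointed: I => I in A *; first by rewrite emptyE => /(_ (finite_set0 _)).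
move=> /infiniteP/ppcard_leP[f]; exists (f @` `I_k).
  by move=> _ [j _ <-]; exact: funS.
by apply: inj_card_eq => i j _ _; apply: inj; rewrite inE.
Qed.

(** * Translations of tiles and patches *)

Section Translation.
Context {R : realType} {n : nat} {L : Type}.
Local Notation V := 'rV[R]_n.
Local Notation tile := (ltile R n L).
Implicit Types (t s : tile) (P Q T : set tile) (x y z : V).

Lemma ttranslateP t x y : (ttranslate t x).1 y <-> t.1 (y - x).
Proof.
split => [[z tz <-]|ty]; first by rewrite addrK.
by exists (y - x) => //; rewrite subrK.
Qed.

Lemma ttranslate0 t : ttranslate t 0 = t.
Proof.
case: t => A l; congr pair; apply/seteqP; split => y /=; first by move=> [z Az <-]; rewrite addr0.
by move=> Ay; exists y => //; rewrite addr0.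
Qed.

Lemma ttranslateD t x y : ttranslate (ttranslate t x) y = ttranslate t (x + y).
Proof.
case: t => A l; congr pair; apply/seteqP; split => z /=.
  by move=> [_ [w Aw <-] <-]; exists w => //; rewrite addrA.
by move=> [w Aw <-]; exists (w + x); [exists w | rewrite addrA].
Qed.

Lemma ttranslateK t x : ttranslate (ttranslate t x) (- x) = t.
Proof. by rewrite ttranslateD subrr ttranslate0. Qed.

Lemma ttranslateNK t x : ttranslate (ttranslate t (- x)) x = t.
Proof. by rewrite ttranslateD addNr ttranslate0. Qed.

Lemma translateP T x t : translate T x t <-> T (ttranslate t (- x)).
Proof.
split => [[s Ts <-]|Tt]; first by rewrite ttranslateK.
by exists (ttranslate t (- x)) => //; rewrite ttranslateNK.
Qed.

Lemma translateK T x : translate (translate T x) (- x) = T.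
Proof. by rewrite translateD subrr translate0. Qed.

Lemma translateNK T x : translate (translate T (- x)) x = T.
Proof. by rewrite translateD addNr translate0. Qed.

Lemma translate_inj x : injective (fun T => translate T x).
Proof. exact: (can_inj (g := fun T => translate T (- x)) (translateK^~ x)). Qed.

Lemma translateU P Q x : translate (P `|` Q) x = translate P x `|` translate Q x.
Proof. by rewrite /translate image_setU. Qed.

Lemma translateS P Q x : P `<=` Q -> translate P x `<=` translate Q x.
Proof. exact: image_subset. Qed.

Lemma translate_subl P Q x : translate P x `<=` Q <-> P `<=` translate Q (- x).
Proof.
split => [/(@translateS _ _ (- x))|/(@translateS _ _ x)]; first by rewrite translateK.
by rewrite translateNK.
Qed.

(** A tile fixed by [x] contains [a + k x] for all [k] as soon as it contains [a], but it is
    bounded. Consequently the displacement between two copies of a tile is unique. *)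
Lemma ttranslate_fixed t x : is_tile t -> ttranslate t x = t -> x = 0.
Proof.
move=> ht tx; have [a ta] := tile_nonempty ht; have [M M0 tM] := tile_bounded ht.
have tk k : t.1 (a + x *+ k).
  elim: k => [|k IHk]; first by rewrite mulr0n addr0.
  by rewrite -tx; apply/ttranslateP; rewrite mulrSr addrA addrK.
apply/eqP; rewrite -normr_le0 leNgt; apply/negP => x0.
have : `|x *+ (Num.truncn (2 * M / `|x|)).+1| <= 2 * M.
  rewrite -(addKr a (x *+ _)) (le_trans (ler_normD _ _)) // normrN.
  by have := tM _ ta; have := tM _ (tk (Num.truncn (2 * M / `|x|)).+1); lra.
rewrite normrMn -[`|x| *+ _]mulr_natl; apply/negP; rewrite -ltNge -ltr_pdivrMr //.
exact: truncnS_gt.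
Qed.

Lemma ttranslate_injr t x y : is_tile t -> ttranslate t x = ttranslate t y -> x = y.
Proof.
move=> ht xy; apply/eqP; rewrite -subr_eq0; apply/eqP; apply: (ttranslate_fixed ht).
by rewrite -ttranslateD xy ttranslateK.
Qed.

Lemma is_tile_ttranslate t x : is_tile t -> is_tile (ttranslate t x).
Proof.
move=> [f [g [cf cg fA gB [fK gK]]]].
exists (fun y => f (y - x)), (fun y => g y + x); split.
- apply/within_continuous_normP => y /ttranslateP ty e e0.
  have [d d0 dP] := (within_continuous_normP _ _).1 cf _ ty e e0.
  exists d => // z /ttranslateP tz yz; apply: dP => //.
  by rewrite opprB addrA subrK.
- apply/within_continuous_normP => y ty e e0.
  have [d d0 dP] := (within_continuous_normP _ _).1 cg _ ty e e0.
  exists d => // z tz yz; rewrite opprD addrACA subrr addr0; exact: dP.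
- by move=> y /ttranslateP ty; exact: fA.
- by move=> y y1; apply/ttranslateP; rewrite addrK; exact: gB.
- split => y; rewrite inE; first by move=> /ttranslateP ty; rewrite fK ?subrK // inE.
  by move=> y1; rewrite addrK gK // inE.
Qed.

Lemma interior_shift (A B : set V) x : (forall y, A y <-> B (y - x)) ->
  forall y, A° y <-> B° (y - x).
Proof.
move=> AB y; split => /nbhs_ballP[e /= e0 eP]; apply/nbhs_ballP; exists e => // z;
  rewrite -ball_normE /= => yz.
  rewrite -(addrK x z); apply/AB/eP; rewrite -ball_normE /=.
  by rewrite opprD addrA addrAC.
by apply/AB/eP; rewrite -ball_normE /= opprB addrA subrK.
Qed.

Lemma interior_ttranslate t x y : (ttranslate t x).1° y <-> t.1° (y - x).
Proof. by apply: interior_shift => z; exact: ttranslateP. Qed.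

Lemma tiling_support_translate T x y :
  tiling_support (translate T x) y <-> tiling_support T (y - x).
Proof.
split => [[t /translateP Tt ty]|[t Tt ty]].
  by exists (ttranslate t (- x)) => //; apply/ttranslateP; rewrite opprK subrK.
by exists (ttranslate t x); [apply/translateP; rewrite ttranslateK|apply/ttranslateP].
Qed.

Lemma partial_tiling_translate T x : partial_tiling T -> partial_tiling (translate T x).
Proof.
move=> [tT dT]; split => [_ [t Tt <-]|_ _ [t Tt <-] [s Ts <-] ts].
  exact/is_tile_ttranslate/tT.
apply/seteqP; split => // y [/interior_ttranslate ty /interior_ttranslate sy].
suff : (set0 : set V) (y - x) by [].
by rewrite -(dT t s Tt Ts) // => h; apply: ts; rewrite h.
Qed.

Lemma is_patch_translate P x : is_patch P -> is_patch (translate P x).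
Proof.
by move=> [pP fP]; split; [exact: partial_tiling_translate|exact: finite_image].
Qed.

Lemma tiling_translate T x : tiling T -> tiling (translate T x).
Proof.
move=> [pT sT]; split; first exact: partial_tiling_translate.
by apply/seteqP; split => // y _; apply/tiling_support_translate; rewrite sT.
Qed.

Lemma partial_tilingS P T : P `<=` T -> partial_tiling T -> partial_tiling P.
Proof.
move=> PT [tT dT]; split => [t /PT/tT//|t s Pt Ps]; apply: dT; exact: PT.
Qed.

Lemma connected_translate_interior P x :
  connected (tiling_support P)° -> connected (tiling_support (translate P x))°.
Proof.
move=> cP; have -> : (tiling_support (translate P x))° = (fun y => y + x) @` (tiling_support P)°.
  have h := interior_shift (tiling_support_translate P x).
  apply/seteqP; split => [y /h Py|_ [y Py <-]]; last by apply/h; rewrite addrK.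
  by exists (y - x) => //; rewrite subrK.
apply: connected_continuous_connected => //; apply: continuous_subspaceT => y.
by apply: (@continuousD _ V V id (cst x)); [exact: cvg_id|exact: cst_continuous].
Qed.

Lemma meeting_sub T (U : set V) : meeting T U `<=` T.
Proof. by move=> t []. Qed.

Lemma meeting_translate T x y r :
  meeting (translate T x) (eball (y + x) r) = translate (meeting T (eball y r)) x.
Proof.
apply/seteqP; split => [t [/translateP Tt [z [tz zr]]]|_ [t [Tt [z [tz zr]]] <-]].
  apply/translateP; split => //; exists (z - x); split.
    by apply/ttranslateP; rewrite opprK subrK.
  by move: zr; rewrite /eball /= opprD addrA addrAC.
split; first by exists t.
exists (z + x); split; first by apply/ttranslateP; rewrite addrK.
by rewrite /eball /= opprD addrACA subrr addr0.
Qed.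

End Translation.

(** * Interiors of supports of patches *)

Section PatchGeometry.
Context {R : realType} {n : nat} {L : Type}.
Local Notation V := 'rV[R]_n.
Local Notation tile := (ltile R n L).
Implicit Types (t s : tile) (P Q T : set tile) (x y z : V).

Lemma partial_tiling_inj T t s y : partial_tiling T -> T t -> T s ->
  t.1° y -> s.1° y -> t = s.
Proof.
move=> [_ dT] Tt Ts ty sy; apply: contrapT => ts.
by have : (t.1° `&` s.1°) y by []; rewrite dT.
Qed.

(** The open core of [t] meets [U], where it is covered by the finitely many closed tiles of [P].
    One of them has an interior point in the core, and disjointness of interiors identifies it with
    [t]. *)
Lemma tile_in_patch T P t (U : set V) : partial_tiling T -> finite_set P -> P `<=` T ->
  open U -> U `<=` tiling_support P -> T t -> t.1 `&` U !=set0 -> P t.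
Proof.
move=> pT fP PT oU UP Tt [y [ty Uy]].
have [C [oC C0 _ Ct tC]] := tile_core (pT.1 t Tt).
have CU0 : (C `&` U) !=set0 by exact: tC y ty _ (open_nbhs_nbhs (conj oU Uy)).
have [||||s Ps [z [sz [Cz Uz]]]] := @finite_closed_cover_interior _ _ P (fun t => t.1) (C `&` U) fP.
- by move=> s /PT/(pT.1 s)/closed_tile.
- exact: openI.
- by [].
- by move=> z [_ /UP].
suff -> : t = s by [].
apply: (partial_tiling_inj pT Tt (PT _ Ps) _ sz).
by apply: filterS Ct _; exact: open_nbhs_nbhs.
Qed.

(** The interior of the support lies between the component of [y] in it and the closure of that
    component, because each tile is in the closure of a connected set through [y]. *)
Lemma connected_patch_interior P y :
  (forall t, P t -> exists A : set V, [/\ connected A, A y,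
     A `<=` (tiling_support P)° & t.1 `<=` closure A]) ->
  connected (tiling_support P)°.
Proof.
set W := (_)° => PA; apply: (@connected_between _ (connected_component W y)); first exact: component_connected.
  exact: connected_component_sub.
move=> z /interior_subset[t Pt tz]; have [A [cA Ay AW tA]] := PA t Pt.
by apply: closureS (tA z tz); exact: connected_component_max.
Qed.

Lemma open_sub_interior P (C : set V) : open C -> C `<=` tiling_support P ->
  C `<=` (tiling_support P)°.
Proof.
move=> oC CP y Cy; apply: (@filterS _ (nbhs y) _ C) => //.
exact: open_nbhs_nbhs.
Qed.

Lemma eball_sub_meeting T r : tiling T ->
  eball 0 r `<=` tiling_support (meeting T (eball 0 r)).
Proof.
move=> [_ sT] z Bz; have : tiling_support T z by rewrite sT.
by move=> [t Tt tz]; exists t => //; split => //; exists z.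
Qed.

(** The core of each tile that meets the ball is dense in the tile, hence meets the ball too, so
    that ball and core have a connected union. *)
Lemma connected_meeting T r : 0 < r -> tiling T ->
  connected (tiling_support (meeting T (eball 0 r)))°.
Proof.
move=> r0 hT; set P := meeting _ _; set B := eball (0 : V) r.
have B0 : B 0 by rewrite /B /eball /= subrr enorm0.
have oB : open B by exact: open_eball.
apply: (@connected_patch_interior P 0) => t Pt.
have [Tt [y [ty By]]] := Pt; have [C [oC _ cC Ct tC]] := tile_core (hT.1.1 t Tt).
exists (B `|` C); split; [|by left| |by move=> z /tC; apply: closureS => w; right].
  apply: connectedU => //; last exact: connected_eball.
  by rewrite setIC; exact: tC y ty _ (open_nbhs_nbhs (conj oB By)).
apply: open_sub_interior; first exact: openU.
by move=> z [/(eball_sub_meeting hT)//|/Ct tz]; exists t.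
Qed.

(** The core of the common tile [t] gives a point interior to both supports. *)
Lemma connected_union P Q t : (forall t, (P `|` Q) t -> is_tile t) -> P t -> Q t ->
  connected (tiling_support P)° -> connected (tiling_support Q)° ->
  connected (tiling_support (P `|` Q))°.
Proof.
move=> PQt Pt Qt cP cQ.
have [C [oC [y Cy] _ Ct _]] := tile_core (PQt t (or_introl Pt)).
have sub A B : A `<=` B -> (tiling_support A : set V)° `<=` (tiling_support B)°.
  by move=> AB; apply: interiorS => z [s /AB]; exists s.
have inP A : A t -> (tiling_support A)° y.
  by move=> At; apply: open_sub_interior oC _ _ Cy => z /Ct; exists t.
have dense A s : is_tile s -> A s -> s.1 `<=` closure (tiling_support A)°.
  move=> /tile_core[D [oD _ _ Ds sD]] As z /sD; apply: closureS.
  by apply: open_sub_interior => // w /Ds; exists s.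
apply: (@connected_patch_interior _ y) => s PQs; have st := PQt s PQs.
case: PQs => [Ps|Qs].
  by exists (tiling_support P)°; split; [|exact: inP|apply: sub; left|exact: dense].
by exists (tiling_support Q)°; split; [|exact: inP|apply: sub; right|exact: dense].
Qed.

End PatchGeometry.

(** * Local finiteness in the hull *)

Section Hull.
Context {R : realType} {n : nat} {L : Type}.
Local Notation V := 'rV[R]_n.
Local Notation tile := (ltile R n L).
Implicit Types (t s : tile) (P Q T : set tile) (x y z : V).
Variable T0 : set tile.
Hypothesis hT0 : tiling T0.
Hypothesis hflc : finite_local_complexity T0.

Lemma in_hull0 : in_hull T0 T0.
Proof. by split => // P _ PT; exists 0; rewrite translate0. Qed.

Lemma in_hull_translate T x : in_hull T0 T -> in_hull T0 (translate T x).
Proof.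
move=> [hT TP]; split; first exact: tiling_translate.
move=> P pP PT; have [|y yP] := TP (translate P (- x)) (is_patch_translate _ pP).
  by apply/translate_subl; rewrite opprK.
by exists (- x + y); rewrite -translateD.
Qed.

Lemma hull_patch T P : in_hull T0 T -> finite_set P -> P `<=` T -> is_patch P.
Proof. by move=> [[pT _] _] fP PT; split => //; exact: partial_tilingS PT pT. Qed.

Lemma hull_appears T P : in_hull T0 T -> finite_set P -> P `<=` T ->
  exists x, translate P x `<=` T0.
Proof. by move=> hT fP PT; apply: hT.2 => //; exact: hull_patch PT. Qed.

(** Too many tiles of [T] near the origin would form a finite patch, a translate of which appears in
    [T0] within a ball of radius [r]; finite local complexity bounds the number of tiles there. *)
Lemma finite_meeting_hull T r : 0 < r -> in_hull T0 T ->
  finite_set (meeting T (eball 0 r)).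
Proof.
move=> r0 hT; have [F [fF FP T0F]] := hflc r0.
have [N NP] := finite_card_bound fF (fun P FP' => (FP P FP').2).
apply: contrapT => /(infinite_subset_card N.+1)[Q QT QN].
have fQ : finite_set Q by apply/finite_setP; exists N.+1.
have [x Qx] := hull_appears hT fQ (subset_trans QT (@meeting_sub _ _ _ _ _)).
have {}Qx : translate Q x `<=` meeting T0 (eball x r).
  move=> _ [t Qt <-]; split; first by apply: Qx; exists t.
  have [_ [y [ty yr]]] := QT t Qt.
  exists (y + x); split; first by apply/ttranslateP; rewrite addrK.
  by move: yr; rewrite /eball /= subr0 addrK.
have [P FP' [y E]] := T0F x; rewrite E in Qx.
suff : (`I_N.+1 #<= `I_N)%card by rewrite card_le_II ltnn.
apply: card_le_trans (NP P FP').
apply: card_le_trans (card_image_le (fun t => ttranslate t (y - x)) P).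
have QP : Q `<=` translate P (y - x).
  by rewrite -translateD; apply/translate_subl.
apply: card_le_trans (subset_card_le QP).
by move: (card_esym QN); rewrite card_eq_le => /andP[].
Qed.

End Hull.

(** * The semigroup and its tight characters *)

Section Semigroup.
Context {R : realType} {n : nat} {L : Type}.
Local Notation V := 'rV[R]_n.
Local Notation tile := (ltile R n L).
Implicit Types (t s p q : tile) (P Q T : set tile) (x y z : V).
Variables T0 protos : set tile.
Hypothesis hT0 : tiling T0.
Hypothesis hprotos : has_prototiles T0 protos.
Hypothesis hflc : finite_local_complexity T0.
Local Notation S := (tiling_semigroup T0).
Local Notation M := (connected_patches T0).

Definition appears P : Prop := exists x, translate P x `<=` T0.

Lemma appearsS P Q : P `<=` Q -> appears Q -> appears P.
Proof. by move=> PQ [x Qx]; exists x; apply: subset_trans (translateS PQ) Qx. Qed.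

Lemma appears_translate P x : appears (translate P x) <-> appears P.
Proof.
split => [[y]|[y Py]]; first by rewrite translateD => Py; exists (x + y).
by exists (y - x); rewrite translateD addrC subrK.
Qed.

(** * Products of classes of pointed patches *)

Lemma pclass_refl t P s : pclass t P s (t, P, s).
Proof. by exists 0; rewrite !ttranslate0 translate0. Qed.

Lemma pclass_translate t P s x :
  pclass (ttranslate t x) (translate P x) (ttranslate s x) = pclass t P s.
Proof.
apply/seteqP; split => w [y ->]; first by exists (x + y); rewrite -!ttranslateD translateD.
by exists (y - x); rewrite !ttranslateD translateD addrC subrK.
Qed.

Lemma pclass_eqP t P s t' P' s' : pclass t P s = pclass t' P' s' ->
  exists x, [/\ t' = ttranslate t x, P' = translate P x & s' = ttranslate s x].
Proof.
move=> E; have [x [-> -> ->]] : pclass t P s (t', P', s') by rewrite E; exact: pclass_refl.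
by exists x.
Qed.

Lemma pclass_neq0 t P s : pclass t P s <> set0.
Proof. by move=> E; have := pclass_refl t P s; rewrite E. Qed.

(** Both representatives are translated so as to send [t] to one and the same tile; a tile has no
    translational symmetry, so the two translations agree and [P] and [Q] keep their relative
    position. *)
Lemma pmulE t1 P t Q t2 : appears (P `|` Q) -> is_tile t ->
  pmul T0 (pclass t1 P t) (pclass t Q t2) = pclass t1 (P `|` Q) t2.
Proof.
move=> [z PQz] ht; apply/seteqP; split => w.
  move=> [a [A [b [b' [B [c [x [x']]]]]]]] [[u [-> -> ->]] [v [-> -> ->]] [_ _]].
  rewrite !ttranslateD => /(ttranslate_injr ht) uv.
  by rewrite !translateD uv -translateU pclass_translate.
move=> [y ->]; exists t1, P, t, t, Q, t2, z, z; split => //.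
- exact: pclass_refl.
- exact: pclass_refl.
- split; apply: subset_trans PQz; apply: translateS; [exact: subsetUl|exact: subsetUr].
- by rewrite -translateU pclass_translate; exists y.
Qed.

Lemma pmul_neq0 t1 P t t' Q t2 w : is_tile t ->
  pmul T0 (pclass t1 P t) (pclass t' Q t2) w ->
  exists x, t = ttranslate t' x /\ appears (P `|` translate Q x).
Proof.
move=> ht [a [A [b [b' [B [c [x [x']]]]]]]] [[u [-> -> ->]] [v [-> -> ->]] [PT QT]].
rewrite !ttranslateD => tt' _; exists (v + x' - (u + x)); split.
  by rewrite -ttranslateD -tt' ttranslateK.
exists (u + x); rewrite translateU translateD subrK.
by rewrite -!translateD => z [/PT|/QT].
Qed.

Lemma pmul0l a : pmul T0 set0 a = set0.
Proof. by apply/seteqP; split => // w [a' [A [b [b' [B [c [x [x' []]]]]]]]]. Qed.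

Lemma pmul0r a : pmul T0 a set0 = set0.
Proof. by apply/seteqP; split => // w [a' [A [b [b' [B [c [x [x' []]]]]]]]]. Qed.

Lemma pstarE t1 P t2 : pstar (pclass t1 P t2) = pclass t2 P t1.
Proof.
apply/seteqP; split => -[[a A] b] [x [-> -> ->]]; by exists x.
Qed.

Lemma M_tile P t : M P -> P t -> is_tile t.
Proof. by move=> [[[h _] _] _ _]; exact: h. Qed.

Lemma M_finite P : M P -> finite_set P.
Proof. by case=> -[]. Qed.

Lemma M_appears P : M P -> appears P.
Proof. by case. Qed.

Lemma M_translate P x : M P -> M (translate P x).
Proof.
move=> [pP aP cP]; split; first exact: is_patch_translate.
  exact/appears_translate.
exact: connected_translate_interior.
Qed.

Lemma M_proto P t : M P -> P t -> exists2 p, protos p & exists x, t = ttranslate p x.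
Proof.
move=> [_ [y Py] _] Pt; have [_ _ _ h] := hprotos.
have [|p pp [x tx]] := h (ttranslate t y); first by apply: Py; exists t.
by exists p => //; exists (x - y); rewrite -ttranslateD -tx ttranslateK.
Qed.

Lemma proto_tile p : protos p -> is_tile p.
Proof. by have [_ h _ _] := hprotos; move=> /h[]. Qed.

Lemma proto_shift p q x : protos p -> protos q -> q = ttranslate p x -> p = q /\ x = 0.
Proof.
have [_ _ h _] := hprotos => pp pq E; have pq' := h _ _ _ pp pq E; split => //.
by apply: (@ttranslate_fixed _ _ _ p); [exact: proto_tile|rewrite -E].
Qed.

Lemma appears_patch P : finite_set P -> appears P -> is_patch P.
Proof.
move=> fP [x Px]; split => //; rewrite -(translateK P x).
by apply: partial_tiling_translate; exact: partial_tilingS Px hT0.1.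
Qed.

(** The shared tile keeps the interior connected; this is why nonzero products remain in the
    semigroup. *)
Lemma M_union P Q t : M P -> M Q -> P t -> Q t -> appears (P `|` Q) -> M (P `|` Q).
Proof.
move=> MP MQ Pt Qt aPQ; split => //; first apply: appears_patch => //.
  by rewrite finite_setU; split; exact: M_finite.
apply: (connected_union _ Pt Qt); last by case: MQ.
  by move=> s [Ps|Qs]; [exact: M_tile Ps|exact: M_tile Qs].
by case: MP.
Qed.

(** * Idempotents and their order *)

Definition marked p P : Prop := [/\ protos p, M P & P p].

(* The idempotent [[p, P, p]]; a nonzero idempotent has exactly one such form
   with [p] a prototile, its puncture being then at the origin. *)
Definition nf p P : S := pclass p P p.

Lemma idempotent_nf p P : marked p P -> idempotents S (nf p P).
Proof.
move=> [pp MP Pp]; split; first by right; exists p, P, p.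
rewrite /= /nf pmulE ?setUid //; first exact: M_appears.
exact: proto_tile.
Qed.

Lemma elt_nf (a : S) : isg_elt S a -> a = szero S \/
  exists p P t, [/\ marked p P, P t & a = pclass t P p].
Proof.
move=> [->|[t1 [P [t2 [MP Pt1 Pt2 ->]]]]]; [by left|right].
have [p pp [x tx]] := M_proto MP Pt2.
exists p, (translate P (- x)), (ttranslate t1 (- x)); split.
- split => //; first exact: M_translate.
  by apply/translateP; rewrite opprK -tx.
- by exists t1.
- by rewrite -[RHS](pclass_translate _ _ _ x) ttranslateNK translateNK -tx.
Qed.

(** For [e] the class of [(t, P, p)] to have a nonzero square, [t] must be a translate of [p], by
    [- x]. The square then ends at [p] moved by [x] while still starting at [t]; equality with [e]
    forces [x = 0], that is, [t = p]. *)
Lemma idempotentP (e : S) : idempotents S e -> e = szero S \/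
  exists p P, marked p P /\ e = nf p P.
Proof.
move=> [Se ee]; have [|[p [P [t [mP Pt E]]]]] := elt_nf Se; [by left|right].
exists p, P; split => //; have [pp MP Pp] := mP.
have : pmul T0 e e (t, P, p) by rewrite [pmul _ _ _]ee E; exact: pclass_refl.
rewrite {1 2}E => h; have [x [px aPx]] := pmul_neq0 (proto_tile pp) h.
have E2 : pclass t P p = pclass p (translate P x) (ttranslate p x).
  by rewrite px pclass_translate.
have := @pmulE t P p (translate P x) (ttranslate p x) aPx (proto_tile pp).
rewrite -E2; move: ee; rewrite E /= => -> /pclass_eqP[y [/esym ty _ /esym]].
have tt := M_tile MP Pt.
move: ty => /(ttranslate_fixed tt) ->; rewrite ttranslate0.
by move=> /esym/(ttranslate_fixed (proto_tile pp)) x0; rewrite /nf px x0 ttranslate0.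
Qed.

Lemma nf_inj p P q Q : marked p P -> marked q Q -> nf p P = nf q Q -> p = q /\ P = Q.
Proof.
move=> [pp _ _] [pq _ _] /pclass_eqP[x [qx -> _]].
by have [-> ->] := proto_shift pp pq qx; rewrite translate0.
Qed.

Lemma nf_mul p P Q : marked p P -> marked p Q -> appears (P `|` Q) ->
  marked p (P `|` Q) /\ smul (nf p P) (nf p Q) = nf p (P `|` Q).
Proof.
move=> [pp MP Pp] [_ MQ Qp] aPQ; split; last by apply: pmulE => //; exact: proto_tile.
by split => //; [exact: M_union Pp Qp aPQ|left].
Qed.

Lemma nf_mul_neq0 p P q Q : marked p P -> marked q Q ->
  smul (nf p P) (nf q Q) <> szero S -> p = q /\ appears (P `|` Q).
Proof.
move=> [pp _ _] [pq _ _] /eqP/set0P[w /(pmul_neq0 (proto_tile pp))[x [px aPQ]]].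
by have [-> x0] := proto_shift pq pp px; move: aPQ; rewrite x0 translate0.
Qed.

(** The product takes the union of patches, so that $e = ef$ reads $P = P \cup Q$: the order is
    reverse inclusion. *)
Lemma idem_le_nf p P (f : S) : marked p P -> idempotents S f ->
  idem_le (nf p P) f <-> exists Q, [/\ marked p Q, f = nf p Q & Q `<=` P].
Proof.
move=> mP Ef; split => [|[Q [mQ -> QP]]]; last first.
  have PQ : P `|` Q = P by apply/setUidPl.
  have [|_] := nf_mul mP mQ; first by rewrite PQ; case: mP => _ /M_appears.
  by rewrite PQ.
have [->|[q [Q [mQ ->]]]] := idempotentP Ef.
  by rewrite /idem_le /= pmul0r => /pclass_neq0.
move=> E; have [|pq aPQ] := nf_mul_neq0 mP mQ; first by rewrite -E; exact: pclass_neq0.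
subst q; exists Q; split => //; have [mPQ E'] := nf_mul mP mQ aPQ.
have [_ ->] := nf_inj mP mPQ (etrans E E'); exact: subsetUr.
Qed.

(** * Tilings seen through their tiles near the origin *)

Lemma absorb P : (forall t, P t -> is_tile t) -> finite_set P ->
  exists2 r0 : R, 0 < r0 & forall r t, r0 <= r -> P t -> t.1 `&` eball 0 r !=set0.
Proof.
move=> tP fP; move: P fP tP.
apply: (@finite_set_elim _ (fun P => (forall t, P t -> is_tile t) -> _)) => [_|a P IHP tP].
  by exists 1.
have [|r0 r00 h] := IHP; first by move=> t Pt; apply: tP; right.
have [y ay] : a.1 !=set0 by apply: tile_nonempty; apply: tP; left.
exists (Num.max r0 (enorm y + 1)) => [|r t]; first by rewrite lt_max r00.
rewrite ge_max => /andP[r0r yr] [->|Pt]; last exact: h.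
exists y; split => //; rewrite /eball /= subr0 (lt_le_trans _ yr) // ltrDl.
exact: ltr01.
Qed.

(** The given tiles cover the ball, which leaves no room for another tile of [T'] meeting it. *)
Lemma meeting_determined T T' r : tiling T -> partial_tiling T' ->
  finite_set (meeting T (eball 0 r)) -> meeting T (eball 0 r) `<=` T' ->
  meeting T' (eball 0 r) = meeting T (eball 0 r).
Proof.
move=> hT pT' fT sub; apply/seteqP; split => [t [T't tr]|t Tt]; last first.
  by split; [exact: sub|case: Tt].
exact: (tile_in_patch pT' fT sub (@open_eball R n r) (eball_sub_meeting hT) T't tr).
Qed.

Definition punctured T : Prop := in_hull T0 T /\ exists2 p, protos p & T p.

Lemma proto_origin p : protos p -> p.1° 0.
Proof. by have [_ h _ _] := hprotos; move=> /h[]. Qed.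

Lemma proto_unique T p q : partial_tiling T -> protos p -> protos q -> T p -> T q -> p = q.
Proof.
by move=> pT pp pq Tp Tq; apply: (partial_tiling_inj pT Tp Tq (proto_origin pp) (proto_origin pq)).
Qed.

Lemma marked_meeting T p r : 0 < r -> in_hull T0 T -> protos p -> T p ->
  marked p (meeting T (eball 0 r)).
Proof.
move=> r0 hT pp Tp; have fT := finite_meeting_hull hflc r0 hT.
have sT : meeting T (eball 0 r) `<=` T by exact: meeting_sub.
split => //; last first.
  split => //; exists 0; split; first exact: interior_subset (proto_origin pp).
  by rewrite /eball /= subrr enorm0.
split; [exact: hull_patch hT fT sT|exact: hull_appears hT fT sT|].
by apply: connected_meeting => //; case: hT.
Qed.

(** The patches cut out by balls around the origin are cofinal among the finite parts of [T]. *)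
Lemma marked_cover T p P : in_hull T0 T -> protos p -> T p -> finite_set P -> P `<=` T ->
  exists r : R, [/\ 0 < r, marked p (meeting T (eball 0 r)) & P `<=` meeting T (eball 0 r)].
Proof.
move=> hT pp Tp fP PT; have [|r r0 h] := absorb _ fP.
  by move=> t /PT; case: hT => -[[+ _] _ _ Tt]; apply.
exists r; split => //; first exact: marked_meeting.
by move=> t Pt; split; [exact: PT|exact: h].
Qed.

(** Take a ball that meets all tiles of [P]. A translate of [T0] containing both [P] and the tiles
    of [T] that meet this ball has no other tile meeting it, so [P] is among the latter. *)
Lemma compatible_sub T P : in_hull T0 T -> (forall t, P t -> is_tile t) -> finite_set P ->
  (forall r : R, 0 < r -> appears (P `|` meeting T (eball 0 r))) -> P `<=` T.
Proof.
move=> hT tP fP aP; have [r r0 h] := absorb tP fP.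
have [z /translate_subl PT0] := aP r r0.
have fT := finite_meeting_hull hflc r0 hT.
have E := meeting_determined hT.1 (partial_tiling_translate (- z) hT0.1) fT
  (subset_trans (@subsetUr _ _ _) PT0).
move=> t Pt; apply: (@meeting_sub _ _ _ T (eball 0 r)); rewrite -E.
by split; [apply: PT0; left|exact: h].
Qed.

(* The character of the filter of the [[p, P, p]] with [P] a patch of [T]
   around the tile [p] at the origin. *)
Definition tchar T : {ptws S -> bool} :=
  fun e => `[< idempotents S e /\ exists p P, [/\ protos p, (e : set (ptriple)) (p, P, p) & P `<=` T] >].

Lemma tchar_nf T p P : marked p P -> tchar T (nf p P) <-> P `<=` T.
Proof.
move=> mP; split => [/asboolP[_ [q [Q [pq [x [qx -> _]] QT]]]]|PT].
  have [pp _ _] := mP; have [_ x0] := proto_shift pp pq qx.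
  by move: QT; rewrite x0 translate0.
apply/asboolP; split; first exact: idempotent_nf.
by have [pp _ _] := mP; exists p, P; split => //; exact: pclass_refl.
Qed.

Lemma tchar0 T : tchar T (szero S) = false.
Proof. by apply/negP => /asboolP[_ [p [P []]]]. Qed.

Lemma tcharP T (e : S) : tchar T e <-> exists p P, [/\ marked p P, e = nf p P & P `<=` T].
Proof.
split => [h|[p [P [mP -> PT]]]]; last exact/tchar_nf.
have /asboolP[/idempotentP Ee _] := h.
case: Ee => [E0|[p [P [mP E]]]]; first by move: h; rewrite E0 tchar0.
by exists p, P; split => //; apply/(tchar_nf _ mP); rewrite -E.
Qed.

Lemma tchar_character T : punctured T -> characters (tchar T).
Proof.
move=> [hT [p pp Tp]]; split.
- by move=> e /asboolP[].
- exists (nf p (meeting T (eball 0 1))).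
  by apply/tchar_nf; [exact: marked_meeting|exact: meeting_sub].
- move=> e f Ee Ef; apply/idP/andP.
    have [->|[q [Q [mQ ->]]]] := idempotentP Ee; first by rewrite /= pmul0l tchar0.
    have [->|[s [P [mP ->]]]] := idempotentP Ef; first by rewrite /= pmul0r tchar0.
    move=> h; have [|qs aQP] := nf_mul_neq0 mQ mP; first by move=> E; rewrite E tchar0 in h.
    subst s; have [mQP E] := nf_mul mQ mP aQP; move: h; rewrite E.
    move=> /(tchar_nf _ mQP) QPT.
    by split; apply/tchar_nf => //; apply: subset_trans QPT; [exact: subsetUl|exact: subsetUr].
  move=> [/tcharP[q [Q [mQ -> QT]]] /tcharP[s [P [mP -> PT]]]].
  have qs : q = s.
    have [pq _ Qq] := mQ; have [ps _ Ps] := mP.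
    exact: (proto_unique hT.1.1 pq ps (QT _ Qq) (PT _ Ps)).
  subst s; have QPT : Q `|` P `<=` T by rewrite subUset.
  have [|mQP ->] := nf_mul mQ mP.
    apply: (hull_appears hT) => //; rewrite finite_setU.
    by split; apply: M_finite; [case: mQ|case: mP].
  exact/tchar_nf.
- exact: tchar0.
Qed.

Lemma tchar_filter T : punctured T -> sfilter [set e | tchar T e].
Proof.
move=> Tp; have [cE [e0 Te0] cM c0] := tchar_character Tp.
split => [| |e f Te Ef ef|e f Te Tf].
- by split; [move=> e /cE|exists e0].
- by rewrite /= c0.
- by move: (Te); rewrite /= ef cM //; [move=> /andP[]|exact: cE].
exists (smul e f); first by rewrite /= cM; [apply/andP|exact: cE|exact: cE].
move: Te Tf => /tcharP[q [Q [mQ -> QT]]] /tcharP[s [P [mP -> PT]]].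
have [hT [p pp T_p]] := Tp.
have qs : q = s.
  have [pq _ Qq] := mQ; have [ps _ Ps] := mP.
  exact: (proto_unique hT.1.1 pq ps (QT _ Qq) (PT _ Ps)).
subst s; have QPT : Q `|` P `<=` T by rewrite subUset.
have [|mQP ->] := nf_mul mQ mP.
  apply: (hull_appears hT) => //; rewrite finite_setU.
  by split; apply: M_finite; [case: mQ|case: mP].
by split; apply/(idem_le_nf mQP); first exact: idempotent_nf;
  [exists Q|exact: idempotent_nf|exists P]; split.
Qed.

(** In a larger filter, any patch [Q] has a common lower bound with each patch of [T] cut out by a
    ball; it is then compatible with all of them, hence contained in [T]. *)
Lemma tchar_ultra T : punctured T -> ultra_sfilter [set e | tchar T e].
Proof.
move=> Tp; split; first exact: tchar_filter.
move=> zeta [[zE _] z0 zup zdir] Tz; apply/seteqP; split => // e ze.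
have [Ee0|[q [Q [mQ Ee]]]] := idempotentP (zE _ ze); first by rewrite -Ee0 in z0.
rewrite Ee /=; apply/(tchar_nf _ mQ).
have [hT [p pp T_p]] := Tp; apply: (compatible_sub hT).
- by move=> t; case: mQ => _ MQ _; exact: M_tile MQ.
- by case: mQ => _ /M_finite.
move=> r r0; have mr := marked_meeting r0 hT pp T_p.
have zr : zeta (nf p (meeting T (eball 0 r))).
  by apply: Tz; apply/(tchar_nf _ mr); exact: meeting_sub.
have [d zd [de dr]] := zdir _ _ ze zr.
have [d0|[s [D [mD Ed]]]] := idempotentP (zE _ zd); first by rewrite d0 in zd.
move: de dr; rewrite Ed Ee => /(idem_le_nf mD (idempotent_nf mQ))[Q' [mQ' /(nf_inj mQ mQ')[_ <-] QD]].
move=> /(idem_le_nf mD (idempotent_nf mr))[r' [mr' /(nf_inj mr mr')[_ <-] rD]].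
apply: (@appearsS _ D); first by rewrite subUset.
by case: mD => _ /M_appears.
Qed.

Lemma tchar_tight T : punctured T -> tight_characters (tchar T).
Proof.
move=> Tp; split; first exact: tchar_character.
by apply: subset_closure; split; [exact: tchar_character|exact: tchar_ultra].
Qed.

Lemma tchar_inj T T' : punctured T -> punctured T' -> tchar T = tchar T' -> T = T'.
Proof.
have sub A B : punctured A -> tchar A = tchar B -> A `<=` B.
  move=> [hA [p pp Ap]] AB t At.
  have [||r [r0 mr tr]] := @marked_cover A p [set t] hA pp Ap; first exact: finite_set1.
    by move=> _ ->.
  have /(tchar_nf _ mr) : tchar B (nf p (meeting A (eball 0 r))).
    by rewrite -AB; apply/(tchar_nf _ mr); exact: meeting_sub.
  by apply; exact: tr.
by move=> hT hT' E; apply/seteqP; split; apply: sub.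
Qed.

(** Maximality criterion: an ultrafilter contains every idempotent having nonzero product with all
    its members. Here [zeta] is the filter generated by [xi] and [nf p Q]. *)
Lemma ultra_mem (xi : set S) p Q : ultra_sfilter xi -> marked p Q ->
  (forall q F, marked q F -> xi (nf q F) -> smul (nf q F) (nf p Q) <> szero S) ->
  xi (nf p Q).
Proof.
move=> [[[xiE [e0 xe0]] xi0 xiup xidir] ximax] mQ nz.
have xinf e : xi e -> exists F, [/\ marked p F, e = nf p F & appears (F `|` Q)].
  move=> xe; have [e00|[q [F [mF E]]]] := idempotentP (xiE _ xe); first by rewrite -e00 in xi0.
  subst e; have [qp aFQ] := nf_mul_neq0 mF mQ (nz _ _ mF xe).
  by subst q; exists F.
pose zeta : set S := [set e | exists F B, [/\ xi (nf p F), marked p F /\ appears (F `|` Q),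
  marked p B, B `<=` F `|` Q & e = nf p B]].
have [F0 [mF0 E0 aF0]] := xinf _ xe0; subst e0.
have zQ : zeta (nf p Q) by exists F0, Q; split.
suff <- : zeta = xi by [].
apply: ximax.
- split.
  + split; last by exists (nf p Q).
    by move=> _ [F [B [_ _ mB _ ->]]]; exact: idempotent_nf.
  + by move=> [F [B [_ _ _ _ /esym/pclass_neq0]]].
  + move=> _ f [F [B [xF [mF aF] mB BF ->]]] Ef /(idem_le_nf mB Ef)[C [mC -> CB]].
    by exists F, C; split => //; exact: subset_trans BF.
  + move=> _ _ [F [B [xF [mF aF] mB BF ->]]] [F' [B' [xF' [mF' aF'] mB' BF' ->]]].
    have [d xd [dF dF']] := xidir _ _ xF xF'.
    have [D [mD Ed aD]] := xinf _ xd; subst d.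
    move: dF => /(idem_le_nf mD (idempotent_nf mF))[? [m1 /(nf_inj mF m1)[_ <-] FD]].
    move: dF' => /(idem_le_nf mD (idempotent_nf mF'))[? [m2 /(nf_inj mF' m2)[_ <-] FD']].
    have [mDQ _] := nf_mul mD mQ aD.
    exists (nf p (D `|` Q)); first by exists D, (D `|` Q); split.
    split; apply/(idem_le_nf mDQ); try exact: idempotent_nf.
      by exists B; split => //; apply: subset_trans BF _; exact: setSU.
    by exists B'; split => //; apply: subset_trans BF' _; exact: setSU.
- move=> e xe; have [F [mF Ee aF]] := xinf _ xe; subst e.
  by exists F, F; split => //; exact: subsetUl.
Qed.

(* The compactness of the punctured hull enters through this finite set. *)
Lemma flc_classes (r : R) : 0 < r -> exists EE : set S, finite_set EE /\
  forall T p, in_hull T0 T -> protos p -> T p -> EE (nf p (meeting T (eball 0 r))).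
Proof.
move=> r0; have [F [fF FP T0F]] := hflc r0.
exists (\bigcup_(P in F) ((fun t => pclass t P t) @` P)); split.
  by apply: bigcup_finite => // P /FP[_ fP]; exact: finite_image.
move=> T p hT pp Tp; have fT := finite_meeting_hull hflc r0 hT.
have [x Tx] := hull_appears hT fT (@meeting_sub _ _ _ _ _).
have [P FP' [y E]] := T0F x.
have Tx' : meeting T0 (eball x r) = translate (meeting T (eball 0 r)) x.
  have := meeting_determined hT.1 (partial_tiling_translate (- x) hT0.1) fT.
  rewrite -translate_subl => /(_ Tx) <-.
  by rewrite -meeting_translate add0r translateNK.
have mE : meeting T (eball 0 r) = translate P (y - x).
  by rewrite -(translateK (meeting T _) x) -Tx' E translateD.
have Pp : P (ttranslate p (- (y - x))).
  apply/translateP; rewrite -mE; split => //; exists 0.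
  split; first exact: interior_subset (proto_origin pp).
  by rewrite /eball /= subrr enorm0.
exists P => //; exists (ttranslate p (- (y - x))) => //.
by rewrite /nf mE -[RHS](pclass_translate _ _ _ (- (y - x))) translateK.
Qed.

(** Since [bool] is discrete, prescribing finitely many values is an open condition. *)
Lemma ptws_closure_finite (I : Type) (A : set {ptws I -> bool}) (phi : {ptws I -> bool})
    (EE : set I) : closure A phi -> finite_set EE ->
  exists2 psi : {ptws I -> bool}, A psi & forall e, EE e -> psi e = phi e.
Proof.
move=> cA fE; have : nbhs phi [set psi : {ptws I -> bool} | forall e, EE e -> psi e = phi e].
  move: EE fE; apply: finite_set_elim => [|a EE IHE]; first by apply: filterE => psi e [].
  have ha : nbhs phi [set psi : {ptws I -> bool} | psi a = phi a].
    have := @proj_continuous {classic I} (fun=> bool) a phi _ (discrete_set1 (phi a)).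
    by [].
  apply: filterS (filterI ha IHE) => psi [pa pE] e [->//|]; exact: pE.
by move=> /cA[psi [Apsi psiE]]; exists psi.
Qed.

Lemma character_union (phi : {ptws S -> bool}) p q P Q : characters phi ->
  marked p P -> marked q Q -> phi (nf p P) -> phi (nf q Q) ->
  [/\ q = p, marked p (P `|` Q) & phi (nf p (P `|` Q))].
Proof.
move=> [_ _ phiM phi0] mP mQ phiP phiQ.
have h := phiM _ _ (idempotent_nf mP) (idempotent_nf mQ); rewrite phiP phiQ in h.
have [|pq aQ] := nf_mul_neq0 mP mQ; first by move=> E; rewrite E phi0 in h.
by subst q; have [mU E] := nf_mul mP mQ aQ; rewrite E in h.
Qed.

(** Otherwise each patch [Q] with [nf p Q] in [EE] and outside [psi] is incompatible with some patch
    of [psi], and [F], a union of finitely many such patches, is incompatible with all of them. But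
    [F] occurs in a translate of [T0], together with the patch cut out there by the ball. *)
Lemma ultracharacter_meeting (psi : {ptws S -> bool}) p Q0 (r : R) (EE : set S) :
  ultracharacters psi -> marked p Q0 -> psi (nf p Q0) -> 0 < r -> finite_set EE ->
  (forall T, in_hull T0 T -> T p -> EE (nf p (meeting T (eball 0 r)))) ->
  exists T, [/\ in_hull T0 T, T p & psi (nf p (meeting T (eball 0 r)))].
Proof.
move=> [cpsi upsi] mQ0 psiQ0 r0 fE EP; apply: contrapT => no.
have pp : protos p by case: mQ0.
have [F [mF psiF FE]] : exists F, [/\ marked p F, psi (nf p F) &
    forall Q, marked p Q -> EE (nf p Q) -> ~ psi (nf p Q) -> ~ appears (F `|` Q)].
  move: EE fE {EP}; apply: finite_set_elim => [|a EE [F [mF psiF FE]]]; first by exists Q0; split.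
  have [[Q [mQ Ea nQ]]|na] := pselect (exists Q, [/\ marked p Q, a = nf p Q & ~ psi (nf p Q)]); last first.
    exists F; split => // Q mQ [Ea|EQ] nQ; last exact: FE.
    by case: na; exists Q.
  have [F' [mF' psiF' aF']] : exists F', [/\ marked p F', psi (nf p F') & ~ appears (F' `|` Q)].
    apply: contrapT => nF'; apply: nQ; apply: (ultra_mem upsi mQ) => q F' mF' psiF' E.
    have [qp _ _] := character_union cpsi mQ0 mF' psiQ0 psiF'; subst q.
    apply: nF'; exists F'; split => // aF'; have [_ E'] := nf_mul mF' mQ aF'.
    by rewrite E in E'; exact: pclass_neq0 (esym E').
  have [_ mU psiU] := character_union cpsi mF mF' psiF psiF'.
  exists (F `|` F'); split => // Q' mQ' [E|EQ'] nQ'.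
    have [_ ->] := nf_inj mQ' mQ (etrans E Ea).
    by apply: contra_not aF'; apply: appearsS; apply: setSU; exact: subsetUr.
  apply: contra_not (FE Q' mQ' EQ' nQ'); apply: appearsS; apply: setSU; exact: subsetUl.
have [_ MF Fp] := mF; have [x FT0] := M_appears MF.
have hT := in_hull_translate (- x) (in_hull0 hT0).
have /translate_subl FT := FT0; have Tp := FT _ Fp.
have mT := marked_meeting r0 hT pp Tp.
apply: (FE _ mT (EP _ hT Tp)) => [psiT|]; first by apply: no; exists (translate T0 (- x)).
apply: (hull_appears hT).
  by rewrite finite_setU; split; [exact: M_finite MF|case: mT => _ /M_finite].
by rewrite subUset; split => //; exact: meeting_sub.
Qed.

(** [T] is the union of the patches on which [phi] is 1; any finite part of it lies in one of them.
    It covers every ball because [phi] agrees with an ultracharacter on the finitely many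
    idempotents of [flc_classes]. *)
Lemma tight_tchar phi : tight_characters (phi : {ptws S -> bool}) ->
  exists2 T, punctured T & phi = tchar T.
Proof.
move=> [[phiE [e0 phie0] phiM phi0] cphi].
have [e00|[p [Q0 [mQ0 E0]]]] := idempotentP (phiE _ phie0); first by rewrite e00 phi0 in phie0.
subst e0; have [pp _ Q0p] := mQ0.
have phi_inf e : phi e -> exists2 Q, marked p Q & e = nf p Q.
  move=> phie; have [e00|[q [Q [mQ Ee]]]] := idempotentP (phiE _ phie); first by rewrite e00 phi0 in phie.
  subst e; have [|qp _] := nf_mul_neq0 mQ0 mQ; last by subst q; exists Q.
  move=> E; have := phiM _ _ (idempotent_nf mQ0) (idempotent_nf mQ).
  by rewrite E phi0 phie phie0.
have cphi' : characters (phi : {ptws S -> bool}) by split => //; exists (nf p Q0).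
have phiU Q Q' : marked p Q -> marked p Q' -> phi (nf p Q) -> phi (nf p Q') ->
    marked p (Q `|` Q') /\ phi (nf p (Q `|` Q')).
  by move=> mQ mQ' phiQ phiQ'; have [] := character_union cphi' mQ mQ' phiQ phiQ'.
pose T := \bigcup_(Q in [set Q | marked p Q /\ phi (nf p Q)]) Q.
have TQ P : finite_set P -> P `<=` T -> exists Q, [/\ marked p Q, phi (nf p Q) & P `<=` Q].
  move: P; apply: finite_set_elim => [|a P IHP PT]; first by exists Q0; split.
  have [|Q [mQ phiQ PQ]] := IHP; first by move=> t Pt; apply: PT; right.
  have [|Q' [mQ' phiQ'] Q'a] := PT a; first by left.
  have [mU phiQQ] := phiU _ _ mQ mQ' phiQ phiQ'.
  by exists (Q `|` Q'); split => // t [->|/PQ]; [right|left].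
have Tp : T p by exists Q0.
have pT : partial_tiling T.
  split => [t [Q [[_ MQ _] _] Qt]|t s Tt Ts ts]; first exact: M_tile MQ Qt.
  have [||Q [[_ [[[_ dQ] _] _ _] _] _ tsQ]] := TQ [set t; s]; first exact: finite_set2.
    by move=> _ [->|->].
  by apply: dQ => //; apply: tsQ; [left|right].
have cover r : 0 < r -> eball 0 r `<=` tiling_support T.
  move=> r0; have [EE [fE EP]] := flc_classes r0.
  (* Adding [nf p Q0] to the finite set ensures that [psi] has the same prototile [p] at the origin
     as [phi]. *)
  have [|psi upsi psiphi] := @ptws_closure_finite _ _ _ (EE `|` [set nf p Q0]) cphi.
    by rewrite finite_setU; split => //; exact: finite_set1.
  have psi0 : psi (nf p Q0) by rewrite psiphi //; right.
  have [T' [hT' T'p psiT']] := ultracharacter_meeting upsi mQ0 psi0 r0 fE (fun T hT => EP T p hT pp).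
  have mT' := marked_meeting r0 hT' pp T'p.
  move=> y /(eball_sub_meeting hT'.1)[t Qt ty]; exists t => //.
  exists (meeting T' (eball 0 r)) => //; split => //; rewrite -psiphi //.
  by left; exact: EP.
have hT : in_hull T0 T.
  split; first split => //.
    apply/seteqP; split => // y _; apply: (cover (enorm y + 1)); first by rewrite ltr_wpDl ?sqrtr_ge0.
    by rewrite /eball /= subr0 ltrDl ltr01.
  move=> P [_ fP] /(TQ _ fP)[Q [[_ /M_appears aQ _] _ PQ]].
  exact: appearsS PQ aQ.
exists T; first by split => //; exists p.
apply/funext => e; apply/idP/idP => [phie|/tcharP[q [Q [mQ -> QT]]]].
  have [Q mQ Ee] := phi_inf _ phie; subst e; apply/(tchar_nf _ mQ) => t Qt.
  by exists Q.
have [pq _ Qq] := mQ; have qp := proto_unique pT pq pp (QT _ Qq) Tp; subst q.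
have fQ : finite_set Q by case: mQ => _ /M_finite.
have [Q' [mQ' phiQ' QQ']] := TQ _ fQ QT.
have QU : Q' `|` Q = Q' by exact/setUidPl.
have [|_ E] := nf_mul mQ' mQ; first by rewrite QU; case: mQ' => _ /M_appears.
have := phiM _ _ (idempotent_nf mQ') (idempotent_nf mQ).
by rewrite E QU phiQ' /= => <-.
Qed.
End Semigroup.

(** * The topology of the punctured hull *)

Lemma nbhs_initialP (S : choiceType) (T : topologicalType) (f : S -> T)
    (s : initial_topology f) (N : set (initial_topology f)) :
  nbhs s N <-> exists2 A, nbhs (f s) A & f @^-1` A `<=` N.
Proof.
split => [|[A fA AN]]; last by apply: filterS AN _; exact: initial_continuous.
rewrite nbhsE => -[_ [[A oA <-] As] AN]; exists A => //.
by exists A.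
Qed.

Lemma cvg_ptws (I : Type) (T : topologicalType) (F : set_system {ptws I -> T})
    (f : {ptws I -> T}) : Filter F ->
  (forall i A, nbhs (f i) A -> F [set g : {ptws I -> T} | A (g i)]) -> F --> f.
Proof.
move=> FF cF; apply/cvg_sup => i N /nbhs_initialP[A fA AN].
by apply: filterS (cF i A fA) => g Ag; apply: AN.
Qed.

Lemma cvg_germs (S : invsemigroup) (X : topologicalType) (D : S -> set X)
    (F : set_system (germs D)) (g : germs D) : Filter F ->
  (forall W, germ_base W -> W g -> F W) -> F --> g.
Proof.
move=> FF cF N; rewrite nbhsE => -[_ [[B sB <-] [C BC Cg] sUBN]].
apply: filterS sUBN _; apply: (@filterS _ _ _ C).
  by move=> h Ch; exists C.
have [E sED CE] := sB _ BC; rewrite -CE; apply: filter_bigI => W EW.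
have := sED _ EW; rewrite inE => bW; apply: cF => //.
by move: Cg; rewrite -CE; apply.
Qed.

Section HullTopology.
Context {R : realType} {n : nat} {L : Type}.
Local Notation V := 'rV[R]_n.
Local Notation tile := (ltile R n L).
Implicit Types (t s p q : tile) (P Q T : set tile) (x y z : V).
Variables T0 protos : set tile.
Hypothesis hT0 : tiling T0.
Hypothesis hprotos : has_prototiles T0 protos.
Hypothesis hflc : finite_local_complexity T0.
Local Notation Om := (hull_punc T0 protos).

Lemma tiling_of_punctured (T : Om) : punctured T0 protos (tiling_of T).
Proof.
case: T => [[T hT] pT]; split; first by rewrite /tiling_of; exact: set_mem hT.
by have := set_mem pT.
Qed.

Lemma tiling_of_inj : injective (@tiling_of R n L T0 protos).
Proof. by move=> T T' E; apply/val_inj/val_inj. Qed.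

Lemma punctured_tiling_of T : punctured T0 protos T -> exists T' : Om, tiling_of T' = T.
Proof.
move=> [hT pT]; pose H : hull T0 := exist _ T (mem_set hT).
have pH : in_hull_punc protos H by [].
by exists (exist _ H (mem_set pH)).
Qed.

(** The finitely many prototiles share a ball around the origin in their interiors. A puncture this
    close to the origin must be at the origin. *)
Lemma protos_ball : exists2 e : R, 0 < e &
  forall p x, protos p -> `|x| < e -> p.1° x.
Proof.
have [fp hp _ _] := hprotos.
suff : exists2 e : R, 0 < e & forall p x, protos p -> `|x| < e -> p.1 x.
  move=> [e e0 eP]; exists e => // p x pp xe; apply/nbhs_ballP.
  exists (e - `|x|); first by rewrite /= subr_gt0.
  move=> y; rewrite -ball_normE /= => xy; apply: eP => //.
  by rewrite -(subrK x y) (le_lt_trans (ler_normD _ _)) // -ltrBrDr distrC.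
have {}hp p : protos p -> p.1° 0 by move=> /hp[].
move: protos fp hp; apply: finite_set_elim => [_|a A IHA aA]; first by exists 1.
have [|e e0 eP] := IHA; first by move=> p Ap; apply: aA; right.
have /nbhs_ballP[d /= d0 dP] : a.1° 0 by apply: aA; left.
exists (Num.min e d) => [|p x [->|Ap]]; first by rewrite lt_min e0.
  rewrite lt_min => /andP[_ xd]; apply: dP.
  by rewrite -ball_normE /= sub0r normrN.
by rewrite lt_min => /andP[xe _]; exact: eP.
Qed.

(** The bound [r <= 1] excludes the value 1 put into the infimum by hand. *)
Lemma tdist_lt T T' (r : R) : tdist T T' < r -> r <= 1 ->
  exists e x x', [/\ e < r, enorm x < e /\ enorm x' < e &
    meeting (translate T (- x)) (eball 0 e^-1) = meeting (translate T' (- x')) (eball 0 e^-1)].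
Proof.
move=> Tr r1; have [|e [->|[x [x' [xe xe' E]]]]] := inf_lt _ Tr.
- by exists 1; left.
- by rewrite ltNge r1.
- by move=> er; exists e, x, x'.
Qed.

Lemma tdist_le T T' (e : R) : 0 < e ->
  meeting T (eball 0 e^-1) = meeting T' (eball 0 e^-1) -> tdist T T' <= e.
Proof.
move=> e0 E; apply: ge_inf; last first.
  by right; exists 0, 0; rewrite enorm0 oppr0 !translate0.
exists 0 => d [->|[x [x' [xd _ _]]]]; first exact: ler01.
by rewrite (le_trans _ (ltW xd)) // sqrtr_ge0.
Qed.

(* Small translations have to be allowed for this set to be open in the hull;
   on the punctured hull they are trivial. *)
Definition near_tiling P (e : R) : set (hull T0) :=
  [set T | exists x, `|x| < e /\ translate P x `<=` set_val T].

Lemma open_near_tiling P (r e : R) : 0 < r ->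
  (forall t, P t -> t.1 `&` eball 0 r !=set0) -> hull_open (near_tiling P e).
Proof.
(* The tiles of [P], moved by [x - x1], still meet the Euclidean ball of radius [c], the factor
   [n.+1] comparing the norms. In [d], the term [c^-1] makes this ball one on which the tilings
   agree, and [(e - |x|) / 2] leaves room for two small translations. *)
move=> r0 Pr T [x [xe PT]]; pose c := n.+1%:R * (r + `|x| + 1).
have c0 : 0 < c by rewrite mulr_gt0 // ?ltr0Sn // !ltr_wpDr ?ltr01.
pose d := Num.min (Num.min 1 c^-1) ((e - `|x|) / 2).
have d0 : 0 < d by rewrite !lt_min ltr01 invr_gt0 c0 divr_gt0 // subr_gt0.
have d1 : d <= 1 by rewrite !ge_min lexx.
have dc : d <= c^-1 by rewrite !ge_min lexx orbT.
have de : d <= (e - `|x|) / 2 by rewrite ge_min lexx orbT.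
exists d => // T' /tdist_lt/(_ d1)[e' [x1 [x2 [e'd [x1e x2e] E]]]].
have e'0 : 0 < e' by rewrite (le_lt_trans _ x1e) // sqrtr_ge0.
have n1 := le_lt_trans (norm_le_enorm x1) x1e.
have n2 := le_lt_trans (norm_le_enorm x2) x2e.
exists (x - x1 + x2); split.
  rewrite (le_lt_trans (ler_normD _ _)) // (le_lt_trans (lerD (ler_normB _ _) (lexx _))) //.
  by move: de; rewrite ler_pdivlMr //; lra.
move=> _ [t Pt <-]; have [y [ty yr]] := Pr t Pt.
have Tt : meeting (translate (set_val T) (- x1)) (eball 0 e'^-1) (ttranslate t (x - x1)).
  split; first by rewrite -ttranslateD; exists (ttranslate t x) => //; apply: PT; exists t.
  exists (y + (x - x1)); split; first by apply/ttranslateP; rewrite addrK.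
  rewrite /eball /= subr0 (le_lt_trans (enorm_le_norm _)) //.
  rewrite (@lt_le_trans _ _ c) //; last first.
    by rewrite -[c]invrK lef_pV2 ?posrE ?invr_gt0 // (le_trans (ltW e'd)).
  rewrite ltr_pM2l ?ltr0Sn // (le_lt_trans (ler_normD _ _)) //.
  rewrite (le_lt_trans (lerD (lexx _) (ler_normB _ _))) //.
  have := le_lt_trans (norm_le_enorm y) (_ : enorm y < r).
  by move: yr; rewrite /eball /= subr0 => yr /(_ yr); lra.
move: Tt; rewrite E => -[/translateP + _]; rewrite opprK ttranslateD.
by apply.
Qed.

(** Punctured tilings that are close for [tdist] agree near the origin up to a small translation,
    which must be zero: both have a prototile there, and these prototiles would overlap. *)
Lemma nbhs_hull_punc (T : Om) (N : set Om) : nbhs T N <-> exists2 r : R, 0 < r &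
  forall T' : Om, meeting (tiling_of T') (eball 0 r) = meeting (tiling_of T) (eball 0 r) -> N T'.
Proof.
have [hT [p pp Tp]] := tiling_of_punctured T.
split.
  move=> /nbhs_initialP[A]; rewrite nbhsE => -[U [oU UT] UA] AN.
  have [r r0 rU] : exists2 r : R, 0 < r & forall T' : hull T0, tdist (tiling_of T) (set_val T') < r -> U T'.
    exact: oU.
  exists (r / 2)^-1; first by rewrite invr_gt0 divr_gt0.
  move=> T' E; apply/AN/UA/rU; rewrite (@le_lt_trans _ _ (r / 2)) //.
    by apply: tdist_le; rewrite ?divr_gt0.
  by rewrite ltr_pdivrMr // ltr_pMr // ltr1n.
move=> [r r0 rN]; have [e e0 eP] := protos_ball.
pose P := meeting (tiling_of T) (eball 0 r).
have fP : finite_set P := finite_meeting_hull hflc r0 hT.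
have oP : hull_open (near_tiling P e) by apply: (open_near_tiling r0) => t [].
apply/nbhs_initialP; exists (near_tiling P e).
  rewrite nbhsE; exists (near_tiling P e) => //; split => //.
  exists 0; rewrite normr0; split => //; rewrite translate0; exact: meeting_sub.
move=> T' [x [xe PT']]; apply: rN.
have [hT' [q pq T'q]] := tiling_of_punctured T'.
have mT := marked_meeting hprotos hflc r0 hT pp Tp.
have T'p : tiling_of T' (ttranslate p x) by apply: PT'; exists p => //; case: mT.
(* The point [x] is interior to both tiles: to [q] because [x] is small, to the translate of [p]
   because it is its puncture. *)
have qE : q = ttranslate p x.
  apply: (partial_tiling_inj hT'.1.1 T'q T'p (y := x)); first exact: eP.
  by apply/interior_ttranslate; have := proto_origin hprotos pp; rewrite subrr.
have [_ x0] := proto_shift hprotos pp pq qE.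
apply: meeting_determined fP _; [exact: hT.1|exact: hT'.1.1|].
by rewrite x0 translate0 in PT'.
Qed.

Local Notation S := (tiling_semigroup T0).
Local Notation X := (set_type (@tight_characters S)).

Lemma tiling_of_tight (T : Om) : tight_characters (@tchar R n L T0 protos (tiling_of T)).
Proof. exact/(tchar_tight hT0 hprotos hflc)/tiling_of_punctured. Qed.

Definition chi (T : Om) : X := exist _ (@tchar R n L T0 protos (tiling_of T)) (mem_set (tiling_of_tight T)).

Lemma chi_inj : injective chi.
Proof.
move=> T T' /(congr1 set_val) E; apply: tiling_of_inj.
by apply: (tchar_inj hprotos hflc) E; exact: tiling_of_punctured.
Qed.

Lemma chi_surj (phi : X) : exists T : Om, phi = chi T.
Proof.
have [T pT phiT] := tight_tchar hT0 hprotos hflc (set_mem (svalP phi)).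
have [T' T'T] := punctured_tiling_of pT; exists T'; apply/val_inj.
by rewrite /= T'T.
Qed.

Lemma tight_dom_chi p P (T : Om) : marked T0 protos p P ->
  tight_dom (nf T0 p P) (chi T) <-> P `<=` tiling_of T.
Proof. exact: tchar_nf. Qed.

(** A nonzero idempotent involves a finite patch, so its value depends only on the tiles meeting
    some ball. *)
Lemma tchar_near (T : Om) (e : S) : nbhs T [set T' : Om |
  @tchar R n L T0 protos (tiling_of T') e = @tchar R n L T0 protos (tiling_of T) e].
Proof.
have [[p [P [mP ->]]]|ne] := pselect (exists p P, marked T0 protos p P /\ e = nf T0 p P); last first.
  apply: filterE => T' /=; suff no A : @tchar R n L T0 protos A e = false by rewrite !no.
  by apply/negP => /(tcharP hprotos)[p [P [mP E _]]]; apply: ne; exists p, P.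
have [_ MP _] := mP.
have [|r r0 rP] := absorb _ (M_finite MP); first by move=> t; exact: M_tile MP.
apply/nbhs_hull_punc; exists r => // T' E /=.
suff sub (A B : set tile) : meeting A (eball 0 r) = meeting B (eball 0 r) -> P `<=` A -> P `<=` B.
  by apply/idP/idP => /(tchar_nf hprotos _ mP) PA; apply/(tchar_nf hprotos _ mP);
    [exact: sub E PA|exact: sub (esym E) PA].
move=> AB PA t Pt; have : meeting A (eball 0 r) t by split; [exact: PA|exact: rP].
by rewrite AB => -[].
Qed.

Lemma chi_continuous : continuous chi.
Proof.
move=> T N /nbhs_initialP[A TA AN].
apply: (@filterS _ (nbhs T) _ [set T' | A (set_val (chi T'))]) => [T' AT'|]; first exact: AN.
suff h : (fun T : Om => @tchar R n L T0 protos (tiling_of T)) @ T --> @tchar R n L T0 protos (tiling_of T).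
  exact: (h A TA).
apply: (cvg_ptws (fmap_filter _ (nbhs_filter T))) => e B TB; apply: filterS (tchar_near T e) => T' /= ->.
exact: nbhs_singleton.
Qed.

Lemma open_chi_nbhs (U : set X) (T : Om) : open U -> U (chi T) ->
  exists2 r : R, 0 < r & forall T' : Om,
    meeting (tiling_of T') (eball 0 r) = meeting (tiling_of T) (eball 0 r) -> U (chi T').
Proof.
move=> oU UT; apply/nbhs_hull_punc; apply: chi_continuous.
exact: open_nbhs_nbhs.
Qed.

Lemma open_tight_dom (e : S) : open (@tight_dom S e).
Proof.
have -> : @tight_dom S e = set_val @^-1` [set phi : {ptws S -> bool} | phi e].
  by [].
exists [set phi : {ptws S -> bool} | phi e] => //.
apply: (@open_comp _ _ (fun phi : {ptws S -> bool} => phi e) [set true]) => [phi _|].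
  exact: (@proj_continuous {classic S} (fun=> bool) e phi).
exact: discrete_open.
Qed.

End HullTopology.

(** * Germs as arrows between punctured tilings *)

Section Groupoids.
Context {R : realType} {n : nat} {L : Type}.
Local Notation V := 'rV[R]_n.
Local Notation tile := (ltile R n L).
Variables T0 protos : set tile.
Hypothesis hT0 : tiling T0.
Hypothesis hprotos : has_prototiles T0 protos.
Hypothesis hflc : finite_local_complexity T0.
Local Notation Om := (hull_punc T0 protos).
Local Notation S := (tiling_semigroup T0).
Local Notation X := (set_type (@tight_characters S)).
Local Notation chi := (chi hT0 hprotos hflc).
Local Notation marked := (marked T0 protos).
Implicit Types (t s p q : tile) (P Q : set tile) (x y z : V) (T : Om).

(* The tile of [T] with puncture at the origin. *)
Definition root T : tile := s2val (cid2 (tiling_of_punctured T).2).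

Lemma root_proto T : protos (root T).
Proof. exact: (s2valP (cid2 (tiling_of_punctured T).2)). Qed.

Lemma root_in T : tiling_of T (root T).
Proof. exact: (s2valP' (cid2 (tiling_of_punctured T).2)). Qed.

Lemma tiling_of_hull T : in_hull T0 (tiling_of T).
Proof. exact: (tiling_of_punctured T).1. Qed.

Lemma root_unique T p : protos p -> tiling_of T p -> p = root T.
Proof.
move=> pp Tp; apply: (proto_unique hprotos (tiling_of_hull T).1.1 pp (root_proto T) Tp).
exact: root_in.
Qed.

Definition shift (T T' : Om) x : Prop := tiling_of T' = translate (tiling_of T) x.

Lemma shiftN T T' x : shift T T' x -> shift T' T (- x).
Proof. by rewrite /shift => ->; rewrite translateK. Qed.

Lemma shiftD T T' T'' x y : shift T T' x -> shift T' T'' y -> shift T T'' (x + y).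
Proof. by rewrite /shift => -> ->; rewrite translateD. Qed.

Lemma root_shift T T' x : shift T T' x -> tiling_of T' (ttranslate (root T) x).
Proof. by move=> ->; exists (root T) => //; exact: root_in. Qed.

Lemma star_smul p P t : marked p P -> P t ->
  smul (sstar (pclass t P p : S)) (pclass t P p) = nf T0 p P.
Proof.
move=> [_ MP _] Pt; rewrite /= pstarE pmulE ?setUid //; first exact: M_appears.
exact: M_tile MP Pt.
Qed.

(* [[t, P, root T]] acts on [chi T] by moving the puncture of [t] to the origin. *)
Definition arrow_rep T t P : Prop := [/\ marked (root T) P, P t & P `<=` tiling_of T].

Lemma arrow_repP T t (fin : tiling_of T t) (A : set tile) : finite_set A -> A `<=` tiling_of T ->
  exists P, arrow_rep T t P /\ A `<=` P.
Proof.
move=> fA AT; have [||r [r0 mr tr]] := @marked_cover _ _ _ _ _ hprotos hflc (tiling_of T)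
    (root T) (t |` A) (tiling_of_hull T) (root_proto T) (root_in T).
- by rewrite finite_setU; split => //; exact: finite_set1.
- by move=> s [->|/AT].
exists (meeting (tiling_of T) (eball 0 r)); split; last by move=> s As; apply: tr; right.
by split => //; [apply: tr; left|exact: meeting_sub].
Qed.

Lemma tight_dom0 T : ~ tight_dom (szero S) (chi T).
Proof.
move=> h; have : @tchar R n L T0 protos (tiling_of T) (szero S) := h.
by rewrite tchar0.
Qed.

Lemma germ_pairP (s : S) T : germ_pair (@tight_dom S) s (chi T) <->
  exists t P, arrow_rep T t P /\ s = pclass t P (root T).
Proof.
split => [[Ss]|[t [P [[mP Pt PT] ->]]]]; last first.
  split; first by right; exists t, P, (root T); case: mP.
  by rewrite star_smul //; apply/tight_dom_chi.
have [->|[p [P [t [mP Pt ->]]]]] := elt_nf hprotos Ss.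
  by rewrite /= pmul0r => /tight_dom0.
rewrite star_smul // => /(tight_dom_chi _ _ _ _ mP) PT.
have [pp _ Pp] := mP; have Ep := root_unique pp (PT _ Pp); subst p.
by exists t, P.
Qed.

(* The germ at [chi T] of any [[t, P, root T]]: it does not depend on [P]. *)
Definition gset T t : set (S * X) :=
  [set w | w.2 = chi T /\ exists P, arrow_rep T t P /\ w.1 = pclass t P (root T)].

(** Two patches [P] and [Q] with the same [t] give elements that agree after multiplication by the
    idempotent of $P \cup Q$. Conversely, equality after multiplication by an idempotent fixes the
    root, hence excludes a translation and forces the same [t]. *)
Lemma germ_gset T t P : arrow_rep T t P ->
  germ (@tight_dom S) (pclass t P (root T)) (chi T) = gset T t.
Proof.
move=> [mP Pt PT]; apply/seteqP; split => -[u y] /=.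
  move=> [+ [yT [e [Ee De E]]]]; rewrite -yT => /germ_pairP[t' [Q [[mQ Qt' QT] Eu]]].
  split => //; exists Q; rewrite Eu in E *.
  have [e0|[p [F [mF Fe]]]] := idempotentP hprotos Ee.
    by move: De; rewrite e0 => /tight_dom0.
  rewrite Fe in De E; move: De => /(tight_dom_chi _ _ _ _ mF) FT.
  have [pp MF Fp] := mF; have Ep := root_unique pp (FT _ Fp); subst p.
  have [_ MP _] := mP; have [_ MQ _] := mQ.
  have ap A : A `<=` tiling_of T -> finite_set A -> appears T0 A.
    by move=> AT fA; exact: hull_appears (tiling_of_hull T) fA AT.
  have fU A B : connected_patches T0 A -> connected_patches T0 B -> finite_set (A `|` B).
    by move=> MA MB; rewrite finite_setU; split; apply: M_finite; eassumption.
  have ht := proto_tile hprotos (root_proto T).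
  move: E; rewrite /= /nf !pmulE //; try (apply: ap; [by rewrite subUset|exact: fU]).
  move=> /pclass_eqP[x [Ex _ /esym/(ttranslate_fixed ht) x0]].
  by rewrite Ex x0 ttranslate0 in Qt' *.
move=> [/= -> [Q [[mQ Qt QT] /= ->]]].
have [_ MP rP] := mP; have [_ MQ rQ] := mQ.
have PQT : P `|` Q `<=` tiling_of T by rewrite subUset.
have aPQ : appears T0 (P `|` Q).
  apply: (hull_appears (tiling_of_hull T)) => //; rewrite finite_setU.
  by split; [exact: M_finite MP|exact: M_finite MQ].
have [mPQ _] := nf_mul hT0 hprotos mP mQ aPQ.
split; [by apply/germ_pairP; exists t, Q|split => //].
exists (nf T0 (root T) (P `|` Q)); split.
- exact: (idempotent_nf hprotos mPQ).
- exact/tight_dom_chi.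
have ht := proto_tile hprotos (root_proto T).
have PPQ : P `|` (P `|` Q) = P `|` Q by rewrite setUA setUid.
have QPQ : Q `|` (P `|` Q) = P `|` Q by rewrite setUCA setUid.
by rewrite /= /nf !pmulE ?PPQ ?QPQ.
Qed.

Lemma gset_inj T T' t t' : tiling_of T t -> gset T t = gset T' t' -> T = T' /\ t = t'.
Proof.
move=> Tt E; have [P [rP _]] := arrow_repP Tt (finite_set0 _) (sub0set _).
have : gset T' t' (pclass t P (root T), chi T) by rewrite -E; split => //; exists P.
move=> [/= /chi_inj TT' [Q [_ ]]]; subst T' => E'; split => //.
move: E' => /pclass_eqP[x [-> _ /esym/(ttranslate_fixed (proto_tile hprotos (root_proto T))) ->]].
by rewrite ttranslate0.
Qed.


(* For [T' = T + x], the germ corresponding to the arrow [(T, T')]. *)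
Definition garr T T' x : set (S * X) := gset T' (ttranslate (root T) x).

Lemma arrow_rep_germ T t P : arrow_rep T t P ->
  germ_pair (@tight_dom S) (pclass t P (root T)) (chi T).
Proof. by move=> rP; apply/germ_pairP; exists t, P. Qed.

Lemma shift_rep T T' x : shift T T' x -> exists P, arrow_rep T' (ttranslate (root T) x) P.
Proof.
move=> /root_shift TT'; have [P [rP _]] := arrow_repP TT' (finite_set0 _) (sub0set _).
by exists P.
Qed.

Lemma is_germ_garr T T' x : shift T T' x -> is_germ (@tight_dom S) (garr T T' x).
Proof.
move=> /shift_rep[P rP]; exists (pclass (ttranslate (root T) x) P (root T')), (chi T').
by split; [exact: arrow_rep_germ|rewrite (germ_gset rP)].
Qed.

Definition garr_germ T T' x (sx : shift T T' x) : germs (@tight_dom S) :=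
  exist _ (garr T T' x) (mem_set (is_germ_garr sx)).

(** Moving the puncture of [t] to the origin yields [T], with the moved [t] as its root; thus every
    germ will be of the form [garr]. *)
Lemma arrow_source T' t : tiling_of T' t -> exists T x, shift T T' x /\ t = ttranslate (root T) x.
Proof.
move=> Tt; have [P [rP _]] := arrow_repP Tt (finite_set0 _) (sub0set _).
have [[_ MP _] Pt _] := rP; have [q pq [x tx]] := M_proto hprotos MP Pt.
have pT : punctured T0 protos (translate (tiling_of T') (- x)).
  split; first exact: in_hull_translate (tiling_of_hull T').
  by exists q => //; apply/translateP; rewrite opprK -tx.
have [T TE] := punctured_tiling_of pT; exists T, x; split.
  by rewrite /shift TE translateNK.
suff -> : root T = q by [].
apply/esym/root_unique => //; rewrite TE; apply/translateP.
by rewrite opprK -tx.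
Qed.

Lemma germ_garr (g : set (S * X)) : is_germ (@tight_dom S) g ->
  exists T T' x, shift T T' x /\ g = garr T T' x.
Proof.
move=> [s [y [sy ->]]]; have [T' yT'] := chi_surj hT0 hprotos hflc y; subst y.
have [t [P [rP ->]]] := (germ_pairP _ _).1 sy; rewrite germ_gset //.
have [_ Pt PT] := rP; have [T [x [sx tE]]] := arrow_source (PT _ Pt).
by exists T, T', x; split => //; rewrite /garr -tE.
Qed.

(** The tile [root T1 + x] recovered from the germ has a unique prototile and puncture; this gives
    [x], and then [T1] as [T2 - x]. *)
Lemma garr_inj T1 T2 x T1' T2' x' : shift T1 T2 x -> shift T1' T2' x' ->
  garr T1 T2 x = garr T1' T2' x' -> [/\ T1 = T1', T2 = T2' & x = x'].
Proof.
move=> sx sx' /(gset_inj (root_shift sx))[ET Et]; subst T2'.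
have E : root T1 = ttranslate (root T1') (x' - x).
  by rewrite -ttranslateD -Et ttranslateK.
have [_ /eqP] := proto_shift hprotos (root_proto T1') (root_proto T1) E.
rewrite subr_eq0 => /eqP Ex; subst x'; split => //.
by apply: tiling_of_inj; apply: (translate_inj (x := x)); rewrite -sx -sx'.
Qed.

(** For [e = nf q Q] the conjugate is zero or, with [q = root T1], the idempotent at [root T] of the
    patch $P \cup (Q + x)$. As [P] lies in [T] already, this patch lies in [T] exactly when [Q] lies
    in [T1]. *)
Lemma tchar_translate T1 T x P (e : S) : shift T1 T x ->
  arrow_rep T (ttranslate (root T1) x) P -> idempotents S e ->
  @tchar R n L T0 protos (tiling_of T1) e =
  @tchar R n L T0 protos (tiling_of T)
    (smul (smul (sstar (pclass (ttranslate (root T1) x) P (root T) : S)) e)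
          (pclass (ttranslate (root T1) x) P (root T))).
Proof.
set t := ttranslate _ _ => sx [mP Pt PT] Ee; rewrite [sstar _]pstarE.
have [_ MP rP] := mP; have ht : is_tile t by exact: M_tile MP Pt.
have [->|[q [Q [mQ ->]]]] := idempotentP hprotos Ee.
  by rewrite /= pmul0r pmul0l !tchar0.
have tE : pclass t (translate Q x) t = nf T0 (root T1) Q by rewrite pclass_translate.
have [pq MQ Qq] := mQ.
have T1T A : A `<=` tiling_of T1 -> translate A x `<=` tiling_of T.
  by rewrite sx; exact: translateS.
have TT1 A : translate A x `<=` tiling_of T -> A `<=` tiling_of T1.
  by rewrite sx => /translate_subl; rewrite translateK.
apply/idP/idP => [/(tchar_nf hprotos _ mQ) QT1|].
  have Eq := root_unique pq (QT1 _ Qq); subst q.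
  have PQT : P `|` translate Q x `<=` tiling_of T by rewrite subUset; split => //; exact: T1T.
  have fPQ : finite_set (P `|` translate Q x).
    by rewrite finite_setU; split; [exact: M_finite MP|apply: finite_image; exact: M_finite MQ].
  have aPQ := hull_appears (tiling_of_hull T) fPQ PQT.
  have PQP : P `|` translate Q x `|` P = P `|` translate Q x by rewrite setUAC setUid.
  rewrite -tE /= !pmulE ?PQP //; apply/(tchar_nf hprotos) => //.
  split; [exact: root_proto| |by left].
  apply: (M_union hT0 MP _ Pt) => //; first exact: M_translate.
  by exists (root T1).
move=> h.
have [w ww] : exists w, pmul T0 (pclass (root T) P t) (pclass q Q q) w.
  apply: contrapT => nw; move: h.
  rewrite [smul (pclass (root T) P t : S) _](_ : _ = set0) ?[smul _ _]pmul0l ?tchar0 //.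
  by apply/seteqP; split => // w ww; apply: nw; exists w.
have [y [ty aPQ]] := pmul_neq0 ht ww.
have E1 : q = ttranslate (root T1) (x - y) by rewrite -ttranslateD -/t ty ttranslateK.
have [qE xy] := proto_shift hprotos (root_proto T1) pq E1.
move/eqP: xy; rewrite subr_eq0 => /eqP xy; subst y; clear E1; subst q.
have PQP : P `|` translate Q x `|` P = P `|` translate Q x by rewrite setUAC setUid.
move: h; rewrite -{1}tE /= !pmulE ?PQP // => /(tchar_nf hprotos).
move=> h; apply/(tchar_nf hprotos _ mQ); apply: TT1; apply: subset_trans (h _); first exact: subsetUr.
split; [exact: root_proto| |by left].
apply: (M_union hT0 MP _ Pt) => //; first exact: M_translate.
by exists (root T1).
Qed.

Lemma tight_act_chi T1 T x P (psi : X) : shift T1 T x ->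
  arrow_rep T (ttranslate (root T1) x) P ->
  tight_act (pclass (ttranslate (root T1) x) P (root T) : S) (chi T) psi <-> psi = chi T1.
Proof.
move=> sx rP; split => [[_ h]|->]; last first.
  by split; [have [] := arrow_rep_germ rP|move=> e Ee; exact: tchar_translate].
apply/val_inj/funext => e.
have [[psiE _ _ _] _] := set_mem (svalP psi).
have [Ee|nE] := pselect (idempotents S e); first by rewrite [LHS]h //; apply/esym/tchar_translate.
(* Off the idempotents both maps are 0, by the encoding of characters. *)
transitivity false; first by apply/negP => /psiE.
by apply/esym/negP => /asboolP[].
Qed.

Lemma arrow_mul T1 T2 T3 x y P Q : shift T1 T2 x -> shift T2 T3 y ->
  arrow_rep T2 (ttranslate (root T1) x) P -> arrow_rep T3 (ttranslate (root T2) y) Q ->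
  arrow_rep T3 (ttranslate (root T1) (x + y)) (translate P y `|` Q) /\
  smul (pclass (ttranslate (root T1) x) P (root T2) : S)
       (pclass (ttranslate (root T2) y) Q (root T3)) =
  pclass (ttranslate (root T1) (x + y)) (translate P y `|` Q) (root T3).
Proof.
move=> sx sy [[_ MP rP] Pt PT] [[_ MQ rQ] Qt QT].
have PQT : translate P y `|` Q `<=` tiling_of T3.
  by rewrite subUset; split => //; rewrite sy; exact: translateS.
have fPQ : finite_set (translate P y `|` Q).
  by rewrite finite_setU; split; [apply: finite_image; exact: M_finite MP|exact: M_finite MQ].
have aPQ := hull_appears (tiling_of_hull T3) fPQ PQT.
split.
  split => //; last by left; rewrite -ttranslateD; exists (ttranslate (root T1) x).
  split; [exact: root_proto| |by right].
  apply: (@M_union _ _ _ _ hT0 _ _ (ttranslate (root T2) y)) => //; first exact: M_translate.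
  by exists (root T2).
(* Translating the first class by [y] brings its last tile onto the first tile of the second
   class. *)
rewrite -(pclass_translate (ttranslate (root T1) x) P (root T2) y) ttranslateD.
by rewrite /= pmulE //; exact: M_tile MQ Qt.
Qed.

Lemma germ_mul_composable (g h k : germs (@tight_dom S)) T1 T2 T2' T3 x y :
  shift T1 T2 x -> shift T2' T3 y -> set_val g = garr T1 T2 x -> set_val h = garr T2' T3 y ->
  germ_mul (@tight_act S) g h k -> T2 = T2' /\ set_val k = garr T1 T3 (x + y).
Proof.
move=> sx sy Eg Eh [s [t [u [v [su tv tvu [gs ht] kst]]]]].
have [A uA] := chi_surj hT0 hprotos hflc u; subst u.
have [B vB] := chi_surj hT0 hprotos hflc v; subst v.
have [a [P [rP Es]]] := (germ_pairP _ _).1 su; subst s.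
have [b [Q [rQ Et]]] := (germ_pairP _ _).1 tv; subst t.
rewrite germ_gset // Eg in gs; rewrite germ_gset // Eh in ht.
have [EA Ea] := gset_inj (root_shift sx) gs; subst A a.
have [EB Eb] := gset_inj (root_shift sy) ht; subst B b.
have /chi_inj ET := (tight_act_chi _ sy rQ).1 tvu; subst T2'.
split => //; have [rPQ E] := arrow_mul sx sy rP rQ.
by rewrite kst E germ_gset.
Qed.

Lemma germ_mul_garr (g h k : germs (@tight_dom S)) T1 T2 T3 x y :
  shift T1 T2 x -> shift T2 T3 y -> set_val g = garr T1 T2 x -> set_val h = garr T2 T3 y ->
  germ_mul (@tight_act S) g h k <-> set_val k = garr T1 T3 (x + y).
Proof.
move=> sx sy Eg Eh; split => [/(germ_mul_composable sx sy Eg Eh)[]//|Ek].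
have [P rP] := shift_rep sx; have [Q rQ] := shift_rep sy.
have [rPQ E] := arrow_mul sx sy rP rQ.
exists (pclass (ttranslate (root T1) x) P (root T2)),
  (pclass (ttranslate (root T2) y) Q (root T3)), (chi T2), (chi T3); split.
- exact: arrow_rep_germ.
- exact: arrow_rep_germ.
- exact/tight_act_chi.
- by rewrite !germ_gset.
- by rewrite E germ_gset.
Qed.

(** [germ_inv] selects some germ from a set given by representatives; by [inv] all of them yield the
    same germ. *)
Lemma germ_inv_garr (g : germs (@tight_dom S)) T1 T2 x :
  shift T1 T2 x -> set_val g = garr T1 T2 x ->
  set_val (germ_inv (@tight_act S) g) = garr T2 T1 (- x).
Proof.
move=> sx Eg.
have inv P : arrow_rep T2 (ttranslate (root T1) x) P ->
    germ (@tight_dom S) (sstar (pclass (ttranslate (root T1) x) P (root T2) : S)) (chi T1) =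
    garr T2 T1 (- x).
  move=> [[_ MP rP] Pt PT].
  rewrite [sstar _]pstarE -(pclass_translate _ _ _ (- x)) ttranslateK germ_gset //.
  split; last by rewrite (shiftN sx); exact: translateS.
    split; [exact: root_proto|exact: M_translate|].
    by apply/translateP; rewrite opprK.
  by exists (root T2).
have [P rP] := shift_rep sx.
pose K := [set h : germs (@tight_dom S) | exists (s : S) u v, [/\ germ_pair (@tight_dom S) s u,
  set_val g = germ (@tight_dom S) s u, tight_act s u v & set_val h = germ (@tight_dom S) (sstar s) v]].
have [h hE] : exists h : germs (@tight_dom S), set_val h = garr T2 T1 (- x).
  by exists (garr_germ (shiftN sx)).
have Kh : K h.
  exists (pclass (ttranslate (root T1) x) P (root T2)), (chi T2), (chi T1); split.
  - exact: arrow_rep_germ.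
  - by rewrite germ_gset.
  - exact/tight_act_chi.
  - by rewrite inv.
have [s [u [v [su gs tvu ->]]]] : K (germ_inv (@tight_act S) g) by apply: (@xgetPex _ g K); exists h.
have [A uA] := chi_surj hT0 hprotos hflc u; subst u.
have [a [Q [rQ Es]]] := (germ_pairP _ _).1 su; subst s.
rewrite germ_gset // Eg in gs.
have [EA Ea] := gset_inj (root_shift sx) gs; subst A a.
have Ev := (tight_act_chi _ sx rQ).1 tvu; subst v.
exact: inv.
Qed.

End Groupoids.

(** * The isomorphism of topological groupoids *)

Lemma nbhs_germ_base (S : invsemigroup) (X : topologicalType) (D : S -> set X)
    (W : set (germs D)) (g : germs D) : germ_base W -> W g -> nbhs g W.
Proof.
move=> bW Wg; rewrite nbhsE; exists W => //; split => //.
exists [set W]; last by rewrite predeqE => h; split=> [[_ ->]|] //; exists W.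
by move=> _ ->; exact: (finI_from1 id bW).
Qed.

Section Isomorphism.
Context {R : realType} {n : nat} {L : Type}.
Local Notation V := 'rV[R]_n.
Local Notation tile := (ltile R n L).
Variables T0 protos : set tile.
Hypothesis hT0 : tiling T0.
Hypothesis hprotos : has_prototiles T0 protos.
Hypothesis hflc : finite_local_complexity T0.
Hypothesis haper : strongly_aperiodic T0.
Local Notation Om := (hull_punc T0 protos).
Local Notation S := (tiling_semigroup T0).
Local Notation chi := (chi hT0 hprotos hflc).
Local Notation garr := (garr hT0 hprotos hflc).
Local Notation arrow := (Rpunc T0 protos).
Implicit Types (t s p q : tile) (P Q : set tile) (x y z : V) (T : Om).

(** The difference of two displacements would be a period of [T]: here strong aperiodicity
    enters. *)
Lemma shift_uniq T T' x y : shift T T' x -> shift T T' y -> x = y.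
Proof.
move=> sx sy; apply: contrapT => xy; apply: (haper (tiling_of_hull T)).
exists (x - y); first by move/eqP; rewrite subr_eq0 => /eqP.
by rewrite -translateD -sx sy translateK.
Qed.

Definition displacement (a : arrow) : V := (Rpunc_coord (a : Rpunc_pairs T0 protos)).2.

Lemma shift_displacement (a : arrow) : shift (sval a).1 (sval a).2 (displacement a).
Proof. by have [x sx] := svalP a; apply: (@xgetPex _ 0 [set x | shift _ _ x]); exists x. Qed.

Lemma displacementE (a : arrow) x : shift (sval a).1 (sval a).2 x -> displacement a = x.
Proof. exact: shift_uniq (shift_displacement a). Qed.

Definition to_germ (a : arrow) : tight_groupoid S :=
  garr_germ hT0 hprotos hflc (shift_displacement a).

Lemma to_germE (a : arrow) :
  set_val (to_germ a) = garr (sval a).1 (sval a).2 (displacement a).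
Proof. by []. Qed.

Lemma arrow_eq (a b : arrow) : sval a = sval b -> a = b.
Proof. by case: a b => [a ha] [b hb] /= E; subst b; congr exist; exact: Prop_irrelevance. Qed.

Lemma to_germ_inj : injective to_germ.
Proof.
move=> a b /(congr1 set_val).
move=> /(garr_inj (shift_displacement a) (shift_displacement b))[E1 E2 _].
by apply: arrow_eq; rewrite [LHS]surjective_pairing E1 E2 -surjective_pairing.
Qed.

Lemma to_germ_surj (g : tight_groupoid S) : exists a, to_germ a = g.
Proof.
have [T [T' [x [sx E]]]] := germ_garr hT0 hprotos hflc (set_mem (svalP g)).
exists (exist _ (T, T') (ex_intro _ x sx)); apply/val_inj.
by rewrite [RHS]E [LHS]to_germE; congr (garr _ _ _); exact: displacementE.
Qed.

Lemma to_germ_mul (a b c : arrow) :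
  gmul a b c <-> gmul (to_germ a) (to_germ b) (to_germ c).
Proof.
have sa := shift_displacement a; have sb := shift_displacement b.
split => [[ab cE]|].
  rewrite -ab in sb.
  have Eb : set_val (to_germ b) = garr (sval a).2 (sval b).2 (displacement b).
    by rewrite to_germE -ab.
  apply: (germ_mul_garr (to_germ c) sa sb (to_germE a) Eb).2.
  have sab := shiftD sa sb.
  rewrite to_germE cE /=; congr (garr _ _ _).
  by apply: displacementE; rewrite cE.
move=> /(germ_mul_composable sa sb (to_germE a) (to_germE b))[ab].
rewrite -ab in sb; rewrite to_germE.
move=> /(garr_inj (shift_displacement c) (shiftD sa sb))[E1 E2 _].
by split => //; rewrite -E1 -E2 -surjective_pairing.
Qed.

Lemma to_germ_ginv (a : arrow) : to_germ (ginv a) = ginv (to_germ a).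
Proof.
have sa := shift_displacement a; apply/val_inj.
rewrite [RHS](germ_inv_garr sa (to_germE a)) [LHS]to_germE.
by congr (garr _ _ _); apply: displacementE; exact: shiftN.
Qed.

Lemma nbhs_arrow (a : arrow) (N : set arrow) : nbhs a N <-> exists r e : R, [/\ 0 < r, 0 < e &
  forall b : arrow, meeting (tiling_of (sval b).1) (eball 0 r) = meeting (tiling_of (sval a).1) (eball 0 r) ->
    `|displacement a - displacement b| < e -> N b].
Proof.
split.
  move=> /nbhs_initialP[A [[A1 A2] /= [n1 n2] sA] AN].
  have [r r0 rP] := (nbhs_hull_punc hprotos hflc _ _).1 n1.
  have /nbhs_ballP[e /= e0 eP] := n2.
  exists r, e; split => // b b1 b2; apply/AN/sA; split; first exact: rP.
  by apply: eP; rewrite -ball_normE.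
move=> [r [e [r0 e0 h]]]; apply/nbhs_initialP.
exists ([set T : Om | meeting (tiling_of T) (eball 0 r) = meeting (tiling_of (sval a).1) (eball 0 r)]
  `*` [set x : V | `|displacement a - x| < e]).
  exists ([set T : Om | meeting (tiling_of T) (eball 0 r) = meeting (tiling_of (sval a).1) (eball 0 r)],
   [set x : V | `|displacement a - x| < e]) => //; split => /=.
    by apply/(nbhs_hull_punc hprotos hflc); exists r.
  by apply/nbhs_ballP; exists e => // x; rewrite -ball_normE.
by move=> b [b1 b2]; exact: h.
Qed.

(** For an arrow [b] near [a], the root of its second tiling and the root of [T2] moved by [x' - x]
    overlap, so that [x' = x]. The displacement is thus locally constant, and agreement of the first
    tilings on a large ball carries over to the second ones. *)
Lemma to_germ_continuous : continuous to_germ.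
Proof.
move=> a; apply: (cvg_germs (fmap_filter _ (nbhs_filter a))) => W [s [U [Ss oU UD ->]]].
move=> [y Uy ga]; have [T yT] := chi_surj hT0 hprotos hflc y; subst y.
have sa := shift_displacement a.
have [t [P [rP Es]]] := (germ_pairP _ _ _ _ _).1 (conj Ss (UD _ Uy)); subst s.
rewrite (germ_gset _ _ _ rP) to_germE in ga.
have [Et Ett] := gset_inj (root_shift sa) ga; subst T t.
set T1 := (sval a).1 in sa rP ga; set T2 := (sval a).2 in sa rP ga Uy.
set x := displacement a in sa rP ga.
have [r1 r10 r1P] := open_chi_nbhs oU Uy.
have [[_ MP rtP] Pt PT] := rP.
have fm := finite_meeting_hull hflc r10 (tiling_of_hull T2).
(* [A] collects what must persist in the second tiling: the patch of the germ and the tiles deciding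
   membership in [U]. It is moved back to [T1], since nearness of arrows is measured on their first
   components. *)
pose A := P `|` meeting (tiling_of T2) (eball 0 r1).
have AT : translate A (- x) `<=` tiling_of T1.
  rewrite (shiftN sa); apply: translateS; rewrite subUset; split => //.
  exact: meeting_sub.
have fA : finite_set (translate A (- x)).
  by apply: finite_image; rewrite finite_setU; split => //; exact: M_finite MP.
have [|r r0 rA] := absorb _ fA.
  by move=> u /AT; case: (tiling_of_hull T1) => -[[+ _] _ _ T1u]; apply.
have [e e0 eP] := protos_ball hprotos.
apply/nbhs_arrow; exists r, e; split => // b.
have sb := shift_displacement b.
set T1' := (sval b).1 in sb *; set T2' := (sval b).2 in sb.
set x' := displacement b in sb * => E xx'.
have AT' : translate A (- x) `<=` tiling_of T1'.
  move=> u Au; have : meeting (tiling_of T1) (eball 0 r) u by split; [exact: AT|exact: rA Au].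
  by rewrite -E => -[].
have T2'r : tiling_of T2' (ttranslate (root T2) (x' - x)).
  rewrite sb addrC -ttranslateD; exists (ttranslate (root T2) (- x)) => //.
  by apply: AT'; exists (root T2) => //; left.
have rE : root T2' = ttranslate (root T2) (x' - x).
  apply: (partial_tiling_inj (tiling_of_hull T2').1.1 (root_in T2') T2'r (y := x' - x)).
    by apply: eP; [exact: root_proto|rewrite distrC].
  apply/interior_ttranslate; rewrite subrr.
  by have := proto_origin hprotos (root_proto T2).
have [rE' /eqP] := proto_shift hprotos (root_proto T2) (root_proto T2') rE.
rewrite subr_eq0 => /eqP x'E.
have AT2' : A `<=` tiling_of T2'.
  by rewrite sb x'E; move: AT' => /translate_subl; rewrite opprK.
have r1E : root T1 = root T1'.
  apply: (root_unique hprotos (root_proto T1)).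
  have : meeting (tiling_of T1) (eball 0 r) (root T1).
    split; [exact: root_in|exists 0; split; last by rewrite /eball /= subrr enorm0].
    by apply: interior_subset; have := proto_origin hprotos (root_proto T1).
  by rewrite -E => -[].
exists (chi T2').
  apply: r1P; apply: (meeting_determined (tiling_of_hull T2).1 (tiling_of_hull T2').1.1 fm).
  by apply: subset_trans AT2' => u; right.
have rP' : arrow_rep T2' (ttranslate (root T1) x) P.
  by split => //; [rewrite -rE'; case: rP|apply: subset_trans AT2' => u; left].
have gE : garr T1' T2' x = gset hT0 hprotos hflc T2' (ttranslate (root T1') x) by [].
by rewrite rE' germ_gset // to_germE -/T1' -/T2' -/x' x'E gE -r1E.
Qed.

(** [P] is chosen to contain the tiles of [T1] near the origin, moved by [x]. Every germ in the
    basic set of [s] then has displacement [x], and its first tiling contains those tiles. *)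
Lemma to_germ_inverse_near (a : arrow) (N : set arrow) : nbhs a N ->
  nbhs (to_germ a) [set g | exists2 b, N b & to_germ b = g].
Proof.
move=> /nbhs_arrow[r [e [r0 e0 aN]]].
have sa := shift_displacement a.
set T1 := (sval a).1 in sa aN; set T2 := (sval a).2 in sa.
set x := displacement a in sa aN.
have fm := finite_meeting_hull hflc r0 (tiling_of_hull T1).
have mT2 : translate (meeting (tiling_of T1) (eball 0 r)) x `<=` tiling_of T2.
  by rewrite sa; apply: translateS; exact: meeting_sub.
have [P [rP mP]] := arrow_repP hprotos hflc (root_shift sa) (finite_image _ fm) mT2.
have sP : isg_elt S (pclass (ttranslate (root T1) x) P (root T2)).
  by have [[_ MP rtP] Pt PT] := rP; right; exists (ttranslate (root T1) x), P, (root T2).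
pose s : S := pclass (ttranslate (root T1) x) P (root T2).
pose U := @tight_dom S (smul (sstar s) s).
have ss : smul (sstar s) s = nf T0 (root T2) P by have [mrP Pt _] := rP; exact: star_smul mrP Pt.
apply: (@filterS _ (nbhs (to_germ a)) _ (germ_basic s U)); last first.
  apply: nbhs_germ_base; first by exists s, U; split => //; exact: open_tight_dom.
  exists (chi T2); first by have [mrP Pt PT] := rP; rewrite /U ss; exact/tight_dom_chi.
  by rewrite to_germE (germ_gset _ _ _ rP).
move=> g [y Uy gE]; have [T2' yT2'] := chi_surj hT0 hprotos hflc y; subst y.
have [mrP Pt PT] := rP; have [_ MP rtP] := mrP.
have PT2' : P `<=` tiling_of T2' by move: Uy; rewrite /U ss => /tight_dom_chi; apply.
have rE := root_unique hprotos (root_proto T2) (PT2' _ rtP).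
have rP' : arrow_rep T2' (ttranslate (root T1) x) P by split => //; rewrite -rE.
move: gE; rewrite /s rE germ_gset // => gE.
have [b bg] := to_germ_surj g; exists b => //.
have sb := shift_displacement b.
have := gE; rewrite -bg to_germE => /(gset_inj (root_shift sb))[E2 E1].
have E : root T1 = ttranslate (root (sval b).1) (displacement b - x).
  by rewrite -ttranslateD E1 ttranslateK.
have [_ /eqP] := proto_shift hprotos (root_proto _) (root_proto T1) E.
rewrite subr_eq0 => /eqP Ex; apply: aN; last by rewrite Ex subrr normr0.
apply: (meeting_determined (tiling_of_hull T1).1 (tiling_of_hull _).1.1 fm).
rewrite (shiftN sb) E2 Ex; apply: subset_trans (translateS PT2').
exact/translate_subl.
Qed.

Theorem Rpunc_tight_iso : topgroupoid_iso arrow (tight_groupoid S).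
Proof.
have [psi psiK] := choice to_germ_surj.
have to_germK : cancel to_germ psi by move=> a; apply: to_germ_inj; rewrite psiK.
exists to_germ, psi; split; last exact: to_germ_ginv.
- by split.
- split; first exact: to_germ_continuous.
  move=> g N /to_germ_inverse_near; rewrite psiK; apply: filterS => _ [b Nb <-].
  by rewrite /= to_germK.
- exact: to_germ_mul.
Qed.

End Isomorphism.

(** * Transport of the groupoid algebra *)

Local Open Scope complex_scope.

(** * The triangle inequality in a Hilbert space *)

Section HilbertNorm.
Context {R : realType} {H : hilbert R}.
Implicit Types (v w : H) (a : R[i]).

Lemma ipDl v w z : ip (v + w) z = ip v z + ip w z.
Proof. by have := ip_linear 1 v w z; rewrite scale1r mul1r. Qed.

Lemma ip0l z : ip (0 : H) z = 0.
Proof. by have := ipDl 0 0 z; rewrite addr0 => /eqP; rewrite -subr_eq0 opprD addNKr oppr_eq0 => /eqP. Qed.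

Lemma ipZl a v z : ip (a *: v) z = a * ip v z.
Proof. by have := ip_linear a v 0 z; rewrite addr0 ip0l addr0. Qed.

(** A real inner product with the same norm; its Cauchy-Schwarz inequality suffices for the triangle
    inequality. *)
Definition rip v w : R := complex.Re (ip v w).

Lemma ripC v w : rip v w = rip w v.
Proof. by rewrite /rip ip_conj; case: (ip w v). Qed.

Lemma ripDl v w z : rip (v + w) z = rip v z + rip w z.
Proof. by rewrite /rip ipDl; case: (ip v z) (ip w z) => [? ?] [? ?]. Qed.

Lemma ripZl (r : R) v z : rip (r%:C *: v) z = r * rip v z.
Proof. by rewrite /rip ipZl; case: (ip v z) => a b /=; rewrite mul0r subr0. Qed.

Lemma rip_ge0 v : 0 <= rip v v.
Proof. by have := ip_ge0 v; rewrite /rip; case: (ip v v) => a b; rewrite lecE /= => /andP[]. Qed.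

Lemma rip_eq0 v : rip v v = 0 -> v = 0.
Proof.
move=> v0; apply: ip_eq0; have := ip_ge0 v; move: v0; rewrite /rip.
case: (ip v v) => a b /= ->; rewrite lecE /= => /andP[/eqP b0 _].
by apply/eqP; rewrite eq_complex /= b0 !eqxx.
Qed.

Lemma rip_cauchy_schwarz v w : rip v w ^+ 2 <= rip v v * rip w w.
Proof.
have [v0|v0] := eqVneq (rip v v) 0.
  by have -> := rip_eq0 v0; rewrite /rip !ip0l /= expr0n /= mul0r.
have vp : 0 < rip v v by rewrite lt_neqAle eq_sym v0 rip_ge0.
pose t := - (rip v w / rip v v).
have := rip_ge0 (t%:C *: v + w).
rewrite ripDl ripZl ripC ripDl ripZl [rip w (_ + _)]ripC ripDl ripZl.
rewrite (_ : t * _ + _ = rip w w - rip v w ^+ 2 / rip v v); last by rewrite /t [rip w v]ripC; field.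
by rewrite subr_ge0 ler_pdivrMr // mulrC.
Qed.

Lemma hnorm_triangle v w : hnorm (v + w) <= hnorm v + hnorm w.
Proof.
have cs : rip v w <= hnorm v * hnorm w.
  rewrite /hnorm -sqrtrM ?rip_ge0 // -/(rip _ _) (le_trans (ler_norm _)) //.
  by rewrite -sqrtr_sqr ler_sqrt ?mulr_ge0 ?rip_ge0 //; exact: rip_cauchy_schwarz.
rewrite -[leRHS]ger0_norm ?addr_ge0 ?sqrtr_ge0 // -sqrtr_sqr ler_sqrt ?sqr_ge0 //.
rewrite sqrrD !sqr_sqrtr ?rip_ge0 // -!/(rip _ _) ripDl [rip v (_ + _)]ripC ripDl.
rewrite [rip w (_ + _)]ripC ripDl [rip w v]ripC mulr2n; lra.
Qed.

Lemma hnormN v : hnorm (- v) = hnorm v.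
Proof.
rewrite /hnorm -!/(rip _ _) -scaleN1r; congr Num.sqrt.
have -> : -1 = (-1)%:C :> R[i] by rewrite rmorphN rmorph1.
by rewrite ripZl ripC ripZl mulrA mulrNN mulr1 mul1r.
Qed.

End HilbertNorm.

Section MaxNorm.
Context {R : realType} {G : topgroupoid}.
Implicit Types u w : G -> R[i].

Lemma rep_sub (H : hilbert R) (pi : (G -> R[i]) -> H -> H) u w v :
  star_rep pi -> Cc u -> Cc w -> pi (w \- u) v = pi w v - pi u v.
Proof.
move=> rp Cu Cw; have := rep_linear rp Cu Cw (-1) v.
rewrite scaleN1r addrC => <-; congr pi; apply/funext => x /=.
by rewrite mulN1r addrC.
Qed.

(** The triangle inequality is stated with sums only, because the supremum lives in the extended
    reals. *)
Lemma max_norm_leD u w : Cc u -> Cc w ->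
  (max_norm u <= max_norm w + max_norm (w \- u)%R)%E /\
  (max_norm w <= max_norm u + max_norm (w \- u)%R)%E.
Proof.
move=> Cu Cw; split; apply: ge_ereal_sup => _ [H [pi [v [rp v1 ->]]]].
  apply: (@le_trans _ _ ((hnorm (pi w v))%:E + (hnorm (pi (w \- u) v))%:E)%E).
    rewrite -EFinD lee_fin (rep_sub _ rp Cu Cw) -[hnorm (_ - _)]hnormN opprB.
    by rewrite -{1}(subrK (pi w v) (pi u v)) addrC hnorm_triangle.
  by apply: leeD; apply: ereal_sup_ubound; exists H, pi, v.
apply: (@le_trans _ _ ((hnorm (pi u v))%:E + (hnorm (pi (w \- u) v))%:E)%E).
  rewrite -EFinD lee_fin (rep_sub _ rp Cu Cw).
  by rewrite -{1}(subrK (pi u v) (pi w v)) addrC hnorm_triangle.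
by apply: leeD; apply: ereal_sup_ubound; exists H, pi, v.
Qed.

End MaxNorm.

Lemma cvge_close (R : realType) (f g d : nat -> \bar R) (l : \bar R) :
  (forall k, f k <= g k + d k)%E -> (forall k, g k <= f k + d k)%E ->
  d @ \oo --> 0%E -> f @ \oo --> l -> g @ \oo --> l.
Proof.
move=> fg gf d0 fl.
have fD : (fun k => f k + d k)%E @ \oo --> l.
  by rewrite -[l]adde0; apply: cvgeD => //; rewrite /adde_def /= ?andbF //; case: (l).
have fB : (fun k => f k - d k)%E @ \oo --> l.
  rewrite -[l]sube0; apply: cvgeB => //.
  by rewrite /adde_def /= ?andbF //; case: (l).
apply: (squeeze_cvge _ fB fD).
(* The error is eventually finite, which is what allows it to be subtracted in the extended
   reals. *)
have /fine_cvgP[dfin _] : d @ \oo --> (0%R)%:E := d0.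
apply: filterS dfin => k dk; apply/andP; split; last exact: gf.
by rewrite leeBlDr.
Qed.

(** The content of [topgroupoid_iso] with both maps named, so that the transport lemmas can exchange
    their roles. *)
Definition groupoid_homeo (G H : topgroupoid) (phi : G -> H) (psi : H -> G) : Prop :=
  [/\ cancel phi psi /\ cancel psi phi,
      continuous phi /\ continuous psi,
      (forall a b c, gmul a b c <-> gmul (phi a) (phi b) (phi c)) &
      (forall a, phi (ginv a) = ginv (phi a))].

Lemma groupoid_homeo_sym (G H : topgroupoid) (phi : G -> H) (psi : H -> G) :
  groupoid_homeo phi psi -> groupoid_homeo psi phi.
Proof.
move=> [[K K'] [c c'] m i]; split => //.
  by move=> x y z; rewrite m !K'.
by move=> x; apply: (can_inj K); rewrite i !K'.
Qed.

(** * Functions, convolution and involution along an isomorphism *)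

Section Transport.
Context {R : realType} (G H : topgroupoid) (phi : G -> H) (psi : H -> G).
Hypothesis hom : groupoid_homeo phi psi.
Implicit Types (f g : G -> R[i]).

Let phiK : cancel phi psi. Proof. by case: hom => -[]. Qed.
Let psiK : cancel psi phi. Proof. by case: hom => -[]. Qed.
Let cphi : continuous phi. Proof. by case: hom => _ []. Qed.
Let cpsi : continuous psi. Proof. by case: hom => _ []. Qed.

Lemma Cc_transport f : Cc f -> Cc (f \o psi).
Proof.
move=> [m [h [hU ->]]]; exists m, (fun i => h i \o psi); split => // i.
have [U [oU hausU [[K [cK KU fK]] ch]]] := hU i.
exists (psi @^-1` U); split.
- by apply: open_comp => // x _; exact: cpsi.
- move=> x y Ux Uy xy; have [|V [W [oV oW Vx Wy VW]]] := hausU _ _ Ux Uy.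
    by move=> E; apply: xy; apply: (can_inj psiK).
  exists (psi @^-1` V), (psi @^-1` W); split => //.
  + by apply: open_comp => // z _; exact: cpsi.
  + by apply: open_comp => // z _; exact: cpsi.
  + apply/seteqP; split => // z [[Uz Vz] Wz].
    suff : (set0 : set G) (psi z) by [].
    by rewrite -VW.
- split.
    exists (phi @` K); split.
    + by apply: continuous_compact => //; exact: continuous_subspaceT.
    + by move=> _ [z Kz <-]; rewrite /= phiK; exact: KU.
    + move=> x Kx; apply: fK => Kpx; apply: Kx.
      by exists (psi x).
  move=> x Ux; apply: (@continuous_comp H G (R[i])^o psi (h i)); first exact: cpsi.
  exact: ch.
Qed.

Lemma convolution_transport f g :
  convolution (f \o psi) (g \o psi) = convolution f g \o psi.
Proof.
apply/funext => c; rewrite /convolution /=.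
pose k (p : G * G) : H * H := (phi p.1, phi p.2).
rewrite (reindex_fsbig k [set p : G * G | gmul p.1 p.2 (psi c)]).
  by apply: eq_fsbigr => p _; rewrite /= !phiK.
have [_ _ m _] := hom; split.
- by move=> p /=; rewrite m psiK.
- move=> [a b] [a' b'] _ _ [/(can_inj phiK) -> /(can_inj phiK) ->] //.
- move=> [a b] /= ab; exists (psi a, psi b); last by rewrite /k /= !psiK.
  by rewrite /= m !psiK.
Qed.

Lemma invol_transport f : invol (f \o psi) = invol f \o psi.
Proof.
apply/funext => c; rewrite /invol /=; congr (f _)^*.
by have [_ _ _ i] := groupoid_homeo_sym hom; rewrite i.
Qed.

End Transport.

Section TransportNorm.
Context {R : realType} (G H : topgroupoid).

(** Representations of one algebra are composed with the transport of functions to give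
    representations of the other; this compares the two suprema. *)
Lemma star_rep_transport (phi : G -> H) (psi : H -> G) (hom : groupoid_homeo phi psi)
    (K : hilbert R) (pi : (H -> R[i]) -> K -> K) :
  star_rep pi -> star_rep (fun f : G -> R[i] => pi (f \o psi)).
Proof.
move=> [l b rl rc ri]; split => [f Cf|f Cf|f g Cf Cg|f g Cf Cg|f Cf].
- exact/l/(Cc_transport hom).
- exact/b/(Cc_transport hom).
- by move=> a v; apply: rl; exact: (Cc_transport hom).
- by move=> v; rewrite -(convolution_transport hom); apply: rc; exact: (Cc_transport hom).
- by move=> v w; rewrite -(invol_transport hom); apply: ri; exact: (Cc_transport hom).
Qed.

Lemma max_norm_transport_le (phi : G -> H) (psi : H -> G) (f : G -> R[i]) :
  groupoid_homeo phi psi -> (max_norm (f \o psi) <= max_norm f)%E.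
Proof.
move=> hom; apply: ge_ereal_sup => _ [K [pi [v [rp v1 ->]]]].
apply: ereal_sup_ubound; exists K, (fun f : G -> R[i] => pi (f \o psi)), v; split => //.
exact: star_rep_transport hom _ _ rp.
Qed.

End TransportNorm.

(** * The induced map on completions *)

Section TransportCstar.
Context {R : realType} (G H : topgroupoid) (phi : G -> H) (psi : H -> G).
Hypothesis hom : groupoid_homeo phi psi.

Let phiK : cancel phi psi. Proof. by case: hom => -[]. Qed.
Let psiK : cancel psi phi. Proof. by case: hom => -[]. Qed.

Let comp_phiK (f : G -> R[i]) : (f \o psi) \o phi = f.
Proof. by apply/funext => x /=; rewrite phiK. Qed.
Let comp_psiK (f : H -> R[i]) : (f \o phi) \o psi = f.
Proof. by apply/funext => x /=; rewrite psiK. Qed.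

Lemma max_norm_transport (f : G -> R[i]) : max_norm (f \o psi) = max_norm f.
Proof.
apply/le_anti/andP; split; first exact: max_norm_transport_le hom.
by rewrite -{1}(comp_phiK f); exact: max_norm_transport_le (groupoid_homeo_sym hom).
Qed.

Lemma Cc_transportE (f : G -> R[i]) : Cc (f \o psi) <-> Cc f.
Proof.
split => [/(Cc_transport (groupoid_homeo_sym hom))|/(Cc_transport hom)//].
by rewrite comp_phiK.
Qed.

Definition push (u : nat -> G -> R[i]) : nat -> H -> R[i] := fun k => u k \o psi.
Definition pull (u : nat -> H -> R[i]) : nat -> G -> R[i] := fun k => u k \o phi.

Lemma pushK u : pull (push u) = u.
Proof. by apply/funext => k; exact: comp_phiK. Qed.

Lemma pullK u : push (pull u) = u.
Proof. by apply/funext => k; exact: comp_psiK. Qed.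

Lemma Cc_cauchy_push u : Cc_cauchy (push u) <-> Cc_cauchy u.
Proof.
have E m k : max_norm (push u m \- push u k) = max_norm (u m \- u k).
  exact: max_norm_transport (u m \- u k).
split => -[Cu cu]; split.
- by move=> k; apply/Cc_transportE; exact: Cu.
- by move=> e /cu[N NP]; exists N => m k mN kN; rewrite -E; exact: NP.
- by move=> k; apply/Cc_transportE; exact: Cu.
- by move=> e /cu[N NP]; exists N => m k mN kN; rewrite E; exact: NP.
Qed.

Lemma cauchy_class_push u v : cauchy_class (push u) (push v) <-> cauchy_class u v.
Proof.
rewrite /cauchy_class /=.
have -> : (fun k => max_norm (push u k \- push v k)) = (fun k => max_norm (u k \- v k)).
  by apply/funext => k; exact: max_norm_transport (u k \- v k).
by split => -[/Cc_cauchy_push Cv uv]; split.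
Qed.

(** Taking the preimage of a class under [push] avoids a choice of representative; the map goes from
    classes over [H] to classes over [G]. *)
Definition cstar_pull (A : set (nat -> H -> R[i])) : set (nat -> G -> R[i]) :=
  [set v | A (push v)].

Lemma cstar_pull_class u : cstar_pull (cauchy_class u) = cauchy_class (pull u).
Proof.
have E v : cauchy_class u (push v) <-> cauchy_class (pull u) v.
  by rewrite -{1}(pullK u); exact: cauchy_class_push.
by apply/seteqP; split => v /E.
Qed.

Lemma cstar_pull_bij : set_bij (cstar R H) (cstar R G) cstar_pull.
Proof.
split.
- move=> _ [u Cu ->]; exists (pull u); last exact: cstar_pull_class.
  by apply/Cc_cauchy_push; rewrite pullK.
- move=> A B _ _ AB; apply/seteqP; split => v Av.
    have : cstar_pull A (pull v) by rewrite /cstar_pull /= pullK.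
    by rewrite AB /cstar_pull /= pullK.
  have : cstar_pull B (pull v) by rewrite /cstar_pull /= pullK.
  by rewrite -AB /cstar_pull /= pullK.
- move=> _ [u Cu ->]; exists (cauchy_class (push u)).
    by exists (push u) => //; apply/Cc_cauchy_push.
  by rewrite cstar_pull_class pushK.
Qed.

Lemma cstar_pull_iso A B : cstar R H A -> cstar R H B ->
  [/\ cstar_pull (cstar_add A B) = cstar_add (cstar_pull A) (cstar_pull B),
      forall a, cstar_pull (cstar_scale a A) = cstar_scale a (cstar_pull A),
      cstar_pull (cstar_mul A B) = cstar_mul (cstar_pull A) (cstar_pull B) &
      cstar_pull (cstar_star A) = cstar_star (cstar_pull A)].
Proof.
move=> _ _; split => [|a||].
- apply/seteqP; split => w.
    move=> [u [v [Au Bv uvw]]]; exists (pull u), (pull v); split; rewrite /cstar_pull /= ?pullK //.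
    by apply/cauchy_class_push; move: uvw; rewrite -{1}(pullK u) -{1}(pullK v).
  by move=> [u [v [Au Bv uvw]]]; exists (push u), (push v); split => //; exact: (cauchy_class_push _ _).2 uvw.
- apply/seteqP; split => w.
    move=> [u Au uw]; exists (pull u); rewrite /cstar_pull /= ?pullK //.
    by apply/cauchy_class_push; move: uw; rewrite -{1}(pullK u).
  by move=> [u Au uw]; exists (push u) => //; exact: (cauchy_class_push _ _).2 uw.
- apply/seteqP; split => w.
    move=> [u [v [Au Bv uvw]]]; exists (pull u), (pull v); split; rewrite /cstar_pull /= ?pullK //.
    apply/cauchy_class_push; move: uvw; rewrite -{1}(pullK u) -{1}(pullK v).
    rewrite (_ : (fun k => convolution _ _) = push (fun k => convolution (pull u k) (pull v k))) //.
    by apply/funext => k; exact: (convolution_transport hom).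
  move=> [u [v [Au Bv uvw]]]; exists (push u), (push v); split => //.
  rewrite (_ : (fun k => convolution _ _) = push (fun k => convolution (u k) (v k))).
    exact/cauchy_class_push.
  by apply/funext => k; exact: (convolution_transport hom).
- apply/seteqP; split => w.
    move=> [u Au uw]; exists (pull u); rewrite /cstar_pull /= ?pullK //.
    apply/cauchy_class_push; move: uw; rewrite -{1}(pullK u).
    rewrite (_ : (fun k => invol _) = push (fun k => invol (pull u k))) //.
    by apply/funext => k; exact: (invol_transport hom).
  move=> [u Au uw]; exists (push u) => //.
  rewrite (_ : (fun k => invol _) = push (fun k => invol (u k))).
    exact/cauchy_class_push.
  by apply/funext => k; exact: (invol_transport hom).
Qed.

End TransportCstar.

(** The two sequences of norms have the same set of limits, from which [lim] makes the same
    choice. *)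
Lemma cauchy_class_lim (R : realType) (G : topgroupoid) (u0 u : nat -> G -> R[i]) :
  Cc_cauchy u0 -> cauchy_class u0 u ->
  lim (max_norm (u k) @[k --> \oo]) = lim (max_norm (u0 k) @[k --> \oo]).
Proof.
move=> [C0 _] [[Cu _] d0].
have le k := max_norm_leD (Cu k) (C0 k).
rewrite /lim /lim_in; congr (get _); apply/seteqP; split => l.
  exact: (cvge_close (fun k => (le k).1) (fun k => (le k).2) d0).
exact: (cvge_close (fun k => (le k).2) (fun k => (le k).1) d0).
Qed.

Theorem cstar_iso_of_groupoid_iso (R : realType) (G H : topgroupoid) :
  topgroupoid_iso G H -> cstar_iso R H G.
Proof.
move=> [phi [psi hom]]; exists (cstar_pull psi); split; first exact: cstar_pull_bij hom.
move=> A B hA hB; have [hadd hscale hmul hstar] := cstar_pull_iso hom hA hB; split => //.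
move=> u v; have [u0 C0 ->] := hA => uA.
rewrite (cstar_pull_class hom) => vA.
have C0' : Cc_cauchy (pull phi u0) by apply/(Cc_cauchy_push hom); rewrite (pullK hom).
rewrite (cauchy_class_lim C0 uA) (cauchy_class_lim C0' vA).
suff -> : (fun k => max_norm (pull phi u0 k)) = (fun k => max_norm (u0 k)) by [].
apply/funext => k; rewrite -(max_norm_transport hom (pull phi u0 k)).
by rewrite -[in RHS](pullK hom u0).
Qed.

Theorem theorem3 (R : realType) (n : nat) (L : Type)
    (T0 protos : set (ltile R n L))
    (hT0 : tiling T0) (hprotos : has_prototiles T0 protos)
    (haper : strongly_aperiodic T0) (hrep : repetitive T0)
    (hflc : finite_local_complexity T0) :
  topgroupoid_iso (Rpunc T0 protos) (tight_groupoid (tiling_semigroup T0)) /\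
  cstar_iso R (tight_groupoid (tiling_semigroup T0)) (Rpunc T0 protos).
Proof.
have iso := Rpunc_tight_iso hT0 hprotos hflc haper.
by split => //; exact: cstar_iso_of_groupoid_iso iso.
Qed.
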